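(* Let $\mathfrak R=(\mathcal R,d_{\mathcal R})$ be a unital DG commutative algebra over a field $\mathbb K$ of characteristic zero. An $L_\infty[1]$ $\mathfrak R$-algebra $(V;d_V,q_2,q_3,\ldots)$ is linearizable as an $L_\infty[1]$ $\mathfrak R$-algebra, i.e. is isomorphic as an $L_\infty[1]$ $\mathfrak R$-algebra to $(V;d_V,0,0,\ldots)$, if and only if the short exact sequence of DG $\mathfrak R$-modules $$0\to\big(F^1\mathrm{coDer}_{\mathcal R}(S_{\mathcal R}(V)),\mathcal L_{D}\big)\to\big(\mathrm{coDer}_{\mathcal R}(S_{\mathcal R}(V)),\mathcal L_{D}\big)\xrightarrow{\ \mathrm{ev}_1\ }(V,d_V)\to0$$ splits in the category of DG $\mathfrak R$-modules. Here $D=\widetilde{d_V}+Q$ is the codifferential on $S_{\mathcal R}(V)$ encoding the $L_\infty[1]$ $\mathfrak R$-algebra structure, $\mathcal L_D=[D,-]$, and $\mathrm{ev}_1(\phi)=\phi(1_{\mathcal R})$.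
   Context: DG $\mathfrak R$-module: a graded $\mathcal R$-module $V$ with a degree $+1$ differential $d_V$, $d_V^2=0$, $d_V(rx)=d_{\mathcal R}(r)x+(-1)^{|r|}r\,d_V(x)$. Morphisms are degree $0$ $\mathcal R$-linear cochain maps. $L_\infty[1]$ $\mathfrak R$-algebra: a DG $\mathfrak R$-module $(V,d_V)$ with graded symmetric $\mathcal R$-multilinear maps $q_n:V^{\odot_{\mathcal R}n}\to V$ of degree $1$, $n\ge2$, such that (with $q_1:=d_V$) for all $n\ge2$, $\sum_{i=1}^n\sum_{\sigma\in Sh(i,n-i)}\epsilon(\sigma)\,q_{n-i+1}(q_i(x_{\sigma(1)},\ldots,x_{\sigma(i)}),x_{\sigma(i+1)},\ldots,x_{\sigma(n)})=0$, where $\epsilon(\sigma)$ is the Koszul sign and $Sh$ denotes shuffles. $L_\infty[1]$ $\mathfrak R$-morphism $F=(f_1,f_2,\ldots):(V,d_V,q_2,\ldots)\to(W,d_W,r_2,\ldots)$: graded symmetric $\mathcal R$-multilinear maps $f_n:V^{\odot_{\mathcal R}n}\to W$ of degree $0$, $n\ge 1$, such that (with $q_1=d_V,r_1=d_W$) for all $n\ge1$ $$\sum_{k=1}^n\sum_{i_1+\cdots+i_k=n}\frac1{k!}\sum_{\sigma\in Sh(i_1,\ldots,i_k)}\epsilon(\sigma)r_k(f_{i_1}(x_{\sigma(1)},\ldots),\ldots,f_{i_k}(\ldots,x_{\sigma(n)}))=\sum_{j=1}^n\sum_{\sigma\in Sh(j,n-j)}\epsilon(\sigma)f_{n-j+1}(q_j(x_{\sigma(1)},\ldots,x_{\sigma(j)}),x_{\sigma(j+1)},\ldots,x_{\sigma(n)}).$$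 Composition is the usual one for $L_\infty[1]$ morphisms; an isomorphism is an invertible morphism (equivalently $f_1$ is bijective). $S_{\mathcal R}(V)=\bigoplus_{n\ge0}V^{\odot_{\mathcal R}n}$ (with $V^{\odot 0}=\mathcal R$) carries the standard cofree graded cocommutative $\mathcal R$-coalgebra structure, with $\Delta$ given by the sum over unshuffles. $\mathrm{coDer}_{\mathcal R}(S_{\mathcal R}(V))$ is the graded $\mathcal R$-module of $\mathcal R$-linear coderivations. A coderivation $\phi$ is determined by its corestriction $(\phi_0,\phi_1,\ldots)$, $\phi_n\in\mathrm{Hom}_{\mathcal R}(V^{\odot_{\mathcal R}n},V)$, obtained by composing with the projection $S_{\mathcal R}(V)\to V$. $F^1\mathrm{coDer}_{\mathcal R}(S_{\mathcal R}(V))$ is the subspace of those with $\phi_0=0$; one has $\phi(1_{\mathcal R})=\phi_0(1_{\mathcal R})\in V$. $\widetilde{d_V}$ is the (non-$\mathcal R$-linear) extension of $d_V$ to $S_{\mathcal R}(V)$: $\widetilde{d_V}(r)=d_{\mathcal R}(r)$ for $r\in\mathcal R$ and $\widetilde{d_V}(x_1\odot\cdots\odot x_n)=\sum_{\sigma\in Sh(1,n-1)}\epsilon(\sigma)d_V(x_{\sigma(1)})\odot x_{\sigma(2)}\odot\cdots\odot x_{\sigma(n)}$. $Q\in\mathrm{coDer}^1_{\mathcal R}(S_{\mathcal R}(V))$ is the coderivation with corestriction $(0,0,q_2,q_3,\ldots)$. $[\cdot,\cdot]$ is the graded commutator. With $D=\widetilde{d_V}+Q$, $\mathcal L_D=[D,-]$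 is a differential making $\mathrm{coDer}_{\mathcal R}(S_{\mathcal R}(V))$ a DG $\mathfrak R$-module. *)

(* Defs.v *)
From HB Require Import structures.
From mathcomp Require Import all_boot all_order all_algebra generic_quotient.
From mathcomp Require Import ring boolp functions.
Set Implicit Arguments.
Unset Strict Implicit.
Unset Printing Implicit Defensive.
Import GRing.Theory.
Local Open Scope ring_scope.
Local Open Scope quotient_scope.

(* Koszul sign (-1)^n; it acts on modules through *~. *)
Definition ksg (n : int) : int := (-1) ^ n.

Lemma ksgD m n : ksg (m + n) = ksg m * ksg n.
Proof. by rewrite /ksg exprzDr. Qed.
Lemma ksgK n : ksg n * ksg n = 1.
Proof. by rewrite /ksg -exprzMl ?mulrNN ?mulr1 ?exp1rz. Qed.
Lemma ksgN n : ksg (- n) = ksg n.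
Proof. by rewrite -[LHS]mulr1 -(ksgK n) mulrA -ksgD addNr /ksg expr0z mul1r. Qed.

(* The abelian group presented by generators X and relators Rel: formal
   Z-linear combinations of generators, two of them being identified when every
   map from X to an abelian group that kills the relators takes the same value
   on both. *)
Section Presentation.
Variables (X : choiceType) (Rel : seq (int * X) -> Prop).

Definition fev (M : zmodType) (g : X -> M) (l : seq (int * X)) : M :=
  \sum_(t <- l) g t.2 *~ t.1.

Definition respects (M : zmodType) (g : X -> M) : Prop :=
  forall l, Rel l -> fev g l = 0.

Definition peq (l l' : seq (int * X)) : bool :=
  `[< forall (M : zmodType) (g : X -> M), respects g -> fev g l = fev g l' >].

Lemma peq_refl : reflexive peq.
Proof. by move=> l; apply/asboolP. Qed.
Lemma peq_sym : symmetric peq.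
Proof.
by move=> l l'; apply/idP/idP => /asboolP h; apply/asboolP => M g hg; rewrite h.
Qed.
Lemma peq_trans : transitive peq.
Proof.
move=> l2 l1 l3 /asboolP h /asboolP h'; apply/asboolP => M g hg.
by rewrite h // h'.
Qed.
Canonical peq_equiv := EquivRel peq peq_refl peq_sym peq_trans.

Definition pres : Type := {eq_quot peq_equiv}.
HB.instance Definition _ := EqQuotient.on pres.
HB.instance Definition _ := Choice.on pres.

(* Meaningful when [g] respects the relators; see [plift_gen] and [pliftD]. *)
Definition plift (M : zmodType) (g : X -> M) (z : pres) : M := fev g (repr z).

Lemma plift_pi (M : zmodType) (g : X -> M) l :
  respects g -> plift g (\pi_pres l) = fev g l.
Proof.
by move=> hg; rewrite /plift; case: piP => l' /eqmodP /asboolP /(_ M g hg) ->.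
Qed.

Lemma pres_eq (z z' : pres) :
  (forall (M : zmodType) (g : X -> M), respects g -> plift g z = plift g z') ->
  z = z'.
Proof.
move=> h; rewrite -(reprK z) -(reprK z'); apply/eqmodP/asboolP => M g hg.
exact: h.
Qed.

Definition pzero : pres := \pi_pres [::].
Definition padd (z z' : pres) : pres := \pi_pres (repr z ++ repr z').
Definition popp (z : pres) : pres := \pi_pres [seq (- t.1, t.2) | t <- repr z].
Definition gen (x : X) : pres := \pi_pres [:: (1, x)].

Lemma plift_zero (M : zmodType) (g : X -> M) : respects g -> plift g pzero = 0.
Proof. by move=> hg; rewrite plift_pi // /fev big_nil. Qed.
Lemma plift_add (M : zmodType) (g : X -> M) z z' :
  respects g -> plift g (padd z z') = plift g z + plift g z'.
Proof. by move=> hg; rewrite plift_pi // /fev big_cat. Qed.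
Lemma plift_opp (M : zmodType) (g : X -> M) z :
  respects g -> plift g (popp z) = - plift g z.
Proof.
move=> hg; rewrite plift_pi // /fev big_map -sumrN.
by apply: eq_bigr => t _; rewrite mulrNz.
Qed.

Lemma paddA : associative padd.
Proof. by move=> x y z; apply: pres_eq => M g hg; rewrite !plift_add // addrA. Qed.
Lemma paddC : commutative padd.
Proof. by move=> x y; apply: pres_eq => M g hg; rewrite !plift_add // addrC. Qed.
Lemma padd0 : left_id pzero padd.
Proof. by move=> x; apply: pres_eq => M g hg; rewrite plift_add // plift_zero // add0r. Qed.
Lemma paddN : left_inverse pzero popp padd.
Proof.
move=> x; apply: pres_eq => M g hg.
by rewrite plift_add // plift_opp // plift_zero // addNr.
Qed.
HB.instance Definition _ := GRing.isZmodule.Build pres paddA paddC padd0 paddN.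

Lemma plift_gen (M : zmodType) (g : X -> M) x : respects g -> plift g (gen x) = g x.
Proof. by move=> hg; rewrite plift_pi // /fev big_seq1. Qed.
Lemma plift0 (M : zmodType) (g : X -> M) : respects g -> plift g 0 = 0.
Proof. exact: plift_zero. Qed.
Lemma pliftD (M : zmodType) (g : X -> M) : respects g -> {morph plift g : z z' / z + z'}.
Proof. by move=> hg z z'; apply: plift_add. Qed.
Lemma pliftB (M : zmodType) (g : X -> M) : respects g -> {morph plift g : z z' / z - z'}.
Proof. by move=> hg z z'; rewrite pliftD //; congr (_ + _); apply: plift_opp. Qed.

Lemma morphD_mulrz (M M' : zmodType) (f : M -> M') :
  {morph f : x y / x + y} -> forall x n, f (x *~ n) = f x *~ n.
Proof.
move=> fD.
have f0 : f 0 = 0 by apply: (addrI (f 0)); rewrite -fD !addr0.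
have fN x : f (- x) = - f x by apply: (addrI (f x)); rewrite -fD !subrr.
have fn x n : f (x *+ n) = f x *+ n.
  by elim: n => [|n IHn]; rewrite ?mulr0n // !mulrS fD IHn.
by move=> x [n|n]; rewrite ?NegzE ?mulrNz ?fN -!pmulrn fn.
Qed.

Lemma gen_rel l : Rel l -> fev gen l = 0.
Proof.
move=> hl; apply: pres_eq => M g hg.
rewrite plift0 // -(hg l hl) /fev (big_morph (plift g) (pliftD hg) (plift0 hg)).
by apply: eq_bigr => t _; rewrite (morphD_mulrz (pliftD hg)) plift_gen.
Qed.

Lemma pres_repr z : z = fev gen (repr z).
Proof.
apply: pres_eq => M g hg.
rewrite [in RHS]/fev (big_morph (plift g) (pliftD hg) (plift0 hg)).
by apply: eq_bigr => t _; rewrite (morphD_mulrz (pliftD hg)) plift_gen.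
Qed.

Lemma pres_ext (M : zmodType) (f h : pres -> M) :
  {morph f : x y / x + y} -> {morph h : x y / x + y} ->
  (forall x, f (gen x) = h (gen x)) -> f =1 h.
Proof.
move=> fD hD e z; have f0 : f 0 = 0 by apply: (addrI (f 0)); rewrite -fD !addr0.
have h0 : h 0 = 0 by apply: (addrI (h 0)); rewrite -hD !addr0.
rewrite [z]pres_repr /fev (big_morph f fD f0) (big_morph h hD h0).
by apply: eq_bigr => t _; rewrite (morphD_mulrz fD) (morphD_mulrz hD) e.
Qed.
End Presentation.

(* An internal direct sum decomposition A = \bigoplus_i A_i over the integers,
   given by its projections; [homog i x] below means x \in A_i. *)
Record grading (A : zmodType) := Grading {
  gproj : int -> A -> A;
  gprojD : forall i, {morph gproj i : x y / x + y};
  gprojK : forall i j x, gproj i (gproj j x) = if i == j then gproj j x else 0;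
  gfin : forall x, exists2 s : seq int, uniq s & x = \sum_(i <- s) gproj i x }.

Section Grading.
Variables (A : zmodType) (G : grading A).

Definition homog (i : int) (x : A) : bool := gproj G i x == x.
(* The parity involution x |-> (-1)^|x| x, extended additively. *)
Definition ginv (x : A) : A :=
  \sum_(i <- s2val (cid2 (gfin G x))) gproj G i x *~ ksg i.

Lemma gproj0 i : gproj G i 0 = 0.
Proof. by apply: (addrI (gproj G i 0)); rewrite -gprojD !addr0. Qed.
Lemma gprojMz i x n : gproj G i (x *~ n) = gproj G i x *~ n.
Proof. exact: (morphD_mulrz (@gprojD _ G i)). Qed.
Lemma gprojN i x : gproj G i (- x) = - gproj G i x.
Proof. by apply: (addrI (gproj G i x)); rewrite -gprojD !subrr gproj0. Qed.
Lemma gproj_sum i (I : Type) (r : seq I) (F : I -> A) :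
  gproj G i (\sum_(j <- r) F j) = \sum_(j <- r) gproj G i (F j).
Proof. exact: (big_morph _ (@gprojD _ G i) (gproj0 i)). Qed.
Lemma gproj_homog i x : homog i (gproj G i x).
Proof. by rewrite /homog gprojK eqxx. Qed.
Lemma homogE i x : homog i x -> gproj G i x = x.
Proof. by move/eqP. Qed.
Lemma gproj_ext x y : (forall i, gproj G i x = gproj G i y) -> x = y.
Proof.
move=> h; apply/eqP; rewrite -subr_eq0; apply/eqP.
have [s _ ->] := gfin G (x - y).
by rewrite big1 // => i _; rewrite gprojD gprojN h subrr.
Qed.
Lemma gproj_homog_neq i j x : homog j x -> i != j -> gproj G i x = 0.
Proof. by move=> /homogE <- /negPf; rewrite gprojK => ->. Qed.
Lemma gproj_ginv i x : gproj G i (ginv x) = gproj G i x *~ ksg i.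
Proof.
rewrite /ginv; case: (cid2 _) => s us e /=.
rewrite [in RHS]e !gproj_sum mulrz_suml; apply: eq_bigr => j _.
by rewrite gprojMz gprojK; case: eqP => [->|] //; rewrite !mul0rz.
Qed.
Lemma ginvD : {morph ginv : x y / x + y}.
Proof.
move=> x y; apply: gproj_ext => i.
by rewrite gprojD !gproj_ginv gprojD mulrzDl.
Qed.
Lemma ginv_homog i x : homog i x -> ginv x = x *~ ksg i.
Proof.
move=> hx; apply: gproj_ext => j; rewrite gproj_ginv gprojMz.
by case: (eqVneq j i) => [->|/gproj_homog_neq ->] //; rewrite !mul0rz.
Qed.
Lemma homog0 i : homog i 0.
Proof. by rewrite /homog gproj0. Qed.
Lemma homogD i x y : homog i x -> homog i y -> homog i (x + y).
Proof. by rewrite /homog gprojD => /eqP -> /eqP ->. Qed.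
Lemma homogMz i x n : homog i x -> homog i (x *~ n).
Proof. by rewrite /homog gprojMz => /eqP ->. Qed.
Lemma grade_ext (M : zmodType) (f h : A -> M) :
  {morph f : x y / x + y} -> {morph h : x y / x + y} ->
  (forall i x, homog i x -> f x = h x) -> f =1 h.
Proof.
move=> fD hD e x; have f0 : f 0 = 0 by apply: (addrI (f 0)); rewrite -fD !addr0.
have h0 : h 0 = 0 by apply: (addrI (h 0)); rewrite -hD !addr0.
have [s _ ->] := gfin G x.
rewrite (big_morph f fD f0) (big_morph h hD h0).
by apply: eq_bigr => i _; rewrite (e i) // gproj_homog.
Qed.
End Grading.

(* Unital DG commutative K-algebras (the zero ring is allowed, whence pzRingType
   together with a structure morphism instead of algType). *)
Record dgca (K : fieldType) := Dgca {
  dga_ring :> pzRingType;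
  dga_unit : {rmorphism K -> dga_ring};
  dga_gr : grading dga_ring;
  dga_unit0 : forall c, homog dga_gr 0 (dga_unit c);
  dga_mul : forall i j a b,
    homog dga_gr i a -> homog dga_gr j b -> homog dga_gr (i + j) (a * b);
  dga_comm : forall i j a b,
    homog dga_gr i a -> homog dga_gr j b -> a * b = (b * a) *~ ksg (i * j);
  dga_d : dga_ring -> dga_ring;
  dga_dD : {morph dga_d : a b / a + b};
  dga_dZ : forall c a, dga_d (dga_unit c * a) = dga_unit c * dga_d a;
  dga_d1 : forall i a, homog dga_gr i a -> homog dga_gr (i + 1) (dga_d a);
  dga_dd : forall a, dga_d (dga_d a) = 0;
  dga_dM : forall i a b, homog dga_gr i a ->
    dga_d (a * b) = dga_d a * b + (a * dga_d b) *~ ksg i }.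

Record dgmod (K : fieldType) (R : dgca K) := Dgmod {
  dgm_car :> lmodType R;
  dgm_gr : grading dgm_car;
  dgm_act : forall i j (a : R) (x : dgm_car),
    homog (dga_gr R) i a -> homog dgm_gr j x -> homog dgm_gr (i + j) (a *: x);
  dgm_d : dgm_car -> dgm_car;
  dgm_dD : {morph dgm_d : x y / x + y};
  dgm_d1 : forall i x, homog dgm_gr i x -> homog dgm_gr (i + 1) (dgm_d x);
  dgm_dd : forall x, dgm_d (dgm_d x) = 0;
  dgm_dM : forall i (a : R) x, homog (dga_gr R) i a ->
    dgm_d (a *: x) = dga_d a *: x + (a *: dgm_d x) *~ ksg i }.

Definition homR (K : fieldType) (R : dgca K) (i : int) (a : R) : bool :=
  homog (dga_gr R) i a.
Definition homm (K : fieldType) (R : dgca K) (V : dgmod R) (i : int) (x : V) : bool :=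
  homog (dgm_gr V) i x.

Section Words.
Variables (K : fieldType) (R : dgca K) (V : dgmod R).

(* The letter (i, x) of a word stands for the degree i component of x; in an
   [hword] every x is homogeneous of the degree i it is tagged with. *)
Definition word := seq (int * V).
Definition deg (w : word) : int := \sum_(t <- w) t.1.
Definition hword (w : word) : bool := all (fun t => homm t.1 t.2) w.

(* Permutations are in one-line notation s = [:: s(1); ...; s(n)] (values in
   0..n-1); [koszul ds s] is the sign eps with
   x_1 o ... o x_n = eps * x_s(1) o ... o x_s(n) when |x_i| = ds_i. *)
Fixpoint koszul (ds : seq int) (s : seq nat) : int :=
  if s is a :: s' then
    (\prod_(b <- s' | (b < a)%N) ksg (ds`_a * ds`_b)) * koszul ds s'
  else 1.

(* Sh(i_1, ..., i_k) for sh = [:: i_1; ...; i_k]: increasing on each block. *)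
Definition shuffles (sh : seq nat) : seq (seq nat) :=
  [seq s <- permutations (iota 0 (sumn sh)) | all (sorted ltn) (reshape sh s)].

(* \sum_(s in Sh(sh)) eps(s) F(block_1, ..., block_k), where block_j is the word of
   the letters x_s(l), l ranging over the j-th block of positions. *)
Definition shsum (M : zmodType) (sh : seq nat) (w : word)
    (F : seq word -> M) : M :=
  \sum_(s <- shuffles sh)
     F (reshape sh [seq nth (0, 0) w j | j <- s]) *~ koszul (unzip1 w) s.

Definition sh2sum (M : zmodType) (i : nat) (w : word) (F : word -> word -> M) : M :=
  shsum [:: i; size w - i]%N w (fun bs => F (nth [::] bs 0) (nth [::] bs 1)).

End Words.

(* Recursive enumeration of the unshuffles of a list into two sublists, used to
   prove the well-definedness of the maps on symmetric powers. *)
Fixpoint usp (T : Type) (l : seq T) : seq (seq T * seq T) :=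
  if l is x :: l' then
    [seq (x :: p.1, p.2) | p <- usp l'] ++ [seq (p.1, x :: p.2) | p <- usp l']
  else [:: ([::], [::])].

Section Unshuffle.
Variable (A : eqType).
Implicit Types (l s : seq A) (p : seq A * seq A).

Lemma usp_perm l p : p \in usp l -> perm_eq (p.1 ++ p.2) l.
Proof.
elim: l p => [|x l IH] p /=; first by rewrite inE => /eqP ->.
rewrite mem_cat => /orP[] /mapP[p' /IH h ->] /=; first by rewrite perm_cons.
by rewrite -cat1s perm_catCA /= perm_cons.
Qed.

Lemma usp_uniq l : uniq l -> uniq (usp l).
Proof.
elim: l => [|x l IH] //= /andP[xl /IH u]; rewrite cat_uniq !map_inj_uniq ?u /=;
  try by move=> [a b] [c d] /= [-> ->].
rewrite andbT; apply/hasPn => _ /mapP[p hp ->]; apply/mapP => -[p' hp' [e _]].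
by move: xl; rewrite -(perm_mem (usp_perm hp)) mem_cat e inE eqxx.
Qed.
End Unshuffle.

Lemma mem_usp (l : seq nat) (p : seq nat * seq nat) : sorted ltn l ->
  (p \in usp l) = [&& perm_eq (p.1 ++ p.2) l, sorted ltn p.1 & sorted ltn p.2].
Proof.
elim: l p => [|x l IH] [a b] /= sl.
  rewrite inE; apply/eqP/and3P => [[-> ->] //|[/perm_nilP]].
  by case: a => //= ->.
have sl' := path_sorted sl.
have /allP xl : all (ltn x) l by apply: order_path_min sl; exact: ltn_trans.
have xnl : x \notin l by apply/negP => /xl /=; rewrite ltnn.
have pth c : {subset c <= l} -> path ltn x c = sorted ltn c.
  by move=> h; rewrite path_sortedE; [case: (sorted ltn c); rewrite ?andbF // andbT; apply/allP => y /h /xl | exact: ltn_trans].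
apply/idP/and3P.
  rewrite mem_cat => /orP[] /mapP[p']; rewrite IH // => /and3P[hp s1 s2] [-> ->] /=.
    rewrite perm_cons; split=> //; rewrite pth // => y hy.
    by rewrite -(perm_mem hp) mem_cat hy.
  rewrite -cat1s perm_catCA /= perm_cons; split=> //; rewrite pth // => y hy.
  by rewrite -(perm_mem hp) mem_cat hy orbT.
case=> hp sa sb; rewrite mem_cat.
have minx y c : x \in y :: c -> path ltn y c -> y \in x :: l -> y = x.
  rewrite !inE => /orP[/eqP ->//|xc] pc /orP[/eqP ->//|/xl /= xy].
  have /allP /(_ _ xc) /= : all (ltn y) c by apply: order_path_min pc; exact: ltn_trans.
  by move=> yx; have := ltn_trans xy yx; rewrite ltnn.
have: x \in a ++ b by rewrite (perm_mem hp) inE eqxx.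
rewrite mem_cat => /orP[xa|xb]; apply/orP; [left|right].
  case: a xa sa hp => // y a' xa /= sa hp.
  have e : y = x by apply: minx xa sa _; rewrite -(perm_mem hp) inE eqxx.
  subst y; apply/mapP; exists (a', b) => //; rewrite IH //= sb andbT.
  by move: hp; rewrite perm_cons => ->; rewrite (path_sorted sa).
case: b xb sb hp => // y b' xb /= sb hp.
have e : y = x by apply: minx xb sb _; rewrite -(perm_mem hp) mem_cat inE eqxx orbT.
subst y; apply/mapP; exists (a, b') => //; rewrite IH //= sa (path_sorted sb) !andbT.
by move: hp; rewrite -cat1s perm_catCA /= perm_cons.
Qed.

Lemma shuffles2 i n : (i <= n)%N ->
  perm_eq [seq (take i s, drop i s) | s <- shuffles [:: i; n - i]%N]
          [seq p <- usp (iota 0 n) | size p.1 == i].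
Proof.
move=> lin.
have en : sumn [:: i; n - i]%N = n by rewrite /= addn0 subnKC.
have rs s : perm_eq s (iota 0 n) -> reshape [:: i; n - i]%N s = [:: take i s; drop i s].
  move=> /perm_size; rewrite size_iota /= => hs.
  by rewrite [take (n - i) _]take_oversize // size_drop hs.
apply: uniq_perm.
- rewrite map_inj_in_uniq; first by rewrite filter_uniq // permutations_uniq.
  by move=> s s' _ _ [e1 e2]; rewrite -(cat_take_drop i s) e1 e2 cat_take_drop.
- by rewrite filter_uniq // usp_uniq // iota_uniq.
have si := iota_ltn_sorted 0 n.
move=> [a b]; rewrite mem_filter mem_usp //=; apply/mapP/idP.
  case=> s; rewrite mem_filter en mem_permutations => /andP[].
  move=> + hp; rewrite rs //= => /and3P[s1 s2 _] [-> ->].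
  rewrite cat_take_drop hp s1 s2 !andbT size_takel //.
  by rewrite (perm_size hp) size_iota.
case/and4P=> /eqP sa hp s1 s2; exists (a ++ b).
  by rewrite mem_filter en mem_permutations hp rs //= -sa take_size_cat // drop_size_cat //= s1 s2.
by rewrite -sa take_size_cat // drop_size_cat.
Qed.

Section UnshuffleSum.
Variables (K : fieldType) (R : dgca K) (V : dgmod R) (M : zmodType).
Implicit Types (w : word V) (F : word V -> word V -> M).

Fixpoint tsum w F : M :=
  if w is x :: w' then
    tsum w' (fun b1 b2 => F (x :: b1) b2) +
    tsum w' (fun b1 b2 => F b1 (x :: b2) *~ ksg (x.1 * deg b1))
  else F [::] [::].

Lemma deg_cons (x : int * V) w : deg (x :: w) = x.1 + deg w.
Proof. by rewrite /deg big_cons. Qed.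
Lemma deg_cat w w' : deg (w ++ w') = deg w + deg w'.
Proof. by rewrite /deg big_cat. Qed.
Lemma deg_nil : deg ([::] : word V) = 0.
Proof. by rewrite /deg big_nil. Qed.

Lemma eq_tsum w F F' :
  (forall b1 b2, (size b1 + size b2)%N = size w -> deg b1 + deg b2 = deg w ->
     F b1 b2 = F' b1 b2) ->
  tsum w F = tsum w F'.
Proof.
elim: w F F' => [|x w IH] F F' h /=; first by apply: h; rewrite ?deg_nil ?addr0.
congr (_ + _); apply: IH => b1 b2 hs hd.
  by apply: h; rewrite /= ?addSn ?hs // !deg_cons -addrA hd.
by rewrite h //= ?addnS ?hs // !deg_cons addrCA hd.
Qed.

Lemma tsum_sum w (I : Type) (r : seq I) (F : I -> word V -> word V -> M) :
  tsum w (fun b1 b2 => \sum_(i <- r) F i b1 b2) = \sum_(i <- r) tsum w (F i).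
Proof.
elim: w F => [|x w IH] F //=; rewrite big_split /= -!IH; congr (_ + _).
by apply: eq_tsum => b1 b2 _ _; rewrite mulrz_suml.
Qed.

Lemma koszul_insert (ds : seq int) m s1 s2 :
  (forall a, a \in s1 -> m < a)%N -> (forall a, a \in s2 -> m < a)%N ->
  koszul ds (s1 ++ m :: s2) =
  koszul ds (s1 ++ s2) * ksg (ds`_m * \sum_(a <- s1) ds`_a).
Proof.
move=> h1 h2; elim: s1 h1 => [|a s1 IH] h1 /=.
  rewrite big_nil mulr0 /ksg expr0z mulr1 big_seq_cond big1 ?mul1r // => b.
  by case/andP => /h2 /ltnW; rewrite leqNgt => /negPf ->.
rewrite IH; last by move=> b hb; apply: h1; rewrite inE hb orbT.
rewrite big_cat big_cons (h1 a (mem_head _ _)) /= big_cons [in RHS]big_cat /=.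
rewrite mulrDr ksgD [ds`_a * ds`_m]mulrC; ring.
Qed.

Lemma tsumE (pre w : word V) F :
  \sum_(p <- usp (iota (size pre) (size w)))
     F [seq nth (0, 0) (pre ++ w) j | j <- p.1] [seq nth (0, 0) (pre ++ w) j | j <- p.2]
       *~ koszul (unzip1 (pre ++ w)) (p.1 ++ p.2)
  = tsum w F.
Proof.
elim: w pre F => [|x w IH] pre F /=; first by rewrite big_seq1 /= mulr1z.
have nx : nth (0, 0) (pre ++ x :: w) (size pre) = x.
  by rewrite nth_cat ltnn subnn.
have mem p b : p \in usp (iota (size pre).+1 (size w)) -> b \in p.1 ++ p.2 ->
   (size pre < b < size (pre ++ x :: w))%N.
  move=> /usp_perm /perm_mem ->; rewrite mem_iota size_cat /= addnS => /andP[-> /=].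
  by rewrite addSn.
have mem1 p b : p \in usp (iota (size pre).+1 (size w)) -> b \in p.1 ->
   (size pre < b < size (pre ++ x :: w))%N.
  by move=> hp hb; apply: mem hp _; rewrite mem_cat hb.
have mem2 p b : p \in usp (iota (size pre).+1 (size w)) -> b \in p.2 ->
   (size pre < b < size (pre ++ x :: w))%N.
  by move=> hp hb; apply: mem hp _; rewrite mem_cat hb orbT.
have {}IH F' := IH (rcons pre x) F'.
rewrite size_rcons in IH; rewrite big_cat !big_map /=; congr (_ + _).
  rewrite -IH cat_rcons; apply: eq_big_seq => p hp /=; rewrite nx.
  rewrite [X in X * _]big_seq_cond [X in X * _]big1 ?mul1r // => b.
  by case/andP => /(mem _ _ hp)/andP[/ltnW]; rewrite leqNgt => /negPf ->.
rewrite -IH cat_rcons; apply: eq_big_seq => p hp /=; rewrite nx.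
rewrite koszul_insert; first last.
- by move=> a /(mem2 _ _ hp) /andP[].
- by move=> a /(mem1 _ _ hp) /andP[].
rewrite (mulrC (koszul _ _)) mulrzA; congr (_ *~ _); congr (_ *~ ksg _).
rewrite (nth_map (0, 0)) ?nx; last by rewrite size_cat /= addnS ltnS leq_addr.
congr (_ * _); rewrite /deg big_map big_seq [RHS]big_seq; apply: eq_bigr => a ha.
by rewrite (nth_map (0, 0)) //; case/andP: (mem1 _ _ hp ha).
Qed.

Lemma sh2sumE i w F : (i <= size w)%N ->
  sh2sum i w F = tsum w (fun b1 b2 => if size b1 == i then F b1 b2 else 0).
Proof.
move=> hi; rewrite -(tsumE [::]) /=.
rewrite /sh2sum /shsum -[RHS](big_rmcond_in (fun p : seq nat * seq nat => size p.1 == i)).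
  2: by move=> p _ /negPf h; rewrite size_map h mul0rz.
rewrite -big_filter -(perm_big _ (shuffles2 hi)) /= big_map.
rewrite big_seq [RHS]big_seq; apply: eq_bigr => s.
rewrite mem_filter mem_permutations /= addn0 subnKC // => /andP[_ /perm_size].
rewrite size_iota => hs; rewrite cat_take_drop size_map size_takel ?hs // eqxx.
congr (F _ _ *~ _); rewrite ?map_take //.
by rewrite map_drop take_oversize // size_drop size_map hs.
Qed.

Lemma sh2sum_from m w F :
  \sum_(m <= i < (size w).+1) sh2sum i w F =
  tsum w (fun b1 b2 => if (m <= size b1)%N then F b1 b2 else 0).
Proof.
under eq_big_nat => i /andP[_ hi] do rewrite sh2sumE //.
rewrite -tsum_sum; apply: eq_tsum => b1 b2 hs _.
case: leqP => hm; last first.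
  rewrite big_nat big1 // => i /andP[hi _]; case: eqP => // e.
  by move: hm; rewrite e ltnNge hi.
rewrite (bigD1_seq (size b1)) ?iota_uniq ?mem_index_iota ?ltnS -?hs ?leq_addr ?hm //=.
by rewrite eqxx big1 ?addr0 // => i; rewrite eq_sym => /negPf ->.
Qed.

Lemma sh2sum_all w F :
  \sum_(0 <= i < (size w).+1) sh2sum i w F = tsum w F.
Proof. exact: sh2sum_from. Qed.
End UnshuffleSum.

Section TsumTheory.
Variables (K : fieldType) (R : dgca K) (V : dgmod R) (M : zmodType).
Implicit Types (w : word V) (F : word V -> word V -> M) (G : int * V -> word V -> M).

Lemma tsumMz w F n : tsum w (fun b1 b2 => F b1 b2 *~ n) = tsum w F *~ n.
Proof.
elim: w F => [|x w IH] F //=; rewrite mulrzDl -!IH; congr (_ + _).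
by apply: eq_tsum => b1 b2 _ _; rewrite mulrzAC.
Qed.

Lemma tsumD w F F' :
  tsum w (fun b1 b2 => F b1 b2 + F' b1 b2) = tsum w F + tsum w F'.
Proof.
elim: w F F' => [|x w IH] F F' //=; rewrite addrACA; congr (_ + _); rewrite -IH //.
by apply: eq_tsum => b1 b2 _ _; rewrite mulrzDl.
Qed.

Lemma tsum_slotD w1 i x y w2 F :
  (forall u1 u2 b, F (u1 ++ (i, x + y) :: u2) b =
     F (u1 ++ (i, x) :: u2) b + F (u1 ++ (i, y) :: u2) b) ->
  (forall b u1 u2, F b (u1 ++ (i, x + y) :: u2) =
     F b (u1 ++ (i, x) :: u2) + F b (u1 ++ (i, y) :: u2)) ->
  tsum (w1 ++ (i, x + y) :: w2) F =
    tsum (w1 ++ (i, x) :: w2) F + tsum (w1 ++ (i, y) :: w2) F.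
Proof.
elim: w1 F => [|z w1 IH] F h1 h2 /=.
  rewrite [RHS]addrACA; congr (_ + _); rewrite -tsumD; apply: eq_tsum => b1 b2 _ _.
    exact: (h1 [::]).
  by rewrite -mulrzDl (h2 _ [::]).
rewrite [RHS]addrACA; congr (_ + _); apply: IH => [u1 u2 b|b u1 u2].
- exact: (h1 (z :: _)).
- exact: h2.
- have e c : deg (u1 ++ (i, c) :: u2) = deg u1 + (i + deg u2).
    by rewrite deg_cat deg_cons.
  by rewrite h1 mulrzDl !e.
- by rewrite (h2 _ (z :: _)) mulrzDl.
Qed.

Lemma tsum_slotE w1 i x y w2 F :
  (forall u1 u2 b, F (u1 ++ (i, x) :: u2) b = F (u1 ++ (i, y) :: u2) b) ->
  (forall b u1 u2, F b (u1 ++ (i, x) :: u2) = F b (u1 ++ (i, y) :: u2)) ->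
  tsum (w1 ++ (i, x) :: w2) F = tsum (w1 ++ (i, y) :: w2) F.
Proof.
elim: w1 F => [|z w1 IH] F h1 h2 /=.
  congr (_ + _); apply: eq_tsum => b1 b2 _ _; first exact: (h1 [::]).
  by rewrite (h2 _ [::]).
congr (_ + _); apply: IH => [u1 u2 b|b u1 u2].
- exact: (h1 (z :: _)).
- exact: h2.
- have e c : deg (u1 ++ (i, c) :: u2) = deg u1 + (i + deg u2).
    by rewrite deg_cat deg_cons.
  by rewrite h1 !e.
- by rewrite (h2 _ (z :: _)).
Qed.

Lemma tsum_slotZ w1 k (a : R) i x w2 F F' e :
  (forall u1 u2 b, F (u1 ++ (k + i, a *: x) :: u2) b =
     F' (u1 ++ (i, x) :: u2) b *~ ksg (k * (deg u1 + e))) ->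
  (forall b u1 u2, F b (u1 ++ (k + i, a *: x) :: u2) =
     F' b (u1 ++ (i, x) :: u2) *~ ksg (k * (deg b + deg u1 + e))) ->
  tsum (w1 ++ (k + i, a *: x) :: w2) F =
    tsum (w1 ++ (i, x) :: w2) F' *~ ksg (k * (deg w1 + e)).
Proof.
elim: w1 F F' e => [|z w1 IH] F F' e h1 h2 /=.
  rewrite deg_nil add0r mulrzDl -!tsumMz; congr (_ + _); apply: eq_tsum => b1 b2 _ _.
    by rewrite (h1 [::]) deg_nil add0r.
  rewrite (h2 _ [::]) deg_nil addr0 /= -!mulrzA; congr (_ *~ _).
  rewrite !mulrDr !mulrDl !ksgD.
  transitivity (ksg (k * deg b1) * ksg (k * deg b1) * (ksg (i * deg b1) * ksg (k * e))).
    ring.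
  by rewrite ksgK mul1r.
rewrite mulrzDl deg_cons; congr (_ + _).
  rewrite (IH _ (fun b1 b2 => F' (z :: b1) b2) (z.1 + e)) => [|u1 u2 b|b u1 u2].
  - by congr (_ *~ ksg _); ring.
  - by rewrite (h1 (z :: _)) deg_cons; congr (_ *~ ksg _); ring.
  - by rewrite h2 deg_cons; congr (_ *~ ksg _); ring.
rewrite (IH _ (fun b1 b2 => F' b1 (z :: b2) *~ ksg (z.1 * deg b1)) (z.1 + e))
  => [|u1 u2 b|b u1 u2].
- by congr (_ *~ ksg _); ring.
- rewrite h1 -!mulrzA -!ksgD; congr (_ *~ ksg _); rewrite !deg_cat !deg_cons /=; ring.
- rewrite (h2 _ (z :: _)) deg_cons -!mulrzA -!ksgD; congr (_ *~ ksg _); ring.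
Qed.

Lemma tsum_swap w1 i x j y w2 F :
  (forall u1 u2 b, F (u1 ++ (i, x) :: (j, y) :: u2) b =
     F (u1 ++ (j, y) :: (i, x) :: u2) b *~ ksg (i * j)) ->
  (forall b u1 u2, F b (u1 ++ (i, x) :: (j, y) :: u2) =
     F b (u1 ++ (j, y) :: (i, x) :: u2) *~ ksg (i * j)) ->
  tsum (w1 ++ (i, x) :: (j, y) :: w2) F =
    tsum (w1 ++ (j, y) :: (i, x) :: w2) F *~ ksg (i * j).
Proof.
elim: w1 F => [|z w1 IH] F h1 h2 /=.
  rewrite !mulrzDl addrACA; congr (_ + _ + (_ + _)).
  - by rewrite -tsumMz; apply: eq_tsum => b1 b2 _ _; exact: (h1 [::]).
  - rewrite -tsumMz; apply: eq_tsum => b1 b2 _ _.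
    by rewrite deg_cons -mulrzA -ksgD; congr (_ *~ ksg _); ring.
  - rewrite -tsumMz; apply: eq_tsum => b1 b2 _ _.
    rewrite deg_cons -mulrzA; congr (_ *~ _).
    by rewrite mulrDr ksgD [j * i]mulrC mulrAC ksgK mul1r.
  - rewrite -tsumMz; apply: eq_tsum => b1 b2 _ _.
    by rewrite (h2 _ [::]) /= -!mulrzA -!ksgD; congr (_ *~ ksg _); ring.
rewrite mulrzDl; congr (_ + _); apply: IH => [u1 u2 b|b u1 u2].
- exact: (h1 (z :: _)).
- exact: h2.
- by rewrite h1 mulrzAC !deg_cat !deg_cons /= [i + (j + _)]addrCA.
- by rewrite (h2 _ (z :: _)) mulrzAC.
Qed.

Fixpoint esum w G : M :=
  if w is x :: w' then
    G x w' + esum w' (fun t b => G t (x :: b) *~ ksg (x.1 * t.1))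
  else 0.

Lemma eq_esum w G G' : (forall t b, G t b = G' t b) -> esum w G = esum w G'.
Proof.
elim: w G G' => [|x w IH] G G' h //=.
by rewrite h; congr (_ + _); apply: IH => t b; rewrite h.
Qed.

Lemma tsum_nil w (G : word V -> M) :
  tsum w (fun b1 b2 => if b1 is [::] then G b2 else 0) = G w.
Proof.
elim: w G => [|x w IH] G //=.
have -> : tsum w (fun _ _ => 0) = 0 :> M.
  rewrite -[RHS](mulr0z (tsum w (fun _ _ => 0))) -tsumMz.
  by apply: eq_tsum => ? ? _ _; rewrite mul0rz.
rewrite add0r -[RHS](IH (fun b => G (x :: b))); apply: eq_tsum => b1 b2 _ _.
by case: b1 => [|? ?]; rewrite ?mul0rz // deg_nil mulr0 /ksg expr0z mulr1z.
Qed.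

Lemma tsum_single w G :
  tsum w (fun b1 b2 => if b1 is [:: t] then G t b2 else 0) = esum w G.
Proof.
elim: w G => [|x w IH] G //=; rewrite -[G x w](tsum_nil w (G x)); congr (_ + _).
rewrite -IH; apply: eq_tsum => b1 b2 _ _; case: b1 => [|t [|? ?]]; rewrite ?mul0rz //.
by rewrite deg_cons deg_nil addr0.
Qed.

Lemma esumMz w G n : esum w (fun t b => G t b *~ n) = esum w G *~ n.
Proof.
elim: w G => [|x w IH] G /=; first by rewrite mul0rz.
rewrite mulrzDl -!IH; congr (_ + _).
by apply: eq_esum => t b; rewrite mulrzAC.
Qed.

Lemma esumD w G G' :
  esum w (fun t b => G t b + G' t b) = esum w G + esum w G'.
Proof.
elim: w G G' => [|x w IH] G G' /=; first by rewrite addr0.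
rewrite [RHS]addrACA; congr (_ + _); rewrite -IH.
by apply: eq_esum => t b; rewrite mulrzDl.
Qed.

Lemma esum_slotZ w1 k (a : R) i x w2 G G' (C : word V -> M) e :
  (forall t u1 u2, G t (u1 ++ (k + i, a *: x) :: u2) =
     G' t (u1 ++ (i, x) :: u2) *~ ksg (k * (t.1 + deg u1 + e))) ->
  (forall b, G (k + i, a *: x) b = G' (i, x) b *~ ksg (k * e) + C b) ->
  esum (w1 ++ (k + i, a *: x) :: w2) G =
    esum (w1 ++ (i, x) :: w2) G' *~ ksg (k * (deg w1 + e)) +
    C (w1 ++ w2) *~ ksg ((k + i) * deg w1).
Proof.
elim: w1 G G' C e => [|z w1 IH] G G' C e h1 h2 /=.
  rewrite deg_nil add0r mulr0 mulr1z h2 mulrzDl addrAC; congr (_ + _ + _).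
  rewrite -esumMz; apply: eq_esum => t b.
  rewrite (h1 _ [::]) deg_nil addr0 /= -!mulrzA; congr (_ *~ _).
  rewrite !mulrDr !mulrDl !ksgD.
  transitivity (ksg (k * t.1) * ksg (k * t.1) * (ksg (i * t.1) * ksg (k * e))).
    ring.
  by rewrite ksgK mul1r.
rewrite (IH _ (fun t b => G' t (z :: b) *~ ksg (z.1 * t.1))
  (fun b => C (z :: b) *~ ksg (z.1 * (k + i))) (z.1 + e)) => [|t u1 u2|b].
- rewrite h1 mulrzDl addrA deg_cons; congr (_ + _ + _).
  + congr (_ *~ ksg _); ring.
  + rewrite -mulrzA -ksgD; congr (_ *~ ksg _); ring.
- rewrite (h1 _ (z :: _)) deg_cons -!mulrzA -!ksgD; congr (_ *~ ksg _); ring.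
- rewrite h2 mulrzDl /= -!mulrzA -!ksgD; congr (_ *~ ksg _ + _ *~ ksg _); ring.
Qed.

Lemma esum_slotD w1 i x y w2 G :
  (forall t u1 u2, G t (u1 ++ (i, x + y) :: u2) =
     G t (u1 ++ (i, x) :: u2) + G t (u1 ++ (i, y) :: u2)) ->
  (forall b, G (i, x + y) b = G (i, x) b + G (i, y) b) ->
  esum (w1 ++ (i, x + y) :: w2) G =
    esum (w1 ++ (i, x) :: w2) G + esum (w1 ++ (i, y) :: w2) G.
Proof.
elim: w1 G => [|z w1 IH] G h1 h2 /=.
  rewrite h2 [RHS]addrACA; congr (_ + _); rewrite -esumD; apply: eq_esum => t b.
  by rewrite (h1 _ [::]) mulrzDl.
rewrite h1 [RHS]addrACA; congr (_ + _); apply: IH => [t u1 u2|b].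
- by rewrite (h1 _ (z :: _)) mulrzDl.
- by rewrite h2 mulrzDl.
Qed.

Lemma esum_slotE w1 i x y w2 G :
  (forall t u1 u2, G t (u1 ++ (i, x) :: u2) = G t (u1 ++ (i, y) :: u2)) ->
  (forall b, G (i, x) b = G (i, y) b) ->
  esum (w1 ++ (i, x) :: w2) G = esum (w1 ++ (i, y) :: w2) G.
Proof.
elim: w1 G => [|z w1 IH] G h1 h2 /=.
  by rewrite h2; congr (_ + _); apply: eq_esum => t b; rewrite (h1 _ [::]).
rewrite h1; congr (_ + _); apply: IH => [t u1 u2|b]; last by rewrite h2.
by rewrite (h1 _ (z :: _)).
Qed.

Lemma esum_swap w1 i x j y w2 G :
  (forall t u1 u2, G t (u1 ++ (i, x) :: (j, y) :: u2) =
     G t (u1 ++ (j, y) :: (i, x) :: u2) *~ ksg (i * j)) ->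
  esum (w1 ++ (i, x) :: (j, y) :: w2) G =
    esum (w1 ++ (j, y) :: (i, x) :: w2) G *~ ksg (i * j).
Proof.
elim: w1 G => [|z w1 IH] G h1 /=.
  rewrite !mulrzDl addrCA; congr (_ + (_ + _)).
    by rewrite -mulrzA [j * i]mulrC ksgK mulr1z.
  rewrite -esumMz; apply: eq_esum => t b; rewrite (h1 _ [::]) /= -!mulrzA.
  by congr (_ *~ _); ring.
by rewrite h1 mulrzDl; congr (_ + _); apply: IH => t u1 u2; rewrite (h1 _ (z :: _)) mulrzAC.
Qed.
End TsumTheory.

Section SymmetricCoalgebra.
Variables (K : fieldType) (R : dgca K) (V : dgmod R).
Implicit Types (r a : R) (w : word V) (i j k : int) (x y : V).

(* S_R(V): the generator (r, [:: (i_1, x_1); ...; (i_n, x_n)]) stands for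
   r x_1 o ... o x_n, and V^{o 0} = R is spanned by the generators (r, [::]). *)
Inductive sym_rel : seq (int * (R * word V)) -> Prop :=
| sym_coefD r r' w :
    sym_rel [:: (1, (r + r', w)); (-1, (r, w)); (-1, (r', w))]
| sym_slotD r w1 i x y w2 :
    sym_rel [:: (1, (r, w1 ++ (i, x + y) :: w2));
                (-1, (r, w1 ++ (i, x) :: w2)); (-1, (r, w1 ++ (i, y) :: w2))]
| sym_proj r w1 i x w2 :
    sym_rel [:: (1, (r, w1 ++ (i, x) :: w2));
                (-1, (r, w1 ++ (i, gproj (dgm_gr V) i x) :: w2))]
| sym_slotZ r w1 k a i x w2 : homR k a -> homm i x ->
    sym_rel [:: (1, (r, w1 ++ (k + i, a *: x) :: w2));
                (- ksg (k * deg w1), (r * a, w1 ++ (i, x) :: w2))]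
| sym_swap r w1 i x j y w2 :
    sym_rel [:: (1, (r, w1 ++ (i, x) :: (j, y) :: w2));
                (- ksg (i * j), (r, w1 ++ (j, y) :: (i, x) :: w2))].

Definition sym : Type := pres sym_rel.
HB.instance Definition _ := GRing.Zmodule.on sym.

(* The maps out of generators that respect the relators of S_R(V) ([sbalP]). *)
Record sbal (M : zmodType) (g : R -> word V -> M) : Prop := SBal {
  sbal_coefD : forall r r' w, g (r + r') w = g r w + g r' w;
  sbal_slotD : forall r w1 i x y w2,
    g r (w1 ++ (i, x + y) :: w2) = g r (w1 ++ (i, x) :: w2) + g r (w1 ++ (i, y) :: w2);
  sbal_proj : forall r w1 i x w2,
    g r (w1 ++ (i, x) :: w2) = g r (w1 ++ (i, gproj (dgm_gr V) i x) :: w2);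
  sbal_slotZ : forall r w1 k a i x w2, homR k a -> homm i x ->
    g r (w1 ++ (k + i, a *: x) :: w2) =
    g (r * a) (w1 ++ (i, x) :: w2) *~ ksg (k * deg w1);
  sbal_swap : forall r w1 i x j y w2,
    g r (w1 ++ (i, x) :: (j, y) :: w2) =
    g r (w1 ++ (j, y) :: (i, x) :: w2) *~ ksg (i * j) }.

Lemma sbalP (M : zmodType) (g : R -> word V -> M) :
  sbal g <-> respects sym_rel (fun p => g p.1 p.2).
Proof.
split=> [h|h].
  move=> l [r r' w|r w1 i x y w2|r w1 i x w2|r w1 k a i x w2 ha hx|r w1 i x j y w2];
    rewrite /fev !big_cons big_nil addr0 /= ?mulr1z ?mulrN1z ?mulrNz.
  - by rewrite (sbal_coefD h) -opprD subrr.
  - by rewrite (sbal_slotD h) -opprD subrr.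
  - by rewrite (sbal_proj h) subrr.
  - by rewrite (sbal_slotZ h) // subrr.
  - by rewrite (sbal_swap h) subrr.
have {}h l : sym_rel l -> fev (fun p => g p.1 p.2) l = 0 by exact: h.
have E (u v : M) : u - v = 0 -> u = v by move/eqP; rewrite subr_eq0 => /eqP.
have S l : sym_rel l -> \sum_(t <- l) g t.2.1 t.2.2 *~ t.1 = 0 by move=> /h.
split=> [r r' w|r w1 i x y w2|r w1 i x w2|r w1 k a i x w2 ha hx|r w1 i x j y w2]; apply: E.
- have := S _ (sym_coefD r r' w).
  by rewrite !big_cons big_nil addr0 /= mulr1z !mulrN1z -opprD.
- have := S _ (sym_slotD r w1 i x y w2).
  by rewrite !big_cons big_nil addr0 /= mulr1z !mulrN1z -opprD.
- have := S _ (sym_proj r w1 i x w2).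
  by rewrite !big_cons big_nil addr0 /= mulr1z !mulrN1z.
- have := S _ (sym_slotZ r w1 w2 ha hx).
  by rewrite !big_cons big_nil addr0 /= mulr1z !mulrNz.
- have := S _ (sym_swap r w1 i x j y w2).
  by rewrite !big_cons big_nil addr0 /= mulr1z !mulrNz.
Qed.

Definition slift (M : zmodType) (g : R -> word V -> M) : sym -> M :=
  plift (fun p => g p.1 p.2).
Definition rmono r w : sym := gen sym_rel (r, w).
Definition mono w : sym := rmono 1 w.

Lemma slift_mono (M : zmodType) (g : R -> word V -> M) r w :
  sbal g -> slift g (rmono r w) = g r w.
Proof. by move/sbalP => h; rewrite /slift plift_gen. Qed.
Lemma sliftD (M : zmodType) (g : R -> word V -> M) :
  sbal g -> {morph slift g : z z' / z + z'}.
Proof. by move/sbalP => h; apply: pliftD. Qed.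
Lemma sym_ext (M : zmodType) (f h : sym -> M) :
  {morph f : x y / x + y} -> {morph h : x y / x + y} ->
  (forall r w, f (rmono r w) = h (rmono r w)) -> f =1 h.
Proof. by move=> fD hD e; apply: pres_ext => // -[r w]; apply: e. Qed.

Lemma rmono_bal : sbal rmono.
Proof. by apply/sbalP => l hl; rewrite -(gen_rel hl); apply: eq_bigr => -[? []]. Qed.

Definition sscale a : sym -> sym := slift (fun r w => rmono (a * r) w).

Lemma sscale_bal a : sbal (fun r w => rmono (a * r) w).
Proof.
have h := rmono_bal; split=> *.
- by rewrite mulrDr (sbal_coefD h).
- exact: sbal_slotD.
- exact: sbal_proj.
- by rewrite (sbal_slotZ h) // mulrA.
- exact: sbal_swap.
Qed.
Lemma sscale_mono a r w : sscale a (rmono r w) = rmono (a * r) w.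
Proof. by rewrite /sscale (slift_mono _ _ (sscale_bal a)). Qed.
Lemma sscaleDr : right_distributive sscale +%R.
Proof. by move=> a; apply: (sliftD (sscale_bal a)). Qed.
Lemma sscaleDl z : {morph sscale^~ z : a b / a + b}.
Proof.
move=> a b; move: z; apply: sym_ext => [z z'|z z'|r w].
- exact: sscaleDr.
- by rewrite !sscaleDr addrACA.
- by rewrite !sscale_mono mulrDl (sbal_coefD rmono_bal).
Qed.
Lemma sscaleA a b z : sscale a (sscale b z) = sscale (a * b) z.
Proof.
move: z; apply: sym_ext => [z z'|z z'|r w]; first by rewrite !sscaleDr.
- exact: sscaleDr.
- by rewrite !sscale_mono mulrA.
Qed.
Lemma sscale1 : left_id 1 sscale.
Proof.
apply: sym_ext => [z z'|//|r w]; first exact: sscaleDr.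
by rewrite sscale_mono mul1r.
Qed.
HB.instance Definition _ :=
  GRing.Zmodule_isLmodule.Build R sym sscaleA sscale1 sscaleDr sscaleDl.

Lemma scale_rmono a r w : a *: rmono r w = rmono (a * r) w.
Proof. exact: sscale_mono. Qed.
Lemma rmonoE r w : rmono r w = r *: mono w.
Proof. by rewrite scale_rmono mulr1. Qed.

Lemma mono_slotD w1 i x y w2 :
  mono (w1 ++ (i, x + y) :: w2) = mono (w1 ++ (i, x) :: w2) + mono (w1 ++ (i, y) :: w2).
Proof. exact: (sbal_slotD rmono_bal). Qed.
Lemma mono_proj w1 i x w2 :
  mono (w1 ++ (i, x) :: w2) = mono (w1 ++ (i, gproj (dgm_gr V) i x) :: w2).
Proof. exact: (sbal_proj rmono_bal). Qed.
Lemma mono_slotZ w1 k a i x w2 : homR k a -> homm i x ->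
  mono (w1 ++ (k + i, a *: x) :: w2) =
  (a *: mono (w1 ++ (i, x) :: w2)) *~ ksg (k * deg w1).
Proof.
by move=> ha hx; rewrite /mono (sbal_slotZ rmono_bal) // mul1r rmonoE.
Qed.
Lemma mono_swap w1 i x j y w2 :
  mono (w1 ++ (i, x) :: (j, y) :: w2) =
  mono (w1 ++ (j, y) :: (i, x) :: w2) *~ ksg (i * j).
Proof. exact: (sbal_swap rmono_bal). Qed.

Lemma mono_consZ w k a i x : homR k a -> homm i x ->
  mono ((k + i, a *: x) :: w) = a *: mono ((i, x) :: w).
Proof.
move=> ha hx; rewrite (mono_slotZ [::] w ha hx) deg_nil mulr0.
by rewrite /ksg expr0z mulr1z.
Qed.
Lemma mono_consMz w i x n : mono ((i, x *~ n) :: w) = mono ((i, x) :: w) *~ n.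
Proof.
apply: (morphD_mulrz (f := fun x => mono ((i, x) :: w))) => {}x y.
exact: (mono_slotD [::]).
Qed.

Lemma mono_move i x u w1 w2 :
  mono (u ++ (i, x) :: w1 ++ w2) = mono (u ++ w1 ++ (i, x) :: w2) *~ ksg (i * deg w1).
Proof.
elim: w1 u => [|[j y] w1 IH] u /=; first by rewrite deg_nil mulr0 /ksg expr0z mulr1z.
rewrite mono_swap -cat_rcons IH cat_rcons -mulrzA -ksgD deg_cons mulrDr.
by rewrite [in LHS]addrC.
Qed.

(* The grading of S_R(V) by total degree. *)
Definition sproj (m : int) : sym -> sym :=
  slift (fun r w => rmono (gproj (dga_gr R) (m - deg w) r) w).

Lemma gproj_mulr k a m r : homR k a ->
  gproj (dga_gr R) m (r * a) = gproj (dga_gr R) (m - k) r * a.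
Proof.
move=> ha; move: r; apply: (grade_ext (G := dga_gr R)) => [r r'|r r'|i r hr].
- by rewrite mulrDl gprojD.
- by rewrite gprojD mulrDl.
have hra := dga_mul hr ha; have [->|ne] := eqVneq m (i + k).
  by rewrite (homogE hra) addrK (homogE hr).
rewrite (gproj_homog_neq hra ne) (gproj_homog_neq hr) ?mul0r //.
by apply: contra_neq ne => <-; rewrite subrK.
Qed.

Lemma deg_slot w1 w2 i x : deg (w1 ++ (i, x) :: w2) = deg w1 + i + deg w2.
Proof. by rewrite deg_cat deg_cons addrA. Qed.

Lemma sproj_bal m : sbal (fun r w => rmono (gproj (dga_gr R) (m - deg w) r) w).
Proof.
have h := rmono_bal; split=> [r r' w|r w1 i x y w2|r w1 i x w2|r w1 k a i x w2 ha hx|r w1 i x j y w2].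
- by rewrite gprojD (sbal_coefD h).
- by rewrite !deg_slot (sbal_slotD h).
- by rewrite !deg_slot (sbal_proj h).
- rewrite !deg_slot (sbal_slotZ h) // (gproj_mulr _ _ ha).
  by congr (rmono (gproj _ _ _ * _) _ *~ _); ring.
- rewrite (sbal_swap h); congr (rmono (gproj _ _ _) _ *~ _).
  by rewrite !deg_slot !deg_cons /=; ring.
Qed.
Lemma sproj_mono m r w :
  sproj m (rmono r w) = rmono (gproj (dga_gr R) (m - deg w) r) w.
Proof. by rewrite /sproj (slift_mono _ _ (sproj_bal m)). Qed.
Lemma sprojD m : {morph sproj m : z z' / z + z'}.
Proof. exact: (sliftD (sproj_bal m)). Qed.
Lemma rmono0 w : rmono 0 w = 0.
Proof. by rewrite rmonoE scale0r. Qed.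
Lemma sprojK i j z : sproj i (sproj j z) = if i == j then sproj j z else 0.
Proof.
move: z; apply: sym_ext => [z z'|z z'|r w]; first by rewrite !sprojD.
  by case: ifP; rewrite ?addr0 ?sprojD.
rewrite !sproj_mono gprojK; have [->|ne] := eqVneq i j; first by rewrite eqxx.
by rewrite ifN ?rmono0 //; apply: contra_neq ne => /addIr.
Qed.
Lemma sfin_sum z : exists s : seq int, z = \sum_(i <- s) sproj i z /\
  (forall i, i \notin s -> sproj i z = 0) /\ uniq s.
Proof.
have sproj0 i : sproj i 0 = 0 by apply: (addrI (sproj i 0)); rewrite -sprojD !addr0.
suff [s hs] : exists s : seq int, forall s', uniq s' -> {subset s <= s'} ->
    z = \sum_(i <- s') sproj i z /\ (forall i, i \notin s' -> sproj i z = 0).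
  by exists (undup s); have [] := hs _ (undup_uniq s); [move=> i; rewrite mem_undup|rewrite undup_uniq].
rewrite [z]pres_repr /fev; elim: (repr z) => [|[c [r w]] l [s hs]].
  by exists [::] => s' _ _; rewrite big_nil big1.
have [t ut et] := gfin (dga_gr R) r.
exists (s ++ [seq i + deg w | i <- t]) => s' us sub.
have {hs} [|e1 e2] := hs s' us; first by move=> i hi; apply: sub; rewrite mem_cat hi.
have sM i : sproj i (gen sym_rel (r, w) *~ c) = rmono (gproj (dga_gr R) (i - deg w) r) w *~ c.
  by rewrite (morphD_mulrz (@sprojD i)) -/(rmono r w) sproj_mono.
have z0 i : i \notin s' -> gproj (dga_gr R) (i - deg w) r = 0.
  move=> hi; rewrite et gproj_sum big_seq big1 // => j hj; rewrite gprojK ifN //.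
  apply: contraNneq hi => e; apply: sub; rewrite mem_cat; apply/orP; right.
  by apply/mapP; exists j => //; rewrite -e subrK.
split; last first.
  move=> i hi; rewrite big_cons sprojD e2 // addr0 sM z0 // rmono0 mul0rz //.
rewrite big_cons /=; under [RHS]eq_bigr do rewrite sprojD sM.
rewrite big_split /= -e1; congr (_ + _).
rewrite -mulrz_suml; congr (_ *~ _).
have rmB := sbal_coefD rmono_bal.
rewrite -(big_morph (rmono^~ w) (fun a b => rmB a b w) (rmono0 w)) -/(rmono r w); congr (rmono _ w).
rewrite -(big_map (fun i => i - deg w) xpredT (gproj (dga_gr R)^~ r)) /=.
have us2 : uniq [seq i - deg w | i <- s'] by rewrite map_inj_uniq //; apply: addIr.
apply: (gproj_ext (G := dga_gr R)) => m; rewrite gproj_sum.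
have [hm|hm] := boolP (m \in [seq i - deg w | i <- s']).
  rewrite (bigD1_seq m) //= gprojK eqxx big1 ?addr0 // => i ne.
  by rewrite gprojK eq_sym (negPf ne).
rewrite big_seq big1 => [|i hi]; last first.
  by rewrite gprojK ifN //; apply: contraNneq hm => ->.
rewrite -[m](addrK (deg w)) z0 //; apply: contra hm => hm.
by apply/mapP; exists (m + deg w) => //; rewrite addrK.
Qed.
Lemma sfin z : exists2 s : seq int, uniq s & z = \sum_(i <- s) sproj i z.
Proof. by have [s [e [_ us]]] := sfin_sum z; exists s. Qed.

Definition sym_gr : grading sym := Grading sprojD sprojK sfin.

Lemma homog_rmono i r w : homR i r -> homog sym_gr (i + deg w) (rmono r w).
Proof. by move=> /homogE hr; rewrite /homog /= sproj_mono addrK hr. Qed.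
Lemma homog_mono w : homog sym_gr (deg w) (mono w).
Proof.
rewrite -[deg w]add0r; apply: homog_rmono.
by have := dga_unit0 R 1; rewrite rmorph1.
Qed.

(* [sym_V] is the projection S_R(V) -> V. *)
Definition sym_V_gen r w : V :=
  if w is [:: t] then r *: gproj (dgm_gr V) t.1 t.2 else 0.
Definition sym_V : sym -> V := slift sym_V_gen.

Lemma gproj_scale k a i x : homR k a ->
  gproj (dgm_gr V) (k + i) (a *: x) = a *: gproj (dgm_gr V) i x.
Proof.
move=> ha; move: x; apply: (grade_ext (G := dgm_gr V)) => [x y|x y|j x hx].
- by rewrite scalerDr gprojD.
- by rewrite gprojD scalerDr.
have hax := dgm_act ha hx; have [->|ne] := eqVneq i j.
  by rewrite (homogE hax) (homogE hx).
rewrite (gproj_homog_neq hx ne) scaler0 (gproj_homog_neq hax) //.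
by apply: contra_neq ne => /addrI.
Qed.

Lemma sym_V_bal : sbal sym_V_gen.
Proof.
split=> [r r' w|r w1 i x y w2|r w1 i x w2|r w1 k a i x w2 ha hx|r w1 i x j y w2].
- by case: w => [|t [|? ?]] /=; rewrite ?addr0 // scalerDl.
- by case: w1 => [|? [|? ?]]; case: w2 => [|? ?] /=; rewrite ?addr0 // gprojD scalerDr.
- by case: w1 => [|? [|? ?]]; case: w2 => [|? ?] //=; rewrite gprojK eqxx.
- case: w1 => [|? [|? ?]]; case: w2 => [|? ?] /=; rewrite ?mul0rz //.
  by rewrite deg_nil mulr0 /ksg expr0z mulr1z gproj_scale // scalerA.
- by case: w1 => [|? [|? ?]]; case: w2 => [|? ?] /=; rewrite ?mul0rz.
Qed.
Lemma sym_V_mono r w : sym_V (rmono r w) = sym_V_gen r w.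
Proof. exact: slift_mono sym_V_bal. Qed.
End SymmetricCoalgebra.

Section Tensor.
Variables (K : fieldType) (R : dgca K) (A B : lmodType R) (GA : grading A).

(* The tensor product over R of left graded modules, A being a right module by
   x r = (-1)^(|r||x|) r x. *)
Inductive tens_rel : seq (int * (A * B)) -> Prop :=
| tens_Dl x x' y : tens_rel [:: (1, (x + x', y)); (-1, (x, y)); (-1, (x', y))]
| tens_Dr x y y' : tens_rel [:: (1, (x, y + y')); (-1, (x, y)); (-1, (x, y'))]
| tens_bal k (r : R) i x y : homR k r -> homog GA i x ->
    tens_rel [:: (1, (r *: x, y)); (- ksg (k * i), (x, r *: y))].

Definition tens : Type := pres tens_rel.
HB.instance Definition _ := GRing.Zmodule.on tens.
Definition tpure x y : tens := gen tens_rel (x, y).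

Lemma tpureDl y : {morph tpure^~ y : x x' / x + x'}.
Proof.
move=> x x'; have := gen_rel (tens_Dl x x' y).
rewrite /fev !big_cons big_nil addr0 mulr1z !mulrN1z -opprD.
by move/eqP; rewrite subr_eq0 => /eqP.
Qed.
Lemma tpureDr x : {morph tpure x : y y' / y + y'}.
Proof.
move=> y y'; have := gen_rel (tens_Dr x y y').
rewrite /fev !big_cons big_nil addr0 mulr1z !mulrN1z -opprD.
by move/eqP; rewrite subr_eq0 => /eqP.
Qed.
Lemma tpureZ k (r : R) i x y : homR k r -> homog GA i x ->
  tpure (r *: x) y = tpure x (r *: y) *~ ksg (k * i).
Proof.
move=> hr hx; have := gen_rel (tens_bal y hr hx).
rewrite /fev !big_cons big_nil addr0 mulr1z mulrNz.
by move/eqP; rewrite subr_eq0 => /eqP.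
Qed.
Lemma tpure0l y : tpure 0 y = 0.
Proof. by apply: (addrI (tpure 0 y)); rewrite -tpureDl !addr0. Qed.
Lemma tpure0r x : tpure x 0 = 0.
Proof. by apply: (addrI (tpure x 0)); rewrite -tpureDr !addr0. Qed.
Lemma tpureMzl x y n : tpure (x *~ n) y = tpure x y *~ n.
Proof. exact: (morphD_mulrz (@tpureDl y)). Qed.
Lemma tpureMzr x y n : tpure x (y *~ n) = tpure x y *~ n.
Proof. exact: (morphD_mulrz (@tpureDr x)). Qed.
End Tensor.

Section Coproduct.
Variables (K : fieldType) (R : dgca K) (V : dgmod R).
Implicit Types (r a : R) (w b : word V).

Definition symsym : Type := tens (sym V) (sym_gr V).
HB.instance Definition _ := GRing.Zmodule.on symsym.

(* Delta(r x_1 o ... o x_n) = \sum_i \sum_(s in Sh(i, n - i)) eps(s)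
   r x_s(1) o ... o x_s(i) (x) x_s(i+1) o ... o x_s(n); see [cop_mono]. *)
Definition cop_gen r w : symsym :=
  \sum_(0 <= i < (size w).+1)
    sh2sum i w (fun b1 b2 => tpure (sym_gr V) (r *: mono b1) (mono b2)).
Definition cop : sym V -> symsym := slift cop_gen.

Lemma tpure_slot r k a b (z : sym V) : homR k a ->
  tpure (sym_gr V) (r *: mono b) (a *: z) =
  tpure (sym_gr V) ((r * a) *: mono b) z *~ ksg (k * deg b).
Proof.
move=> ha; move: r; apply: (grade_ext (G := dga_gr R)) => [r r'|r r'|l r hr].
- by rewrite scalerDl tpureDl.
- by rewrite mulrDl scalerDl tpureDl mulrzDl.
have -> : (r * a) *: mono b = a *: (r *: mono b) *~ ksg (l * k).
  by rewrite (dga_comm hr ha) -scalerMzl scalerA.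
have hz : homog (sym_gr V) (l + deg b) (r *: mono b).
  by rewrite -rmonoE; apply: homog_rmono.
rewrite tpureMzl (tpureZ _ ha hz) -!mulrzA -!ksgD.
rewrite (_ : _ + _ = k * (l + deg b) + k * (l + deg b)); last by ring.
by rewrite ksgD ksgK mulr1z.
Qed.

Lemma cop_bal : sbal cop_gen.
Proof.
split=> [r r' w|r w1 i x y w2|r w1 i x w2|r w1 k a i x w2 ha hx|r w1 i x j y w2];
  rewrite /cop_gen !sh2sum_all.
- rewrite -tsumD; apply: eq_tsum => b1 b2 _ _.
  by rewrite scalerDl tpureDl.
- apply: tsum_slotD => [u1 u2 b|b u1 u2].
    by rewrite mono_slotD scalerDr tpureDl.
  by rewrite mono_slotD tpureDr.
- by apply: tsum_slotE => [u1 u2 b|b u1 u2]; rewrite mono_proj.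
- rewrite -[deg w1]addr0; apply: tsum_slotZ => [u1 u2 b|b u1 u2].
    by rewrite addr0 mono_slotZ // -scalerMzr scalerA tpureMzl.
  rewrite addr0 mono_slotZ // tpureMzr.
  by rewrite (tpure_slot _ _ _ ha) -mulrzA -ksgD; congr (_ *~ ksg _); ring.
- apply: tsum_swap => [u1 u2 b|b u1 u2].
    by rewrite mono_swap -scalerMzr tpureMzl.
  by rewrite mono_swap tpureMzr.
Qed.

Lemma cop_mono r w : cop (rmono r w) =
  \sum_(0 <= i < (size w).+1)
    sh2sum i w (fun b1 b2 => tpure (sym_gr V) (r *: mono b1) (mono b2)).
Proof. exact: slift_mono cop_bal. Qed.
End Coproduct.

Section Multilinear.
Variables (K : fieldType) (R : dgca K) (V W : dgmod R).

(* The restriction of f to sequences of size n is a graded symmetric R-multilinear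
   map of degree p. *)
Record multilin (p : int) (n : nat) (f : seq V -> W) : Prop := Multilin {
  ml_add : forall s1 x y s2, (size s1 + size s2).+1 = n ->
    f (s1 ++ (x + y) :: s2) = f (s1 ++ x :: s2) + f (s1 ++ y :: s2);
  ml_scale : forall (w : word V) k (a : R) x s2,
    hword w -> homR k a -> (size w + size s2).+1 = n ->
    f (unzip2 w ++ (a *: x) :: s2) =
    (a *: f (unzip2 w ++ x :: s2)) *~ ksg (k * (p + deg w));
  ml_sym : forall s1 i x j y s2,
    homm i x -> homm j y -> (size s1 + size s2).+2 = n ->
    f (s1 ++ x :: y :: s2) = f (s1 ++ y :: x :: s2) *~ ksg (i * j);
  ml_deg : forall w : word V, hword w -> size w = n ->
    homm (deg w + p) (f (unzip2 w)) }.
End Multilinear.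

Section Linf.
Variables (K : fieldType) (R : dgca K) (V : dgmod R).
(* The full family (q_1 = d_V, q_2, q_3, ...). *)
Definition with_d (q : seq V -> V) (s : seq V) : V :=
  if s is [:: x] then dgm_d x else q s.

(* q_n is the restriction of [li_q] to sequences of size n; only n >= 2 matters. *)
Record linf := Linf {
  li_q : seq V -> V;
  li_ml : forall n, (2 <= n)%N -> multilin 1 n li_q;
  li_rel : forall w : word V, (2 <= size w)%N -> hword w ->
    \sum_(1 <= i < (size w).+1) sh2sum i w (fun b1 b2 =>
      with_d li_q (with_d li_q (unzip2 b1) :: unzip2 b2)) = 0 }.

Lemma zero_ml p n : multilin p n (fun _ : seq V => 0 : V).
Proof.
split=> *; rewrite ?addr0 ?scaler0 ?mul0rz //.
exact: homog0.
Qed.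
Lemma zero_rel (w : word V) : (2 <= size w)%N -> hword w ->
    \sum_(1 <= i < (size w).+1) sh2sum i w (fun b1 b2 =>
      with_d (fun _ => 0 : V) (with_d (fun _ => 0) (unzip2 b1) :: unzip2 b2)) = 0.
Proof.
move=> w2 _; have d0 : dgm_d (0 : V) = 0.
  by apply: (addrI (dgm_d (0 : V))); rewrite -dgm_dD !addr0.
rewrite big_nat big1 // => i /andP[i1 iw]; rewrite sh2sumE //.
rewrite -[RHS](mulr0z (tsum w (fun _ _ => 0 : V))) -tsumMz.
apply: eq_tsum => b1 b2 hs _; rewrite mulr0z; case: eqP => // e.
case: b2 hs => [|t b2] hs //=; case: b1 e hs => [|t1 [|t2 b1]] e //= hs.
by rewrite addn0 in hs; move: w2; rewrite -hs.
Qed.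
(* (V; d_V, 0, 0, ...) *)
Definition linear_linf : linf := Linf (fun n _ => zero_ml 1 n) zero_rel.
End Linf.

Section Codifferential.
Variables (K : fieldType) (R : dgca K) (V : dgmod R) (L : linf V).
Implicit Types (r a : R) (w b : word V).

(* Letters replaced by the homogeneous components they stand for; the identity on
   [hword]s. *)
Definition wproj w : word V := [seq (t.1, gproj (dgm_gr V) t.1 t.2) | t <- w].

(* (-1)^|r| r h(b1) o b2, for h of degree 1. *)
Definition coder_term (h : seq V -> V) r (b1 b2 : word V) : sym V :=
  ginv (dga_gr R) r *: mono ((deg b1 + 1, h (unzip2 (wproj b1))) :: b2).

(* The extension of d_V to S_R(V), on r x_1 o ... o x_n. *)
Definition dtil_gen r w : sym V :=
  dga_d r *: mono w +
  if w is [::] then 0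
  else sh2sum 1 w (coder_term (fun s => dgm_d (head 0 s)) r).
Definition dtil : sym V -> sym V := slift dtil_gen.

(* The coderivation with corestriction (0, 0, q_2, q_3, ...); these two properties
   are [Q_coder] and [Q_corestriction]. *)
Definition Qgen r w : sym V :=
  \sum_(2 <= i < (size w).+1) sh2sum i w (coder_term (li_q L) r).
Definition Qmap : sym V -> sym V := slift Qgen.

(* D = \tilde d_V + Q *)
Definition Dmap (z : sym V) : sym V := dtil z + Qmap z.

Lemma ginvM r k a : homR k a ->
  ginv (dga_gr R) (r * a) = ginv (dga_gr R) r * a *~ ksg k.
Proof.
move=> ha; move: r; apply: (grade_ext (G := dga_gr R)) => [r r'|r r'|i r hr].
- by rewrite mulrDl ginvD.
- by rewrite ginvD mulrDl mulrzDl.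
by rewrite (ginv_homog (dga_mul hr ha)) (ginv_homog hr) mulrzAl -mulrzA -ksgD.
Qed.
Lemma dM r a : dga_d (r * a) = dga_d r * a + ginv (dga_gr R) r * dga_d a.
Proof.
move: r; apply: (grade_ext (G := dga_gr R)) => [r r'|r r'|i r hr].
- by rewrite mulrDl dga_dD.
- by rewrite dga_dD ginvD !mulrDl addrACA.
by rewrite (dga_dM _ hr) (ginv_homog hr) mulrzAl.
Qed.

Lemma wproj_cat w w' : wproj (w ++ w') = wproj w ++ wproj w'.
Proof. exact: map_cat. Qed.
Lemma deg_wproj w : deg (wproj w) = deg w.
Proof. by rewrite /deg big_map. Qed.
Lemma hword_wproj w : hword (wproj w).
Proof. by rewrite /hword all_map; apply/allP => t _; apply: gproj_homog. Qed.

Lemma dm0 : dgm_d (0 : V) = 0.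
Proof. by apply: (addrI (dgm_d (0 : V))); rewrite -dgm_dD !addr0. Qed.

Lemma dtil_genE r w : dtil_gen r w = dga_d r *: mono w +
  esum w (fun t b => ginv (dga_gr R) r *:
     mono ((t.1 + 1, dgm_d (gproj (dgm_gr V) t.1 t.2)) :: b)).
Proof.
congr (_ + _); case: w => [|x w] //; rewrite sh2sumE // -tsum_single.
apply: eq_tsum => -[|t [|t' b1]] b2 _ _ //.
by rewrite /coder_term deg_cons deg_nil addr0.
Qed.

Lemma Qgen_tsum r w : Qgen r w =
  tsum w (fun b1 b2 => if (2 <= size b1)%N then coder_term (li_q L) r b1 b2 else 0).
Proof. exact: sh2sum_from. Qed.

Lemma dtil_bal : sbal dtil_gen.
Proof.
pose ti := ginv (dga_gr R).
split=> [r r' w|r w1 i x y w2|r w1 i x w2|r w1 k a i x w2 ha hx|r w1 i x j y w2];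
  rewrite !dtil_genE.
- rewrite dga_dD scalerDl [RHS]addrACA; congr (_ + _); rewrite -esumD.
  by apply: eq_esum => t b; rewrite ginvD scalerDl.
- rewrite mono_slotD scalerDr [RHS]addrACA; congr (_ + _).
  apply: esum_slotD => [t u1 u2|b].
    by rewrite -!cat_cons mono_slotD scalerDr.
  by rewrite /= gprojD dgm_dD (mono_slotD [::]) scalerDr.
- rewrite mono_proj; congr (_ + _).
  apply: esum_slotE => [t u1 u2|b]; last by rewrite /= gprojK eqxx.
  by rewrite -!cat_cons mono_proj.
- rewrite (@esum_slotZ _ _ _ _ w1 k a i x w2 _
    (fun t b => ti (r * a) *: mono ((t.1 + 1, dgm_d (gproj (dgm_gr V) t.1 t.2)) :: b))
    (fun b => (ti r * dga_d a) *: mono ((i, x) :: b)) 0); first last.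
  + move=> b /=; rewrite gproj_scale // (homogE hx) (dgm_dM _ ha) mulr0 /ksg expr0z mulr1z.
    rewrite (mono_slotD [::]) scalerDr addrC /= mono_consMz; congr (_ + _).
      rewrite -addrA (mono_consZ _ ha (dgm_d1 hx)) /ti (ginvM _ ha).
      by rewrite -scalerMzr scalerA -scalerMzl.
    by rewrite addrAC (mono_consZ _ (dga_d1 ha) hx) scalerA.
  + move=> t u1 u2; rewrite -!cat_cons mono_slotZ // -scalerMzr scalerA deg_cons /=.
    rewrite /ti (ginvM _ ha) -scalerMzl -mulrzA -ksgD; congr (_ *~ ksg _); ring.
  rewrite addr0 mono_slotZ // dM scalerDl mulrzDl -scalerMzr scalerA.
  rewrite [in RHS]mulrzDl -[RHS]addrA; congr (_ + _); rewrite addrC; congr (_ + _).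
  have -> := mono_move i x [::] w1 w2; rewrite -scalerMzr -mulrzA mulrDl.
  by rewrite [ksg (k * _ + _)]ksgD mulrCA ksgK mulr1.
- rewrite mulrzDl mono_swap -scalerMzr; congr (_ + _).
  apply: esum_swap => t u1 u2.
  by rewrite -!cat_cons mono_swap -scalerMzr.
Qed.

Lemma Q_bal : sbal Qgen.
Proof.
pose ti := ginv (dga_gr R).
have vE u1 i x u2 : unzip2 (wproj (u1 ++ (i, x) :: u2)) =
    unzip2 (wproj u1) ++ gproj (dgm_gr V) i x :: unzip2 (wproj u2).
  by rewrite wproj_cat /unzip2 map_cat.
have sE u1 (t : int * V) u2 : size (u1 ++ t :: u2) = (size u1 + size u2).+1.
  by rewrite size_cat addnS.
have sv u : size (unzip2 (wproj u)) = size u by rewrite !size_map.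
have ml n : (2 <= n)%N -> multilin 1 n (li_q L) := @li_ml _ _ _ L n.
split=> [r r' w|r w1 i x y w2|r w1 i x w2|r w1 k a i x w2 ha hx|r w1 i x j y w2];
  rewrite !Qgen_tsum.
- rewrite -tsumD; apply: eq_tsum => b1 b2 _ _.
  by case: ifP => _; rewrite ?addr0 // /coder_term ginvD scalerDl.
- apply: tsum_slotD => [u1 u2 b|b u1 u2].
    rewrite !sE; case: ifP => h2; rewrite ?addr0 //.
    rewrite /coder_term !vE gprojD (ml_add (ml _ h2)) ?sv // !deg_slot.
    by rewrite (mono_slotD [::]) scalerDr.
  case: ifP => h2; rewrite ?addr0 //.
  by rewrite /coder_term -!cat_cons mono_slotD scalerDr.
- apply: tsum_slotE => [u1 u2 b|b u1 u2].
    by rewrite !sE /coder_term !vE gprojK eqxx !deg_slot.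
  by rewrite /coder_term -!cat_cons mono_proj.
- rewrite -[deg w1]addr0; apply: tsum_slotZ => [u1 u2 b|b u1 u2].
    rewrite !sE; case: ifP => h2; rewrite ?mul0rz //.
    rewrite /coder_term !vE gproj_scale //.
    rewrite (ml_scale (ml _ h2) (k := k)) ?hword_wproj ?size_map //.
    rewrite deg_wproj (homogE hx) !deg_slot mono_consMz.
    rewrite (_ : _ + 1 = k + (deg u1 + i + deg u2 + 1)); last by ring.
    rewrite mono_consZ //; last first.
      have := ml_deg (ml _ h2) (hword_wproj (u1 ++ (i, x) :: u2)).
      by rewrite deg_wproj vE (homogE hx) deg_slot; apply; rewrite size_map sE.
    rewrite /ti (ginvM _ ha) -scalerMzr scalerA -scalerMzl -mulrzA -ksgD.
    congr (_ *~ ksg _); ring.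
  case: ifP => h2; rewrite ?mul0rz //.
  rewrite /coder_term -!cat_cons mono_slotZ // -scalerMzr scalerA.
  rewrite (ginvM _ ha) -scalerMzl -mulrzA -ksgD deg_cons /=.
  by congr (_ *~ ksg _); ring.
- apply: tsum_swap => [u1 u2 b|b u1 u2].
    rewrite !sE /=; case: ifP => h2; rewrite ?mul0rz //.
    rewrite /coder_term !vE /=.
    rewrite (ml_sym (ml _ h2) (gproj_homog (dgm_gr V) i x) (gproj_homog (dgm_gr V) j y)) ?sv ?addnS //.
    by rewrite mono_consMz -scalerMzr !deg_cat !deg_cons /= [i + (j + _)]addrCA.
  case: ifP => h2; rewrite ?mul0rz //.
  by rewrite /coder_term -!cat_cons mono_swap -scalerMzr.
Qed.
End Codifferential.

Section Coderivations.
Variables (K : fieldType) (R : dgca K) (V : dgmod R) (L : linf V).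
Implicit Types (phi : sym V -> sym V) (w : word V).

(* phi \in coDer^p. By additivity and R-linearity it is enough to state
   Delta phi = (phi (x) id + id (x) phi) Delta on words; its right-hand side is written
   out, with (id (x) phi)(x (x) y) = (-1)^(p |x|) x (x) phi(y). *)
Record coder (p : int) phi : Prop := Coder {
  cd_add : {morph phi : z z' / z + z'};
  cd_deg : forall m z, homog (sym_gr V) m z -> homog (sym_gr V) (m + p) (phi z);
  cd_lin : forall k (a : R) z, homR k a -> phi (a *: z) = (a *: phi z) *~ ksg (k * p);
  cd_cop : forall w, hword w ->
    cop (phi (mono w)) =
    \sum_(0 <= i < (size w).+1) sh2sum i w (fun b1 b2 =>
      tpure (sym_gr V) (phi (mono b1)) (mono b2) +
      tpure (sym_gr V) (mono b1) (phi (mono b2)) *~ ksg (p * deg b1)) }.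

Definition ev1 phi : V := sym_V (phi (mono [::])).
(* phi_0 = 0, where phi_0 : R = V^{o 0} -> V is the zeroth corestriction. *)
Definition coder_F1 (p : int) phi : Prop :=
  coder p phi /\ forall r : R, sym_V (phi (r *: mono [::])) = 0.
(* [D, phi] for phi of degree p. *)
Definition LD (p : int) phi : sym V -> sym V :=
  fun z => Dmap L (phi z) - phi (Dmap L z) *~ ksg p.
End Coderivations.

Section TripleSum.
Variables (K : fieldType) (R : dgca K) (V : dgmod R) (M : zmodType).
Implicit Types (w : word V) (H : word V -> word V -> word V -> M).

Lemma tsum_assoc w H :
  tsum w (fun c d => tsum c (fun a b => H a b d)) =
  tsum w (fun a e => tsum e (fun b d => H a b d)).
Proof.
elim: w H => [|x w IH] H //=.
rewrite !tsumD -addrA; congr (_ + _).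
  exact: (IH (fun a b d => H (x :: a) b d)).
rewrite (IH (fun a b d => H a (x :: b) d *~ ksg (x.1 * deg a))).
have -> : tsum w (fun c d => tsum c (fun a b => H a b (x :: d)) *~ ksg (x.1 * deg c))
  = tsum w (fun c d => tsum c (fun a b => H a b (x :: d) *~ ksg (x.1 * (deg a + deg b)))).
  apply: eq_tsum => c d _ _; rewrite -tsumMz; apply: eq_tsum => a b _ e.
  by rewrite e.
rewrite (IH (fun a b d => H a b (x :: d) *~ ksg (x.1 * (deg a + deg b)))) -tsumD.
apply: eq_tsum => a e _ _; rewrite mulrzDl -!tsumMz; congr (_ + _).
apply: eq_tsum => b d _ _; rewrite -mulrzA -ksgD; congr (_ *~ ksg _); ring.
Qed.

Lemma tsum_comm w (F : word V -> word V -> M) :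
  tsum w F = tsum w (fun a b => F b a *~ ksg (deg a * deg b)).
Proof.
elim: w F => [|x w IH] F /=; first by rewrite deg_nil mul0r /ksg expr0z mulr1z.
rewrite IH (IH (fun b1 b2 => F b1 (x :: b2) *~ _)) addrC; congr (_ + _).
  apply: eq_tsum => a b _ _; rewrite -mulrzA -ksgD deg_cons.
  by congr (_ *~ ksg _); ring.
apply: eq_tsum => a b _ _; rewrite -mulrzA -ksgD deg_cons mulrDr ksgD.
by rewrite ksgD mulrAC [deg a * x.1]mulrC ksgK mul1r.
Qed.

Lemma tsum_assoc_comm w H :
  tsum w (fun c d => tsum d (fun a b => H a c b)) =
  tsum w (fun a e => tsum e (fun c b => H a c b *~ ksg (deg a * deg c))).
Proof.
rewrite -(tsum_assoc w (fun c a b => H a c b)).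
rewrite -(tsum_assoc w (fun a c b => H a c b *~ ksg (deg a * deg c))).
apply: eq_tsum => c d _ _; rewrite tsum_comm.
by apply: eq_tsum => a b _ _; rewrite mulrC.
Qed.

Lemma tsum_nilr w (G : word V -> M) :
  tsum w (fun b1 b2 => if b2 is [::] then G b1 else 0) = G w.
Proof.
rewrite tsum_comm -[RHS](tsum_nil w G); apply: eq_tsum => a b _ _.
by case: a => [|? ?]; rewrite ?mul0rz // deg_nil mul0r /ksg expr0z mulr1z.
Qed.
End TripleSum.

Section QCoder.
Variables (K : fieldType) (R : dgca K) (V : dgmod R) (L : linf V).

Lemma ginv1 : ginv (dga_gr R) 1 = 1.
Proof.
have h : homR 0 (1 : R) by have := dga_unit0 R 1; rewrite rmorph1.
by rewrite (ginv_homog h) /ksg expr0z mulr1z.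
Qed.

Lemma Q_mono (w : word V) : Qmap L (mono w) = Qgen L 1 w.
Proof. exact: slift_mono (Q_bal L). Qed.

Lemma tsum_morph (M M' : zmodType) (f : M -> M') (w : word V) F :
  {morph f : x y / x + y} -> f (tsum w F) = tsum w (fun b1 b2 => f (F b1 b2)).
Proof.
move=> fD; elim: w F => [|x w IH] F //=; rewrite fD !IH; congr (_ + _).
by apply: eq_tsum => b1 b2 _ _; rewrite (morphD_mulrz fD).
Qed.

Lemma homog_tsum (A : zmodType) (G : grading A) n (w : word V) F :
  (forall b1 b2, deg b1 + deg b2 = deg w -> homog G n (F b1 b2)) ->
  homog G n (tsum w F).
Proof.
elim: w F => [|x w IH] F h /=; first by apply: h; rewrite deg_nil addr0.
apply: homogD; apply: IH => b1 b2 e.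
  by apply: h; rewrite !deg_cons -addrA e.
by apply: homogMz; apply: h; rewrite !deg_cons addrCA e.
Qed.

Lemma QD : {morph Qmap L : z z' / z + z'}.
Proof. exact: sliftD (Q_bal L). Qed.

Lemma Q_rmono (r : R) (w : word V) :
  Qmap L (rmono r w) = ginv (dga_gr R) r *: Qmap L (mono w).
Proof.
rewrite Q_mono /Qmap (slift_mono _ _ (Q_bal L)) !Qgen_tsum.
rewrite (tsum_morph _ _ (scalerDr (ginv (dga_gr R) r))).
apply: eq_tsum => b1 b2 _ _; case: ifP => _; rewrite ?scaler0 //.
by rewrite /coder_term ginv1 scale1r.
Qed.

Lemma ginv_homog_homog i (r : R) : homR i r -> homR i (ginv (dga_gr R) r).
Proof. by move=> h; rewrite (ginv_homog h); apply: homogMz. Qed.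

Lemma ginvMl k (a r : R) : homR k a ->
  ginv (dga_gr R) (a * r) = a * ginv (dga_gr R) r *~ ksg k.
Proof.
move=> ha; move: r; apply: (grade_ext (G := dga_gr R)) => [r r'|r r'|i r hr].
- by rewrite mulrDr ginvD.
- by rewrite ginvD mulrDr mulrzDl.
by rewrite (ginv_homog (dga_mul ha hr)) (ginv_homog hr) mulrzAr -mulrzA -ksgD addrC.
Qed.

Lemma Q_deg m z : homog (sym_gr V) m z -> homog (sym_gr V) (m + 1) (Qmap L z).
Proof.
move/homogE <-; apply/eqP; move: z => /=.
apply: sym_ext => [z z'|z z'|r w]; rewrite ?sprojD ?QD ?sprojD //.
apply/eqP; rewrite sproj_mono; set r' := gproj _ _ r.
rewrite /Qmap (slift_mono _ _ (Q_bal L)) Qgen_tsum.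
rewrite -[_ == _]/(homog (sym_gr V) (m + 1) _).
apply: homog_tsum => b1 b2 e; case: ifP => _; last exact: homog0.
rewrite /coder_term -rmonoE.
rewrite (_ : m + 1 = (m - deg w) + deg ((deg b1 + 1, li_q L (unzip2 (wproj b1))) :: b2)).
  by apply: homog_rmono; apply: ginv_homog_homog; apply: gproj_homog.
by rewrite deg_cons -e /=; ring.
Qed.

Lemma Q_coder : coder 1 (Qmap L).
Proof.
split; [exact: QD | exact: Q_deg | |].
  move=> k a z ha; move: z; apply: sym_ext => [z z'|z z'|r w].
  - by rewrite scalerDr QD.
  - by rewrite QD scalerDr mulrzDl.
  by rewrite mulr1 scale_rmono [LHS]Q_rmono [in RHS]Q_rmono (ginvMl r ha) [in RHS]scalerA [in RHS]scalerMzl.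
move=> w _; rewrite sh2sum_all tsumD.
pose T (b : word V) : int * V := (deg b + 1, li_q L (unzip2 (wproj b))).
pose TP (c d : word V) := tpure (sym_gr V) (mono c) (mono d).
have copM v : cop (mono v) = tsum v TP.
  rewrite /mono cop_mono sh2sum_all; apply: eq_tsum => c d _ _.
  by rewrite scale1r.
have QE v : Qmap L (mono v) =
    tsum v (fun b e => if (2 <= size b)%N then mono (T b :: e) else 0).
  rewrite Q_mono Qgen_tsum; apply: eq_tsum => b e _ _.
  by rewrite /coder_term ginv1 scale1r.
have copD : {morph @cop _ _ V : z z' / z + z'} by exact: sliftD (cop_bal V).
have cop0 : cop (0 : sym V) = 0.
  by apply: (addrI (cop (0 : sym V))); rewrite -copD !addr0.
rewrite QE (tsum_morph _ _ copD).
transitivity (tsum w (fun b e =>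
    tsum e (fun c d => if (2 <= size b)%N then TP (T b :: c) d else 0)) +
  tsum w (fun b e => tsum e (fun c d =>
    (if (2 <= size b)%N then TP c (T b :: d) else 0) *~ ksg ((deg b + 1) * deg c)))).
  rewrite -tsumD; apply: eq_tsum => b e _ _; case: ifP => _; first by rewrite copM.
  rewrite cop0 -tsumD -[LHS](mulr0z (tsum e TP)) -tsumMz.
  by apply: eq_tsum => c d _ _; rewrite mulr0z mul0rz addr0.
congr (_ + _).
  rewrite -tsum_assoc; apply: eq_tsum => c d _ _; rewrite QE.
  rewrite (tsum_morph _ _ (@tpureDl _ _ _ _ (sym_gr V) (mono d))).
  apply: eq_tsum => b e _ _; case: ifP => // _.
  by rewrite tpure0l.
transitivity (tsum w (fun c d => tsum d (fun b e =>
    (if (2 <= size b)%N then TP c (T b :: e) else 0) *~ ksg (deg c)))).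
  rewrite [RHS]tsum_assoc_comm; apply: eq_tsum => b e _ _; apply: eq_tsum => c d _ _.
  by rewrite -mulrzA -ksgD; congr (_ *~ ksg _); ring.
apply: eq_tsum => c d _ _; rewrite QE mul1r.
rewrite (tsum_morph _ _ (@tpureDr _ _ _ _ (sym_gr V) (mono c))) -tsumMz.
apply: eq_tsum => b e _ _; case: ifP => // _.
by rewrite tpure0r.
Qed.

Lemma Q_corestriction (w : word V) : hword w ->
  sym_V (Qmap L (mono w)) = if (2 <= size w)%N then li_q L (unzip2 w) else 0.
Proof.
move=> hw; have sD : {morph @sym_V _ _ V : z z' / z + z'} by exact: sliftD (sym_V_bal V).
have s0 : sym_V (0 : sym V) = 0.
  by apply: (addrI (sym_V (0 : sym V))); rewrite -sD !addr0.
have wE : wproj w = w.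
  elim: w hw => //= -[i x] w IH /andP[hx hw].
  by rewrite IH //= (homogE hx).
rewrite Q_mono Qgen_tsum (tsum_morph _ _ sD).
pose G (b : word V) := if (2 <= size b)%N then
  gproj (dgm_gr V) (deg b + 1) (li_q L (unzip2 (wproj b))) else 0.
transitivity (G w).
  rewrite -(tsum_nilr w G); apply: eq_tsum => b e _ _; rewrite /G.
  case: ifP => _; last by rewrite s0; case: e.
  rewrite /coder_term ginv1 scale1r /mono sym_V_mono /=.
  by case: e => //; rewrite scale1r.
rewrite /G wE; case: ifP => // h2.
have := ml_deg (li_ml L h2) hw (erefl _); exact: homogE.
Qed.
End QCoder.

Section LinfMorphisms.
Variables (K : fieldType) (R : dgca K).

(* \sum_k \sum_(i_1 + ... + i_k = n) 1/k! \sum_(s in Sh(i_1, ..., i_k)) eps(s)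
     g_k(f_(i_1)(x_s(1), ...), ..., f_(i_k)(..., x_s(n))).
   This is the left-hand side of the morphism equation, and also the n-th component
   of the composite of two L_infty[1] morphisms. *)
Definition comp_sum (U V W : dgmod R) (g : seq V -> W) (f : seq U -> V)
    (w : word U) : W :=
  \sum_(1 <= k < (size w).+1)
   \sum_(t : k.-tuple 'I_(size w).+1 |
           all (fun i : 'I__ => 0 < i)%N t && (sumn (map val t) == size w))
     dga_unit R (k`!%:R^-1) *:
       shsum (map val t) w (fun bs => g [seq f (unzip2 b) | b <- bs]).

Record linf_mor (V W : dgmod R) (LV : linf V) (LW : linf W) := LinfMor {
  lm_f :> seq V -> W;
  lm_ml : forall n, (1 <= n)%N -> multilin 0 n lm_f;
  lm_rel : forall w : word V, (1 <= size w)%N -> hword w ->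
    comp_sum (with_d (li_q LW)) lm_f w =
    \sum_(1 <= j < (size w).+1) sh2sum j w (fun b1 b2 =>
      lm_f (with_d (li_q LV) (unzip2 b1) :: unzip2 b2)) }.

(* Components (id, 0, 0, ...) of the identity morphism. *)
Definition linf_id (V : dgmod R) (s : seq V) : V := if s is [:: x] then x else 0.

Definition linf_iso (V W : dgmod R) (LV : linf V) (LW : linf W) : Prop :=
  exists (f : linf_mor LV LW) (g : linf_mor LW LV),
    (forall w : word V, (1 <= size w)%N -> hword w ->
       comp_sum g f w = linf_id (unzip2 w)) /\
    (forall w : word W, (1 <= size w)%N -> hword w ->
       comp_sum f g w = linf_id (unzip2 w)).

Definition linearizable (V : dgmod R) (L : linf V) : Prop :=
  linf_iso L (linear_linf V).
End LinfMorphisms.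

Section ShortExact.
Variables (K : fieldType) (R : dgca K).

(* The data of a DG module, degree by degree: its degree i component is the set of
   elements of the ambient module satisfying [ob_hom i], with differential [ob_d i].
   For a dgmod this is the family of its homogeneous components; coDer_R(S_R(V)) sits
   in the module of all functions S_R(V) -> S_R(V), with (r phi)(z) = r phi(z). *)
Record dgobj := DgObj {
  ob_car : lmodType R;
  ob_hom : int -> ob_car -> Prop;
  ob_d : int -> ob_car -> ob_car }.

(* Degree 0 R-linear cochain maps. *)
Record dg_hom (A B : dgobj) (f : ob_car A -> ob_car B) : Prop := DgHom {
  dh_hom : forall i u, ob_hom i u -> ob_hom i (f u);
  dh_add : forall i u v, ob_hom i u -> ob_hom i v -> f (u + v) = f u + f v;
  dh_scale : forall i k (a : R) u, homR k a -> ob_hom i u -> f (a *: u) = a *: f u;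
  dh_d : forall i u, ob_hom i u -> f (ob_d i u) = ob_d i (f u) }.

Record short_exact (A B C : dgobj) (i : ob_car A -> ob_car B)
    (p : ob_car B -> ob_car C) : Prop := ShortExact {
  se_i : dg_hom i;
  se_p : dg_hom p;
  se_inj : forall k u, ob_hom k u -> i u = 0 -> u = 0;
  se_mid : forall k v, ob_hom k v ->
    (p v = 0 <-> exists2 u, ob_hom k u & i u = v);
  se_surj : forall k c, ob_hom k c -> exists2 v, ob_hom k v & p v = c }.

Definition split_exact (A B C : dgobj) (i : ob_car A -> ob_car B)
    (p : ob_car B -> ob_car C) : Prop :=
  short_exact i p /\
  exists s : ob_car C -> ob_car B,
    dg_hom s /\ forall k c, ob_hom k c -> p (s c) = c.
End ShortExact.

Section TheSequence.
Variables (K : fieldType) (R : dgca K) (V : dgmod R) (L : linf V).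

Definition dgobj_of : dgobj R := @DgObj K R V (@homm K R V) (fun _ => @dgm_d K R V).
Definition coDer : dgobj R :=
  @DgObj K R (sym V -> sym V : lmodType R) (@coder K R V) (LD L).
Definition F1coDer : dgobj R :=
  @DgObj K R (sym V -> sym V : lmodType R) (@coder_F1 K R V) (LD L).
Definition F1_incl (phi : ob_car F1coDer) : ob_car coDer := phi.
Definition ev_one (phi : ob_car coDer) : ob_car dgobj_of := ev1 phi.
End TheSequence.

(* Main.v *)
(* A section s of ev_1 commuting with the differentials exponentiates:
     E(x_1 o ... o x_n) = 1/n! \sum eps s(x_sigma(1)) ... s(x_sigma(n)) 1
   is a morphism of coalgebras, because the s(x) are coderivations and 1 is group-like,
   and it intertwines \tilde d_V with D, because [D, s(x)] = s(d x) and D 1 = 0.  Its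
   linear part is the identity, so it is invertible, and the Taylor coefficients of its
   inverse linearize the L_infty[1] algebra.  Conversely, if F : S(V) -> S(V) is the
   coalgebra isomorphism given by a linearization, with first Taylor coefficient f_1,
   then x |-> F^-1 o (f_1(x) o -) o F is a section.

   Corestrictions determine coalgebra morphisms and coderivations because, writing pr_V
   for the projection onto V and mu for the product, mu (pr_V (x) id) Delta is the Euler
   derivation, multiplication by n on V^{o n}, which in characteristic zero is injective
   on the kernel of the counit. *)
Require Import Defs.
From mathcomp Require Import all_boot all_order all_algebra.
From mathcomp Require Import ring zify boolp functions.
Set Implicit Arguments.
Unset Strict Implicit.
Unset Printing Implicit Defensive.
Import GRing.Theory.
Local Open Scope ring_scope.

(** The codifferential differentiates scalars, so in general it is not [R]-linear and not a
    coderivation in the sense of [coder]; its compatibility with Delta and with morphisms needs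
    separate arguments, and uniqueness is proved for functions of words. Two-block shuffles are
    handled by the recursion [tsum] on the first letter, with [tsum_assoc] and [tsum_assoc_comm]
    playing the roles of coassociativity and cocommutativity. Multi-shuffles with 1/k! matter only
    for reading [comp_sum] as a corestriction of a cofree extension. The operators s(x) need not
    commute with each other: this is why E is symmetrized, and why its proofs rest on the recursion
    n E(w) = \sum eps s(x_i) E(w without x_i) instead of one that peels off the first letter. E is
    invertible because E(w) is w plus shorter words. In the converse direction the section is a
    cochain map because [D_0, v o -] = (d v) o - for the codifferential D_0 of the linear structure,
    and because f_1 commutes with d. *)

Lemma morphD0 (M M' : zmodType) (f : M -> M') : {morph f : x y / x + y} -> f 0 = 0.
Proof. by move=> fD; apply: (addrI (f 0)); rewrite -fD !addr0. Qed.

Lemma morphD_sum (M M' : zmodType) (f : M -> M') (I : Type) (r : seq I) (P : pred I) F :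
  {morph f : x y / x + y} -> f (\sum_(i <- r | P i) F i) = \sum_(i <- r | P i) f (F i).
Proof. by move=> fD; apply: (big_morph f fD (morphD0 fD)). Qed.

Lemma ksg0 : ksg 0 = 1.
Proof. by rewrite /ksg expr0z. Qed.

Lemma ksg2 n : ksg (n + n) = 1.
Proof. by rewrite ksgD ksgK. Qed.

Lemma ksg_even (c m n : int) : m = n + (c + c) -> ksg m = ksg n.
Proof. by move=> ->; rewrite ksgD ksg2 mulr1. Qed.

Lemma mulrz_ksg2 (M : zmodType) (x : M) m n : x *~ ksg m *~ ksg n = x *~ ksg (m + n).
Proof. by rewrite -mulrzA ksgD. Qed.

(** * Graded maps and multilinear functions of words *)

Section HomogeneousExtension.
Variables (A : zmodType) (G : grading A) (M : zmodType).
Implicit Types (Phi : int -> A -> M) (x y : A).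

Definition supp x : seq int := s2val (cid2 (gfin G x)).

Definition homsum Phi x : M := \sum_(i <- supp x) Phi i (gproj G i x).

Lemma supp_uniq x : uniq (supp x).
Proof. by rewrite /supp; case: cid2. Qed.

Lemma suppE x : x = \sum_(i <- supp x) gproj G i x.
Proof. by rewrite /supp; case: cid2. Qed.

Lemma gproj_supp i x : i \notin supp x -> gproj G i x = 0.
Proof.
move=> hi; rewrite {1}[x]suppE gproj_sum big_seq big1 // => j hj.
by rewrite gprojK ifN //; apply: contraNneq hi => ->.
Qed.

(** The support chosen by [supp] is not additive in [x]; sums over a common larger list can be
    compared termwise. *)
Lemma homsum_widen Phi x s : (forall i, {morph Phi i : y z / y + z}) ->
  uniq s -> {subset supp x <= s} -> homsum Phi x = \sum_(i <- s) Phi i (gproj G i x).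
Proof.
move=> PD us sub; rewrite (bigID (mem (supp x))) /= [X in _ + X]big1 ?addr0.
  2: by move=> i /gproj_supp ->; rewrite (morphD0 (PD i)).
rewrite -big_filter; apply: perm_big; apply: uniq_perm; rewrite ?filter_uniq ?supp_uniq //.
move=> i; rewrite mem_filter /=; case: (boolP (i \in supp x)) => //= hi.
by rewrite (sub _ hi).
Qed.

Lemma homsumD Phi : (forall i, {morph Phi i : y z / y + z}) ->
  {morph homsum Phi : x y / x + y}.
Proof.
move=> PD x y; pose s := undup (supp x ++ supp y ++ supp (x + y)).
have us : uniq s by apply: undup_uniq.
rewrite !(homsum_widen PD us) => [||z hz|z hz]; try by rewrite mem_undup !mem_cat hz ?orbT.
  by rewrite -big_split; apply: eq_bigr => i _; rewrite gprojD PD.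
by move=> z hz; rewrite mem_undup !mem_cat hz ?orbT.
Qed.

Lemma homsum_homog Phi i x : (forall i, {morph Phi i : y z / y + z}) ->
  homog G i x -> homsum Phi x = Phi i x.
Proof.
move=> PD hx; pose s := undup (i :: supp x).
rewrite (homsum_widen PD (undup_uniq (i :: supp x))); last first.
  by move=> z hz; rewrite mem_undup inE hz orbT.
rewrite (bigD1_seq i) ?undup_uniq ?mem_undup ?mem_head //= (homogE hx) big1 ?addr0 // => j ji.
by rewrite (gproj_homog_neq hx ji) (morphD0 (PD j)).
Qed.

End HomogeneousExtension.

Section Twist.
Variables (A : zmodType) (G : grading A).
Implicit Types (p q i : int) (x : A).

(** The sign (-1)^(p|x|) that a map of degree [p] picks up in passing [x], made available for
    inhomogeneous [x]. *)
Definition twist p x : A := homsum G (fun i y => y *~ ksg (p * i)) x.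

Lemma twistD p : {morph twist p : x y / x + y}.
Proof. by apply: homsumD => i y z; rewrite mulrzDl. Qed.

Lemma twist_homog p i x : homog G i x -> twist p x = x *~ ksg (p * i).
Proof.
by move=> h; rewrite /twist (homsum_homog _ h) // => j y z; rewrite mulrzDl.
Qed.

Lemma twist0 x : twist 0 x = x.
Proof.
rewrite -[RHS](_ : id x = x) //; move: x.
apply: (grade_ext (G := G)) => // [|i x hx]; first exact: twistD.
by rewrite (twist_homog _ hx) mul0r ksg0 mulr1z.
Qed.
End Twist.

Section GradedMaps.
Variables (K : fieldType) (R : dgca K).

Record gmap (A B : lmodType R) (GA : grading A) (GB : grading B) (p : int)
    (phi : A -> B) : Prop := GMap {
  gm_add : {morph phi : x y / x + y};
  gm_deg : forall m x, homog GA m x -> homog GB (m + p) (phi x);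
  gm_lin : forall k (a : R) x, homR k a -> phi (a *: x) = (a *: phi x) *~ ksg (k * p) }.

Lemma homR1 : homR 0 (1 : R).
Proof. by have := dga_unit0 R 1; rewrite rmorph1. Qed.

Lemma gmap_comp (A B C : lmodType R) (GA : grading A) (GB : grading B)
    (GC : grading C) p q phi psi :
  gmap GB GC q psi -> gmap GA GB p phi -> gmap GA GC (p + q) (psi \o phi).
Proof.
move=> hq hp; split=> [x y|m x hx|k a x ha] /=.
- by rewrite (gm_add hp) (gm_add hq).
- by rewrite addrA; apply: (gm_deg hq); apply: (gm_deg hp).
rewrite (gm_lin hp _ ha) (morphD_mulrz (gm_add hq)) (gm_lin hq _ ha).
by rewrite mulrz_ksg2; congr (_ *~ ksg _); ring.
Qed.

Lemma gmap_id (A : lmodType R) (GA : grading A) : gmap GA GA 0 id.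
Proof. by split=> [||k a x _] //= => [m x|]; rewrite ?addr0 // mulr0 ksg0 mulr1z. Qed.

Lemma gmap0 (A B : lmodType R) (GA : grading A) (GB : grading B) p :
  gmap GA GB p (fun _ => 0).
Proof.
split=> [x y|m x _|k a x _]; rewrite ?addr0 ?scaler0 ?mul0rz //; exact: homog0.
Qed.

Lemma gmapD (A B : lmodType R) (GA : grading A) (GB : grading B) p phi psi :
  gmap GA GB p phi -> gmap GA GB p psi -> gmap GA GB p (fun x => phi x + psi x).
Proof.
move=> h h'; split=> [x y|m x hx|k a x ha].
- by rewrite (gm_add h) (gm_add h') addrACA.
- by apply: homogD; [apply: (gm_deg h)|apply: (gm_deg h')].
by rewrite (gm_lin h _ ha) (gm_lin h' _ ha) scalerDr mulrzDl.
Qed.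

Lemma gmapN (A B : lmodType R) (GA : grading A) (GB : grading B) p phi :
  gmap GA GB p phi -> gmap GA GB p (fun x => - phi x).
Proof.
move=> h; split=> [x y|m x hx|k a x ha].
- by rewrite (gm_add h) opprD.
- by have := homogMz (-1) (gm_deg h hx); rewrite mulrN1z.
by rewrite (gm_lin h _ ha) scalerN mulNrz.
Qed.

Lemma gmap0_lin (A B : lmodType R) (GA : grading A) (GB : grading B) phi :
  gmap GA GB 0 phi -> forall (a : R) x, phi (a *: x) = a *: phi x.
Proof.
move=> h a x; move: a; apply: (grade_ext (G := dga_gr R)) => [a b|a b|k a ha].
- by rewrite scalerDl (gm_add h).
- by rewrite scalerDl.
by rewrite (gm_lin h _ ha) mulr0 ksg0 mulr1z.
Qed.

Section Rational.
Hypothesis charK : [pchar K]%R =i pred0.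

Definition rinv (n : nat) : R := dga_unit R (n%:R^-1).

Lemma rinv_hom n : homR 0 (rinv n).
Proof. exact: dga_unit0. Qed.

(** The characteristic enters the proofs through this cancellation. The inverse is taken in [K],
    since [R] is only a target of [K] and may be the zero ring. *)
Lemma rinvK (A : lmodType R) (n : nat) (x : A) : (0 < n)%N -> rinv n *: (x *+ n) = x.
Proof.
move=> n0; rewrite -scaler_nat scalerA /rinv -(rmorph_nat (dga_unit R)) -rmorphM.
rewrite mulVf ?rmorph1 ?scale1r //.
by rewrite ((pcharf0P K).1 charK) -lt0n.
Qed.

End Rational.
End GradedMaps.

Section MultilinearWords.
Variables (K : fieldType) (R : dgca K) (V : dgmod R).
Variables (M : lmodType R) (GM : grading M).
Hypothesis actM : forall i j (a : R) x, homR i a -> homog GM j x -> homog GM (i + j) (a *: x).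
Implicit Types (p : int) (h : word V -> M).

(* The functions of words that define a map on S_R(V), R-linear of degree p for the
   Koszul signs; [mlw] adds that they are of degree p for the gradings. *)
Record wlin (p : int) (h : word V -> M) : Prop := Wlin {
  mw_add : forall w1 i x y w2,
    h (w1 ++ (i, x + y) :: w2) = h (w1 ++ (i, x) :: w2) + h (w1 ++ (i, y) :: w2);
  mw_proj : forall w1 i x w2,
    h (w1 ++ (i, x) :: w2) = h (w1 ++ (i, gproj (dgm_gr V) i x) :: w2);
  mw_scale : forall w1 k (a : R) i x w2, homR k a -> homm i x ->
    h (w1 ++ (k + i, a *: x) :: w2) =
    (a *: h (w1 ++ (i, x) :: w2)) *~ ksg (k * (p + deg w1));
  mw_swap : forall w1 i x j y w2,
    h (w1 ++ (i, x) :: (j, y) :: w2) =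
    h (w1 ++ (j, y) :: (i, x) :: w2) *~ ksg (i * j) }.

Record mlw (p : int) (h : word V -> M) : Prop := Mlw {
  mw_lin :> wlin p h;
  mw_deg : forall w, homog GM (deg w + p) (h w) }.

(** The twist is the sign of moving a map of degree [p] past the coefficient [r]. *)
Definition ext p h : sym V -> M := slift (fun r w => twist (dga_gr R) p r *: h w).

Lemma twistM p r k (a : R) : homR k a ->
  twist (dga_gr R) p (r * a) = twist (dga_gr R) p r * a *~ ksg (p * k).
Proof.
move=> ha; move: r; apply: (grade_ext (G := dga_gr R)) => [r r'|r r'|i r hr].
- by rewrite mulrDl twistD.
- by rewrite twistD mulrDl mulrzDl.
rewrite (twist_homog _ (dga_mul hr ha)) (twist_homog _ hr) mulrzAl mulrz_ksg2.
by rewrite mulrDr.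
Qed.

Lemma twistMl p r k (a : R) : homR k a ->
  twist (dga_gr R) p (a * r) = a * twist (dga_gr R) p r *~ ksg (p * k).
Proof.
move=> ha; move: r; apply: (grade_ext (G := dga_gr R)) => [r r'|r r'|i r hr].
- by rewrite mulrDr twistD.
- by rewrite twistD mulrDr mulrzDl.
rewrite (twist_homog _ (dga_mul ha hr)) (twist_homog _ hr) mulrzAr mulrz_ksg2.
by rewrite -mulrDr addrC.
Qed.

Lemma twist1 p : twist (dga_gr R) p (1 : R) = 1.
Proof. by rewrite (twist_homog _ (homR1 R)) mulr0 ksg0 mulr1z. Qed.

Lemma ext_bal p h : mlw p h -> sbal (fun r w => twist (dga_gr R) p r *: h w).
Proof.
move=> H; split=> [r r' w|r w1 i x y w2|r w1 i x w2|r w1 k a i x w2 ha hx|r w1 i x j y w2].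
- by rewrite twistD scalerDl.
- by rewrite (mw_add H) scalerDr.
- by rewrite (mw_proj H).
- rewrite (mw_scale H) // (twistM _ _ ha) -scalerMzr scalerA -scalerMzl mulrz_ksg2.
  by congr (_ *~ ksg _); ring.
by rewrite (mw_swap H) -scalerMzr.
Qed.

Lemma ext_rmono p h r w : mlw p h -> ext p h (rmono r w) = twist (dga_gr R) p r *: h w.
Proof. by move=> H; rewrite /ext (slift_mono _ _ (ext_bal H)). Qed.

Lemma ext_mono p h w : mlw p h -> ext p h (mono w) = h w.
Proof. by move=> H; rewrite /mono (ext_rmono _ _ H) twist1 scale1r. Qed.

Lemma extD p h : mlw p h -> {morph ext p h : z z' / z + z'}.
Proof. by move=> H; apply: sliftD (ext_bal H). Qed.

Lemma ext_gmap p h : mlw p h -> gmap (sym_gr V) GM p (ext p h).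
Proof.
move=> H; split; first exact: extD.
- move=> m z /homogE <-; apply/eqP; move: z => /=.
  apply: sym_ext => [z z'|z z'|r w]; rewrite ?sprojD ?(extD H) // ?gprojD //.
  apply/eqP; rewrite sproj_mono (ext_rmono _ _ H).
  have hr := gproj_homog (dga_gr R) (m - deg w) r.
  rewrite (twist_homog _ hr) -scalerMzl -[_ == _]/(homog GM (m + p) _).
  apply: homogMz; rewrite (_ : m + p = (m - deg w) + (deg w + p)); last by ring.
  by apply: actM => //; apply: (mw_deg H).
move=> k a z ha; move: z; apply: sym_ext => [z z'|z z'|r w].
- by rewrite scalerDr (extD H).
- by rewrite (extD H) scalerDr mulrzDl.
rewrite scale_rmono !(ext_rmono _ _ H) (twistMl _ _ ha) -scalerMzl scalerA.
by rewrite mulrC.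
Qed.

Lemma gmap_mlw p (phi : sym V -> M) :
  gmap (sym_gr V) GM p phi -> mlw p (fun w => phi (mono w)).
Proof.
move=> H; split; first split=> [w1 i x y w2|w1 i x w2|w1 k a i x w2 ha hx|w1 i x j y w2].
- by rewrite mono_slotD (gm_add H).
- by rewrite mono_proj.
- rewrite mono_slotZ // (morphD_mulrz (gm_add H)) (gm_lin H _ ha) mulrz_ksg2.
  by congr (_ *~ ksg _); ring.
- by rewrite mono_swap (morphD_mulrz (gm_add H)).
move=> w; exact: (gm_deg H (homog_mono w)).
Qed.

(** Each relation compares words of one and the same length, so a family indexed by the length
    glues. *)
Lemma mlw_size p (h : nat -> word V -> M) :
  (forall n, mlw p (h n)) -> mlw p (fun w => h (size w) w).
Proof.
move=> H; split; first split=> [w1 i x y w2|w1 i x w2|w1 k a i x w2 ha hx|w1 i x j y w2];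
  rewrite ?size_cat /= ?addnS.
- exact: (mw_add (H _)).
- exact: (mw_proj (H _)).
- exact: (mw_scale (H _)).
- exact: (mw_swap (H _)).
move=> w; exact: (mw_deg (H (size w))).
Qed.

Lemma mlw0 p : mlw p (fun _ => 0).
Proof.
split; first split=> *; move=> *; rewrite ?addr0 ?scaler0 ?mul0rz //; exact: homog0.
Qed.

Lemma mlwD p h h' : mlw p h -> mlw p h' -> mlw p (fun w => h w + h' w).
Proof.
move=> H H'; split; first split=> [w1 i x y w2|w1 i x w2|w1 k a i x w2 ha hx|w1 i x j y w2].
- by rewrite (mw_add H) (mw_add H') addrACA.
- by rewrite (mw_proj H) (mw_proj H').
- by rewrite (mw_scale H) // (mw_scale H') // scalerDr mulrzDl.
- by rewrite (mw_swap H) (mw_swap H') mulrzDl.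
by move=> w; apply: homogD; [apply: (mw_deg H)|apply: (mw_deg H')].
Qed.

Lemma mlw_sum p (I : Type) (r : seq I) (h : I -> word V -> M) :
  (forall i, mlw p (h i)) -> mlw p (fun w => \sum_(i <- r) h i w).
Proof.
move=> H; elim: r => [|i r IH].
  rewrite (_ : (fun w => _) = fun _ => 0); first exact: mlw0.
  by rewrite funeqE => w; rewrite big_nil.
rewrite (_ : (fun w => _) = fun w => h i w + \sum_(j <- r) h j w); first exact: mlwD.
by rewrite funeqE => w; rewrite big_cons.
Qed.

Lemma mlw_scale0 p (a : R) h : homR 0 a -> mlw p h -> mlw p (fun w => a *: h w).
Proof.
move=> ha H; split; first split=> [w1 i x y w2|w1 i x w2|w1 k b i x w2 hb hx|w1 i x j y w2].
- by rewrite (mw_add H) scalerDr.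
- by rewrite (mw_proj H).
- rewrite (mw_scale H) // -scalerMzr scalerA (dga_comm ha hb) mul0r ksg0 mulr1z.
  by rewrite -scalerA.
- by rewrite (mw_swap H) -scalerMzr.
by move=> w; rewrite -[_ + p]add0r; apply: actM => //; apply: (mw_deg H).
Qed.

(** A scalar in the second block has to pass the first block as well, hence the degree [p + deg b]
    in the second slot. *)
Lemma mlw_tsum p (H : word V -> word V -> M) :
  (forall b, wlin p (H^~ b)) ->
  (forall b, wlin (p + deg b) (H b)) ->
  (forall b1 b2, homog GM (deg b1 + deg b2 + p) (H b1 b2)) ->
  mlw p (fun w => tsum w H).
Proof.
move=> H1 H2 H3; split.
  split=> [w1 i x y w2|w1 i x w2|w1 k a i x w2 ha hx|w1 i x j y w2].
  - by apply: tsum_slotD => [u1 u2 b|b u1 u2]; [apply: (mw_add (H1 b))|apply: (mw_add (H2 b))].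
  - by apply: tsum_slotE => [u1 u2 b|b u1 u2]; [apply: (mw_proj (H1 b))|apply: (mw_proj (H2 b))].
  - rewrite (@tsum_slotZ _ _ _ _ w1 k a i x w2 H (fun b1 b2 => a *: H b1 b2) p); first last.
    + by move=> b u1 u2; rewrite (mw_scale (H2 b)) //; congr (_ *~ ksg _); ring.
    + by move=> u1 u2 b; rewrite (mw_scale (H1 b)) //; congr (_ *~ ksg _); ring.
    rewrite (@tsum_morph _ _ _ _ _ ( *:%R a)); last exact: scalerDr.
    by congr (_ *~ ksg _); ring.
  by apply: tsum_swap => [u1 u2 b|b u1 u2]; [apply: (mw_swap (H1 b))|apply: (mw_swap (H2 b))].
by move=> w; apply: homog_tsum => b1 b2 <-; apply: H3.
Qed.
End MultilinearWords.

Lemma gmapMz (K : fieldType) (R : dgca K) (A B : lmodType R) (GA : grading A)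
    (GB : grading B) p phi n :
  gmap GA GB p phi -> gmap GA GB p (fun x => phi x *~ n).
Proof.
move=> h; split=> [x y|m x hx|k a x ha].
- by rewrite (gm_add h) mulrzDl.
- by apply: homogMz; apply: (gm_deg h).
by rewrite (gm_lin h _ ha) -scalerMzr mulrzAC.
Qed.

(** * Multiplication by vectors in the symmetric algebra *)

Section SymModule.
Variables (K : fieldType) (R : dgca K) (V : dgmod R).
Implicit Types (z : sym V) (w : word V) (t u : int * V).

Lemma gproj_mull k (a : R) m r : homR k a ->
  gproj (dga_gr R) m (a * r) = a * gproj (dga_gr R) (m - k) r.
Proof.
move=> ha; move: r; apply: (grade_ext (G := dga_gr R)) => [r r'|r r'|i r hr].
- by rewrite mulrDr gprojD.
- by rewrite gprojD mulrDr.
have har := dga_mul ha hr; have [->|ne] := eqVneq m (k + i).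
  by rewrite (homogE har) [k + i]addrC addrK (homogE hr).
rewrite (gproj_homog_neq har ne) (gproj_homog_neq hr) ?mulr0 //.
by apply: contra_neq ne => <-; rewrite addrC subrK.
Qed.

Lemma sym_act i j (a : R) z :
  homR i a -> homog (sym_gr V) j z -> homog (sym_gr V) (i + j) (a *: z).
Proof.
move=> ha /homogE <-; apply/eqP; move: z => /=.
apply: sym_ext => [z z'|z z'|r w]; rewrite ?sprojD ?scalerDr ?sprojD //.
rewrite !sproj_mono !scale_rmono sproj_mono; congr rmono.
rewrite (gproj_mull _ _ ha) (_ : i + j - deg w - i = j - deg w); last by ring.
by rewrite gprojK eqxx.
Qed.

Lemma gmap_scale k (a : R) : homR k a -> gmap (sym_gr V) (sym_gr V) k ( *:%R a).
Proof.
move=> ha; split=> [x y|m x hx|l b x hb].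
- exact: scalerDr.
- by rewrite addrC; apply: sym_act.
by rewrite !scalerA (dga_comm ha hb) scalerMzl mulrC.
Qed.

Lemma mono_wproj w : mono (wproj w) = mono w.
Proof.
suff h (u : word V) : mono (u ++ wproj w) = mono (u ++ w) by exact: (h [::]).
elim: w u => [|[i x] w IH] u //=.
by rewrite [RHS]mono_proj -!cat_rcons IH.
Qed.

Lemma gmap_sym_ext (M : lmodType R) (GM : grading M) p (phi psi : sym V -> M) :
  gmap (sym_gr V) GM p phi -> gmap (sym_gr V) GM p psi ->
  (forall w, hword w -> phi (mono w) = psi (mono w)) -> phi =1 psi.
Proof.
move=> hp hq e.
have {}e w : phi (mono w) = psi (mono w).
  by rewrite -mono_wproj; apply: e; apply: hword_wproj.
apply: sym_ext => [x y|x y|r w]; rewrite ?(gm_add hp) ?(gm_add hq) //.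
rewrite rmonoE; move: r.
apply: (grade_ext (G := dga_gr R)) => [r r'|r r'|k r hr]; rewrite ?scalerDl ?(gm_add hp) ?(gm_add hq) //.
by rewrite (gm_lin hp _ hr) (gm_lin hq _ hr) e.
Qed.

Lemma wproj_hword w : hword w -> wproj w = w.
Proof. by elim: w => //= -[i x] w IH /andP[hx hw]; rewrite IH //= (homogE hx). Qed.

Lemma mlw_mono : mlw (sym_gr V) 0 (@mono _ _ V).
Proof. exact: (gmap_mlw (gmap_id (sym_gr V))). Qed.

Lemma lmul_mlw t : mlw (sym_gr V) t.1 (fun w => mono (t :: w)).
Proof.
split; first split=> [w1 i x y w2|w1 i x w2|w1 k a i x w2 ha hx|w1 i x j y w2];
  rewrite -?cat_cons.
- exact: mono_slotD.
- exact: mono_proj.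
- by rewrite mono_slotZ // deg_cons.
- exact: mono_swap.
by move=> w; rewrite addrC -deg_cons; apply: homog_mono.
Qed.

(** Left multiplication by one letter takes the place of a product on S(V): the formulas below,
    cofree extensions included, multiply by one vector at a time. *)
Definition lmul t : sym V -> sym V := ext t.1 (fun w => mono (t :: w)).

Lemma lmul_gmap t : gmap (sym_gr V) (sym_gr V) t.1 (lmul t).
Proof. exact: (ext_gmap sym_act (lmul_mlw t)). Qed.

Lemma lmul_mono t w : lmul t (mono w) = mono (t :: w).
Proof. exact: (ext_mono _ (lmul_mlw t)). Qed.

Lemma lmulD t : {morph lmul t : z z' / z + z'}.
Proof. exact: (gm_add (lmul_gmap t)). Qed.

Lemma lmulDl i x y z : lmul (i, x + y) z = lmul (i, x) z + lmul (i, y) z.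
Proof.
move: z; apply: (gmap_sym_ext (lmul_gmap (i, x + y)) (gmapD (lmul_gmap (i, x)) (lmul_gmap (i, y)))) => w _.
by rewrite !lmul_mono (mono_slotD [::]).
Qed.

Lemma lmul_proj i x z : lmul (i, gproj (dgm_gr V) i x) z = lmul (i, x) z.
Proof.
move: z; apply: (gmap_sym_ext (lmul_gmap (i, gproj (dgm_gr V) i x)) (lmul_gmap (i, x))) => w _.
by rewrite !lmul_mono -(mono_proj [::]).
Qed.

Lemma lmulZ k (a : R) i x z : homR k a -> homm i x ->
  lmul (k + i, a *: x) z = a *: lmul (i, x) z.
Proof.
move=> ha hx; move: z.
have h : gmap (sym_gr V) (sym_gr V) (k + i) (fun z => a *: lmul (i, x) z).
  by rewrite addrC; exact: (gmap_comp (gmap_scale ha) (lmul_gmap (i, x))).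
apply: (gmap_sym_ext (lmul_gmap (k + i, a *: x)) h) => w _.
by rewrite !lmul_mono mono_consZ.
Qed.

Lemma lmul_comm t u z : lmul t (lmul u z) = lmul u (lmul t z) *~ ksg (t.1 * u.1).
Proof.
move: z; have h1 := gmap_comp (lmul_gmap t) (lmul_gmap u).
have h2 := gmapMz (ksg (t.1 * u.1)) (gmap_comp (lmul_gmap u) (lmul_gmap t)).
rewrite addrC in h2; apply: (gmap_sym_ext h1 h2) => w _ /=.
by rewrite !lmul_mono; case: t u {h1 h2} => i x [j y]; apply: (mono_swap [::]).
Qed.

Lemma lmul0 i z : lmul (i, 0) z = 0.
Proof. by apply: (morphD0 (f := fun x => lmul (i, x) z)) => x y; apply: lmulDl. Qed.

(* Multiplication by an untagged, possibly inhomogeneous, vector. *)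
Definition vmul (x : V) z : sym V := homsum (dgm_gr V) (fun i y => lmul (i, y) z) x.

Lemma vmul_homog i x z : homm i x -> vmul x z = lmul (i, x) z.
Proof. by move=> hx; rewrite /vmul (homsum_homog _ hx) // => j y y'; apply: lmulDl. Qed.

Lemma vmulDl z : {morph vmul^~ z : x y / x + y}.
Proof. by apply: homsumD => j y y'; apply: lmulDl. Qed.

Lemma vmulDr x : {morph vmul x : z z' / z + z'}.
Proof. by move=> z z'; rewrite /vmul /homsum -big_split; apply: eq_bigr => i _; apply: lmulD. Qed.

Lemma vmulZl (a : R) x z : vmul (a *: x) z = a *: vmul x z.
Proof.
move: a; apply: (grade_ext (G := dga_gr R)) => [a b|a b|k a ha].
- by rewrite scalerDl vmulDl.
- by rewrite scalerDl.
move: x; apply: (grade_ext (G := dgm_gr V)) => [x y|x y|i x hx].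
- by rewrite scalerDr vmulDl.
- by rewrite vmulDl scalerDr.
by rewrite (vmul_homog _ (dgm_act ha hx)) (vmul_homog _ hx) lmulZ.
Qed.

Lemma vmulZr k (a : R) i x z : homR k a -> homm i x ->
  vmul x (a *: z) = (a *: vmul x z) *~ ksg (k * i).
Proof. by move=> ha hx; rewrite !(vmul_homog _ hx) (gm_lin (lmul_gmap (i, x)) _ ha). Qed.

Lemma vmul_comm i j x y z : homm i x -> homm j y ->
  vmul x (vmul y z) = vmul y (vmul x z) *~ ksg (i * j).
Proof. by move=> hx hy; rewrite !(vmul_homog _ hx) !(vmul_homog _ hy) lmul_comm. Qed.

(** [multilin] speaks of untagged, possibly inhomogeneous vectors, so multilinear maps are read off
    a map on S(V) through [vmul] and not through tagged words. *)
Definition smono (s : seq V) : sym V := foldr vmul (mono [::]) s.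

Lemma smono_hword w : hword w -> smono (unzip2 w) = mono w.
Proof.
elim: w => //= -[i x] w IH /andP[hx hw].
by rewrite IH // (vmul_homog _ hx) lmul_mono.
Qed.

Lemma foldr_vmulD (s : seq V) : {morph (fun z => foldr vmul z s) : z z' / z + z'}.
Proof. by elim: s => //= x s IH z z'; rewrite IH vmulDr. Qed.

Lemma smono_multilin (W : dgmod R) p (phi : sym V -> W) n :
  gmap (sym_gr V) (dgm_gr W) p phi -> multilin p n (fun s => phi (smono s)).
Proof.
move=> h; split=> [s1 x y s2 _|w k a x s2 hw ha _|s1 i x j y s2 hx hy _|w hw _].
- by rewrite /smono !foldr_cat /= vmulDl foldr_vmulD (gm_add h).
- rewrite /smono !foldr_cat /= vmulZl; set z := vmul x _.
  suff -> : foldr vmul (a *: z) (unzip2 w) = a *: foldr vmul z (unzip2 w) *~ ksg (k * deg w).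
    by rewrite (morphD_mulrz (gm_add h)) (gm_lin h _ ha) mulrz_ksg2 mulrDr.
  elim: w hw => [|[i y] w IH] /=; first by rewrite deg_nil mulr0 ksg0 mulr1z.
  case/andP=> hy hw; rewrite IH // (morphD_mulrz (@vmulDr y)) (vmulZr _ ha hy).
  by rewrite mulrz_ksg2 deg_cons mulrDr.
- rewrite /smono !foldr_cat /= (vmul_comm _ hx hy) (morphD_mulrz (foldr_vmulD s1)).
  by rewrite (morphD_mulrz (gm_add h)).
by rewrite smono_hword //; apply: (gm_deg h); apply: homog_mono.
Qed.

End SymModule.

Section Corestriction.
Variables (K : fieldType) (R : dgca K) (V W : dgmod R).

(** Projecting the letters makes the function respect tags; the value 0 on the empty word expresses
    that an L_infty[1] morphism has no zeroth coefficient. *)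
Definition corestr (f : seq V -> W) (w : word V) : W :=
  if w is [::] then 0 else f (unzip2 (wproj w)).

Lemma corestr_hword f w : hword w -> (0 < size w)%N -> corestr f w = f (unzip2 w).
Proof. by case: w => // t w /wproj_hword hw _; rewrite /corestr hw. Qed.

Lemma corestr_mlw f p : (forall n, (1 <= n)%N -> multilin p n f) ->
  mlw (dgm_gr W) p (corestr f).
Proof.
move=> ml.
have vE (u1 : word V) i x u2 : unzip2 (wproj (u1 ++ (i, x) :: u2)) =
    unzip2 (wproj u1) ++ gproj (dgm_gr V) i x :: unzip2 (wproj u2).
  by rewrite wproj_cat /unzip2 map_cat.
have sv (u : word V) : size (unzip2 (wproj u)) = size u by rewrite !size_map.
have cE (u1 : word V) t u2 : corestr f (u1 ++ t :: u2) = f (unzip2 (wproj (u1 ++ t :: u2))).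
  by case: u1.
split; first split=> [w1 i x y w2|w1 i x w2|w1 k a i x w2 ha hx|w1 i x j y w2]; rewrite ?cE.
- by rewrite !vE gprojD (ml_add (ml (size w1 + size w2).+1 _)) ?sv.
- by rewrite !vE gprojK eqxx.
- rewrite !vE gproj_scale // (ml_scale (ml (size w1 + size w2).+1 _) (k := k)) ?hword_wproj ?size_map //.
  by rewrite deg_wproj.
- rewrite !vE /= (ml_sym (ml (size w1 + size w2).+2 _)
    (gproj_homog (dgm_gr V) i x) (gproj_homog (dgm_gr V) j y)) ?sv //.
case=> [|t w]; first exact: homog0.
rewrite /corestr -(deg_wproj (t :: w)).
by apply: (ml_deg (ml (size w).+1 _)); rewrite ?hword_wproj //= size_map.
Qed.
End Corestriction.

(** * Coderivations and coalgebra morphisms *)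

Section TensorMaps.
Variables (K : fieldType) (R : dgca K).
Variables (A B A' B' : lmodType R).
Variables (GA : grading A) (GB : grading B) (GA' : grading A') (GB' : grading B').
Hypothesis actA : forall i j (a : R) x, homR i a -> homog GA j x -> homog GA (i + j) (a *: x).

Lemma tens_ext (M : zmodType) (f h : tens B GA -> M) :
  {morph f : x y / x + y} -> {morph h : x y / x + y} ->
  (forall i x y, homog GA i x -> f (tpure GA x y) = h (tpure GA x y)) -> f =1 h.
Proof.
move=> fD hD e; apply: pres_ext => // -[x y]; rewrite -/(tpure GA x y).
move: x; apply: (grade_ext (G := GA)) => [x x'|x x'|i x hx]; last exact: (e i).
  by rewrite tpureDl fD.
by rewrite tpureDl hD.
Qed.

Lemma tens_respects (M : zmodType) (g : A -> B -> M) :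
  (forall y, {morph g^~ y : x x' / x + x'}) -> (forall x, {morph g x : y y' / y + y'}) ->
  (forall k (r : R) i x y, homR k r -> homog GA i x ->
     g (r *: x) y = g x (r *: y) *~ ksg (k * i)) ->
  respects (@tens_rel _ _ A B GA) (fun xy => g xy.1 xy.2).
Proof.
move=> hl hr hb l [x x' y|x y y'|k r i x y hk hx];
  rewrite /fev !big_cons big_nil addr0 /= ?mulr1z ?mulrN1z.
- by rewrite hl -opprD subrr.
- by rewrite hr -opprD subrr.
by rewrite mulrNz (hb _ _ _ _ _ hk hx) subrr.
Qed.

(** The twist by [q] is the Koszul sign of [psi] passing the left factor. *)
Definition tmap (q : int) (phi : A -> A') (psi : B -> B') : tens B GA -> tens B' GA' :=
  plift (fun xy => tpure GA' (phi (twist GA q xy.1)) (psi xy.2)).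

Variables (p q : int) (phi : A -> A') (psi : B -> B').
Hypotheses (hphi : gmap GA GA' p phi) (hpsi : gmap GB GB' q psi).

Lemma tmap_respects : respects (@tens_rel _ _ A B GA)
  (fun xy => tpure GA' (phi (twist GA q xy.1)) (psi xy.2)).
Proof.
apply: (@tens_respects _ (fun x y => tpure GA' (phi (twist GA q x)) (psi y))).
- by move=> y x x'; rewrite twistD (gm_add hphi) tpureDl.
- by move=> x y y'; rewrite (gm_add hpsi) tpureDr.
move=> k r i x y hk hx.
rewrite (twist_homog _ (actA hk hx)) (twist_homog _ hx) !(morphD_mulrz (gm_add hphi)).
rewrite (gm_lin hphi _ hk) (gm_lin hpsi _ hk) !tpureMzl tpureMzr.
rewrite (tpureZ _ hk (gm_deg hphi hx)) !mulrz_ksg2.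
by congr (_ *~ _); apply: (@ksg_even (k * p)); ring.
Qed.

Lemma tmapD : {morph tmap q phi psi : z z' / z + z'}.
Proof. exact: pliftD tmap_respects. Qed.

Lemma tmap_pure i x y : homog GA i x ->
  tmap q phi psi (tpure GA x y) = tpure GA' (phi x) (psi y) *~ ksg (q * i).
Proof.
move=> hx; rewrite /tmap plift_gen /=; last exact: tmap_respects.
by rewrite (twist_homog _ hx) (morphD_mulrz (gm_add hphi)) tpureMzl.
Qed.
End TensorMaps.

Local Notation tmapS := (tmap (sym_gr _)).

Section Coalgebra.
Variables (K : fieldType) (R : dgca K) (V : dgmod R).
Implicit Types (z : sym V) (w : word V).

Lemma copD : {morph @cop _ _ V : z z' / z + z'}.
Proof. exact: sliftD (cop_bal V). Qed.

Lemma cop_monoE w :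
  cop (mono w) = tsum w (fun b1 b2 => tpure (sym_gr V) (mono b1) (mono b2)).
Proof.
rewrite /mono cop_mono sh2sum_all; apply: eq_tsum => b1 b2 _ _.
by rewrite scale1r.
Qed.

Lemma tmap_pureS (W W' : dgmod R) p q (phi : sym V -> sym W) (psi : sym V -> sym W') i x y :
  gmap (sym_gr V) (sym_gr W) p phi -> gmap (sym_gr V) (sym_gr W') q psi ->
  homog (sym_gr V) i x ->
  tmapS q phi psi (tpure (sym_gr V) x y) = tpure (sym_gr W) (phi x) (psi y) *~ ksg (q * i).
Proof. move=> h1 h2; exact: (tmap_pure (@sym_act _ _ V) h1 h2). Qed.

Lemma tmapDS (W W' : dgmod R) p q (phi : sym V -> sym W) (psi : sym V -> sym W') :
  gmap (sym_gr V) (sym_gr W) p phi -> gmap (sym_gr V) (sym_gr W') q psi ->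
  {morph (tmapS q phi psi : symsym V -> tens (sym W') (sym_gr W)) : x y / x + y}.
Proof. move=> h1 h2; exact: (tmapD (@sym_act _ _ V) h1 h2). Qed.

Lemma cop_scale k (a : R) z : homR k a ->
  cop (a *: z) = tmapS 0 ( *:%R a) id (cop z).
Proof.
move=> ha; have h := tmapDS (gmap_scale V ha) (gmap_id (sym_gr V)).
move: z; apply: sym_ext => [x y|x y|r w]; rewrite ?scalerDr ?copD ?h //.
rewrite scale_rmono !cop_mono !sh2sum_all (tsum_morph _ _ h); apply: eq_tsum => b1 b2 _ _.
move: r; apply: (grade_ext (G := dga_gr R)) => [r r'|r r'|l r hr].
- by rewrite mulrDr !scalerDl tpureDl.
- by rewrite !scalerDl tpureDl h.
rewrite (tmap_pureS _ (gmap_scale V ha) (gmap_id (sym_gr V)) (sym_act hr (homog_mono b1))).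
by rewrite mul0r ksg0 mulr1z scalerA.
Qed.

End Coalgebra.

Section CopIdentities.
Variables (K : fieldType) (R : dgca K) (V W : dgmod R).
Implicit Types (z : sym V) (w : word V).

(** [symsym] carries only its additive structure, so linearity of a map into it is expressed through
    the scalar action on the left tensor factor. *)
Record tlin (p : int) (f : sym V -> symsym W) : Prop := TLin {
  tl_add : {morph f : z z' / z + z'};
  tl_lin : forall k (a : R) z, homR k a ->
    f (a *: z) = tmapS 0 ( *:%R a) id (f z) *~ ksg (k * p) }.

Lemma tlin_ext p f h : tlin p f -> tlin p h ->
  (forall w, hword w -> f (mono w) = h (mono w)) -> f =1 h.
Proof.
move=> hf hh e; apply: sym_ext; [exact: tl_add hf|exact: tl_add hh|move=> r w].
rewrite rmonoE; move: r.
apply: (grade_ext (G := dga_gr R)) => [r r'|r r'|k r hr]; rewrite ?scalerDl ?(tl_add hf) ?(tl_add hh) //.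
rewrite (tl_lin hf _ hr) (tl_lin hh _ hr) -mono_wproj e //; exact: hword_wproj.
Qed.

Lemma tlin_cop p phi : gmap (sym_gr V) (sym_gr W) p phi -> tlin p (fun z => cop (phi z)).
Proof.
move=> h; split=> [z z'|k a z ha] /=; first by rewrite (gm_add h) copD.
by rewrite (gm_lin h _ ha) (morphD_mulrz (@copD _ _ W)) (cop_scale _ ha).
Qed.

Lemma tlinD p f h : tlin p f -> tlin p h -> tlin p (fun z => f z + h z).
Proof.
move=> hf hh; split=> [z z'|k a z ha].
  by rewrite (tl_add hf) (tl_add hh) addrACA.
rewrite (tl_lin hf _ ha) (tl_lin hh _ ha) -mulrzDl; congr (_ *~ _).
by rewrite (tmapDS (gmap_scale W ha) (gmap_id (sym_gr W))).
Qed.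

Lemma tlin_tmap p q phi psi :
  gmap (sym_gr V) (sym_gr W) p phi -> gmap (sym_gr V) (sym_gr W) q psi ->
  tlin (p + q) (fun z => tmapS q phi psi (cop z)).
Proof.
move=> h1 h2; have hD := tmapDS h1 h2; split=> [z z'|k a z ha]; first by rewrite copD hD.
rewrite (cop_scale _ ha); have sD := tmapDS (gmap_scale W ha) (gmap_id (sym_gr W)).
have sD' := tmapDS (gmap_scale V ha) (gmap_id (sym_gr V)).
move: (cop z) => {z}; apply: tens_ext => [x y|x y|i x y hx].
- by rewrite sD' hD.
- by rewrite hD sD mulrzDl.
rewrite (tmap_pureS _ (gmap_scale V ha) (gmap_id _) hx).
rewrite (tmap_pureS _ h1 h2 hx) (morphD_mulrz sD) (morphD_mulrz hD).
rewrite (tmap_pureS _ (gmap_scale W ha) (gmap_id _) (gm_deg h1 hx)).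
rewrite (tmap_pureS _ h1 h2 (sym_act ha hx)) (gm_lin h1 _ ha) !tpureMzl !mulrz_ksg2.
by congr (_ *~ ksg _); ring.
Qed.
End CopIdentities.

Section CoMaps.
Variables (K : fieldType) (R : dgca K).

(** [coder] states its identity on homogeneous words. Both sides are linear in the sense of [tlin],
    so it extends to all of S(V), where it can be composed with other maps. *)
Lemma coderP (V : dgmod R) p (phi : sym V -> sym V) : coder p phi <->
  gmap (sym_gr V) (sym_gr V) p phi /\
  forall z, cop (phi z) = tmapS 0 phi id (cop z) + tmapS p id phi (cop z).
Proof.
have E (h : gmap (sym_gr V) (sym_gr V) p phi) (w : word V) :
    tmapS 0 phi id (cop (mono w)) + tmapS p id phi (cop (mono w)) =
    tsum w (fun b1 b2 => tpure (sym_gr V) (phi (mono b1)) (mono b2) +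
      tpure (sym_gr V) (mono b1) (phi (mono b2)) *~ ksg (p * deg b1)).
  have h1 := tmapDS h (gmap_id (sym_gr V)); have h2 := tmapDS (gmap_id (sym_gr V)) h.
  rewrite cop_monoE (tsum_morph _ _ h1) (tsum_morph _ _ h2) -tsumD.
  apply: eq_tsum => b1 b2 _ _.
  rewrite (tmap_pureS _ h (gmap_id _) (homog_mono b1)) mul0r ksg0 mulr1z.
  by rewrite (tmap_pureS _ (gmap_id _) h (homog_mono b1)).
split=> [[h1 h2 h3 h4]|[h h4]].
  have h : gmap (sym_gr V) (sym_gr V) p phi by split.
  split=> // z; move: z.
  have t2 := tlin_tmap h (gmap_id (sym_gr V)); have t3 := tlin_tmap (gmap_id (sym_gr V)) h.
  rewrite addr0 in t2; rewrite add0r in t3.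
  apply: (tlin_ext (tlin_cop h) (tlinD t2 t3)) => w hw.
  by rewrite (h4 w hw) sh2sum_all E.
split; [exact: gm_add h|exact: gm_deg h|exact: gm_lin h|].
by move=> w hw; rewrite sh2sum_all h4 E.
Qed.

Lemma coder_gmap (V : dgmod R) p (phi : sym V -> sym V) :
  coder p phi -> gmap (sym_gr V) (sym_gr V) p phi.
Proof. by case/coderP. Qed.

Lemma coder_cop (V : dgmod R) p (phi : sym V -> sym V) z : coder p phi ->
  cop (phi z) = tmapS 0 phi id (cop z) + tmapS p id phi (cop z).
Proof. by case/coderP. Qed.

Lemma lmul_coder (V : dgmod R) (t : int * V) : coder t.1 (lmul t).
Proof.
have [h1 h2 h3] := lmul_gmap t; split=> // w _; rewrite sh2sum_all.
rewrite lmul_mono cop_monoE /= -tsumD; apply: eq_tsum => b1 b2 _ _.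
by rewrite !lmul_mono.
Qed.

Definition coalg (V W : dgmod R) (F : sym V -> sym W) : Prop :=
  forall z, cop (F z) = tmapS 0 F F (cop z).

Lemma coalg_monoP (V W : dgmod R) (F : sym V -> sym W) :
  gmap (sym_gr V) (sym_gr W) 0 F ->
  coalg F <-> forall w, hword w -> cop (F (mono w)) =
    tsum w (fun b1 b2 => tpure (sym_gr W) (F (mono b1)) (F (mono b2))).
Proof.
move=> h; have hD := tmapDS h h.
have E (w : word V) : tmapS 0 F F (cop (mono w)) =
    tsum w (fun b1 b2 => tpure (sym_gr W) (F (mono b1)) (F (mono b2))).
  rewrite cop_monoE (tsum_morph _ _ hD); apply: eq_tsum => b1 b2 _ _.
  by rewrite (tmap_pureS _ h h (homog_mono b1)) mul0r ksg0 mulr1z.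
split=> [hF w _|hF z]; first by rewrite hF E.
move: z; have t := tlin_tmap h h; rewrite addr0 in t.
by apply: (tlin_ext (tlin_cop h) t) => w hw; rewrite hF // E.
Qed.

Lemma coalg_comp (U V W : dgmod R) (F : sym U -> sym V) (G : sym V -> sym W) :
  gmap (sym_gr U) (sym_gr V) 0 F -> gmap (sym_gr V) (sym_gr W) 0 G ->
  coalg F -> coalg G -> coalg (G \o F).
Proof.
move=> hF hG cF cG.
have hGF : gmap (sym_gr U) (sym_gr W) 0 (G \o F) by have := gmap_comp hG hF; rewrite addr0.
move=> z; rewrite /= cG cF; move: (cop z) => {z}.
have fD := tmapDS hF hF; have gD := tmapDS hG hG; have cD := tmapDS hGF hGF.
apply: tens_ext => [x y|x y|i x y hx]; rewrite ?fD ?gD ?cD //.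
rewrite (tmap_pureS _ hF hF hx) (tmap_pureS _ hGF hGF hx) !mul0r ksg0 !mulr1z.
by rewrite (tmap_pureS _ hG hG (gm_deg hF hx)) mul0r ksg0 mulr1z.
Qed.

End CoMaps.

(** * The counit of S(V) *)

Section Counit.
Variables (K : fieldType) (R : dgca K) (V : dgmod R).
Implicit Types (z : sym V) (w : word V).

Definition counit_gen (r : R) w : R := if w is [::] then r else 0.
Definition counit : sym V -> R := slift counit_gen.

Lemma counit_bal : sbal counit_gen.
Proof.
split=> [r r' w|r w1 i x y w2|r w1 i x w2|r w1 k a i x w2 ha hx|r w1 i x j y w2].
- by case: w => [|t w] /=; rewrite ?addr0.
- by case: w1 => [|t w1] /=; rewrite addr0.
- by case: w1.
- by case: w1 => [|t w1] /=; rewrite mul0rz.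
by case: w1 => [|t w1] /=; rewrite mul0rz.
Qed.

Lemma counitD : {morph counit : z z' / z + z'}.
Proof. exact: sliftD counit_bal. Qed.
Lemma counit_rmono r w : counit (rmono r w) = counit_gen r w.
Proof. exact: slift_mono counit_bal. Qed.
Lemma counit_mono w : counit (mono w) = (nilp w)%:R.
Proof. by rewrite /mono counit_rmono; case: w. Qed.
Lemma counitZ a z : counit (a *: z) = a * counit z.
Proof.
move: z; apply: sym_ext => [x y|x y|r w]; rewrite ?scalerDr ?counitD ?mulrDr //.
by rewrite scale_rmono !counit_rmono; case: w => //=; rewrite mulr0.
Qed.
Lemma counit_homog i z : homog (sym_gr V) i z -> homR i (counit z).
Proof.
move/homogE <-; apply/eqP; move: z => /=.
apply: sym_ext => [x y|x y|r w]; rewrite ?sprojD ?counitD ?gprojD //.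
rewrite sproj_mono !counit_rmono; case: w => [|t w] /=; last by rewrite gproj0.
by rewrite deg_nil subr0 gprojK eqxx.
Qed.

Definition counit2 : symsym V -> R := plift (fun xy => counit xy.1 * counit xy.2).

Lemma counit2_respects :
  respects (@tens_rel _ _ (sym V) (sym V) (sym_gr V)) (fun xy => counit xy.1 * counit xy.2).
Proof.
apply: (@tens_respects _ _ _ _ _ _ (fun x y => counit x * counit y)).
- by move=> y x x'; rewrite counitD mulrDl.
- by move=> x y y'; rewrite counitD mulrDr.
move=> k r i x y hr hx; rewrite !counitZ mulrA (dga_comm hr (counit_homog hx)).
by rewrite mulrzAl.
Qed.
Lemma counit2D : {morph counit2 : z z' / z + z'}.
Proof. exact: pliftD counit2_respects. Qed.
Lemma counit2_pure x y : counit2 (tpure (sym_gr V) x y) = counit x * counit y.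
Proof. by rewrite /counit2 plift_gen //; apply: counit2_respects. Qed.

Lemma tsum0 (M : zmodType) w : tsum w (fun _ _ => 0 : M) = 0.
Proof.
rewrite -[RHS](mulr0z (tsum w (fun _ _ => 0))) -tsumMz.
by apply: eq_tsum => ? ? _ _; rewrite mul0rz.
Qed.

Lemma counit2_cop z : counit2 (cop z) = counit z.
Proof.
move: z; apply: sym_ext => [x y|x y|r w]; rewrite ?copD ?counitD ?counit2D //.
rewrite cop_mono sh2sum_all (tsum_morph _ _ counit2D) counit_rmono.
rewrite -[RHS](tsum_nil w (counit_gen r)); apply: eq_tsum => b1 b2 _ _.
rewrite counit2_pure counitZ !counit_mono.
by case: b1 => [|? ?] /=; case: b2 => [|? ?] /=; rewrite ?mulr0 ?mul0r ?mulr1.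
Qed.

(** Applying counit (x) counit to the coderivation identity on a word produces the same scalar once
    on the left and twice on the right. *)
Lemma coder_counit p (phi : sym V -> sym V) z : coder p phi -> counit (phi z) = 0.
Proof.
move=> h; have g := coder_gmap h.
suff e w : counit (phi (mono w)) = 0.
  move: z; apply: sym_ext => [x y|x y|r w]; rewrite ?(gm_add g) ?counitD ?addr0 //.
  rewrite rmonoE; move: r.
  apply: (grade_ext (G := dga_gr R)) => [r r'|r r'|k r hr]; rewrite ?scalerDl ?(gm_add g) ?counitD ?addr0 //.
  by rewrite (gm_lin g _ hr) (morphD_mulrz counitD) counitZ e mulr0 mul0rz.
have h1 := tmapDS g (gmap_id (sym_gr V)); have h2 := tmapDS (gmap_id (sym_gr V)) g.
have := coder_cop (mono w) h.
move/(congr1 counit2); rewrite counit2D !counit2_cop cop_monoE.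
rewrite (tsum_morph _ _ h1) (tsum_morph _ _ h2) !(tsum_morph _ _ counit2D).
have -> : tsum w (fun b1 b2 => counit2 (tmapS 0 phi id (tpure (sym_gr V) (mono b1) (mono b2)))) = counit (phi (mono w)).
  rewrite -[RHS](tsum_nilr w (fun b => counit (phi (mono b)))); apply: eq_tsum => b1 b2 _ _.
  rewrite (tmap_pureS _ g (gmap_id _) (homog_mono b1)) mul0r ksg0 mulr1z counit2_pure counit_mono.
  by case: b2 => [|? ?] /=; rewrite ?mulr1 ?mulr0.
have -> : tsum w (fun b1 b2 => counit2 (tmapS p id phi (tpure (sym_gr V) (mono b1) (mono b2)))) = counit (phi (mono w)).
  rewrite -[RHS](tsum_nil w (fun b => counit (phi (mono b)))); apply: eq_tsum => b1 b2 _ _.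
  rewrite (tmap_pureS _ (gmap_id _) g (homog_mono b1)) (morphD_mulrz counit2D) counit2_pure counit_mono.
  by case: b1 => [|? ?] /=; rewrite ?mul1r ?mul0r ?mul0rz // deg_nil mulr0 ksg0 mulr1z.
by move/eqP; rewrite -subr_eq0 opprD addNKr oppr_eq0 => /eqP.
Qed.
End Counit.

(** * The Euler derivation *)

Section Euler.
Variables (K : fieldType) (R : dgca K) (V : dgmod R).
Implicit Types (z : sym V) (w : word V).

Lemma sym_V_mlw : mlw (dgm_gr V) 0 (sym_V_gen (1 : R) : word V -> V).
Proof.
have h := sym_V_bal V.
split; first split=> [w1 i x y w2|w1 i x w2|w1 k a i x w2 ha hx|w1 i x j y w2].
- exact: (sbal_slotD h).
- exact: (sbal_proj h).
- rewrite (sbal_slotZ h) // mul1r add0r; congr (_ *~ _).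
  by case: (w1 ++ _) => [|t [|? ?]] /=; rewrite ?scaler0 // scale1r.
- exact: (sbal_swap h).
case=> [|t [|? ?]]; rewrite /= ?homog0 // scale1r deg_cons deg_nil !addr0.
exact: gproj_homog.
Qed.

Lemma sym_V_gmap : gmap (sym_gr V) (dgm_gr V) 0 (@sym_V _ _ V).
Proof.
have h := ext_gmap (@dgm_act _ _ V) sym_V_mlw.
rewrite (_ : @sym_V _ _ V = ext 0 (sym_V_gen (1 : R) : word V -> V)) //.
rewrite funeqE; apply: sym_ext; [exact: sliftD (sym_V_bal V)|exact: gm_add h|move=> r w].
rewrite sym_V_mono (ext_rmono _ _ sym_V_mlw) twist0.
by case: w => [|t [|? ?]] /=; rewrite ?scaler0 // scale1r.
Qed.

Lemma sym_VD : {morph @sym_V _ _ V : z z' / z + z'}.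
Proof. exact: gm_add sym_V_gmap. Qed.

Lemma sym_V_monoE w :
  sym_V (mono w) = if w is [:: t] then gproj (dgm_gr V) t.1 t.2 else 0.
Proof. by rewrite /mono sym_V_mono; case: w => [|t [|? ?]] //=; rewrite scale1r. Qed.

Lemma sym_VZ (a : R) z : sym_V (a *: z) = a *: sym_V z.
Proof. exact: (gmap0_lin sym_V_gmap). Qed.

Lemma euler_mlw : mlw (sym_gr V) 0 (fun w => mono w *+ size w).
Proof.
apply: (mlw_size (h := fun n w => mono w *+ n)) => n.
have h : homR 0 (n%:R : R).
  by rewrite -(rmorph_nat (dga_unit R)); apply: dga_unit0.
rewrite (_ : (fun w => _) = fun w => (n%:R : R) *: mono w).
  exact: (mlw_scale0 (@sym_act _ _ V) h (mlw_mono V)).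
by rewrite funeqE => w; rewrite scaler_nat.
Qed.

Definition euler : sym V -> sym V := ext 0 (fun w => mono w *+ size w).

Lemma euler_gmap : gmap (sym_gr V) (sym_gr V) 0 euler.
Proof. exact: (ext_gmap (@sym_act _ _ V) euler_mlw). Qed.
Lemma eulerD : {morph euler : z z' / z + z'}.
Proof. exact: gm_add euler_gmap. Qed.
Lemma euler_mono w : euler (mono w) = mono w *+ size w.
Proof. exact: (ext_mono _ euler_mlw). Qed.
Lemma euler_rmono r w : euler (rmono r w) = rmono r w *+ size w.
Proof. by rewrite rmonoE (gmap0_lin euler_gmap) euler_mono scalerMnr. Qed.

(** The composite mu (pr_V (x) id) of the overview. It is balanced over [R] because the sign of the
    tensor relation cancels that of moving the scalar past the vector. *)
Definition hmul : symsym V -> sym V := plift (fun xy => vmul (sym_V xy.1) xy.2).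

Lemma hmul_respects :
  respects (@tens_rel _ _ (sym V) (sym V) (sym_gr V)) (fun xy => vmul (sym_V xy.1) xy.2).
Proof.
apply: (@tens_respects _ _ _ _ _ _ (fun x y => vmul (sym_V x) y)).
- by move=> y x x'; rewrite sym_VD vmulDl.
- by move=> x y y'; rewrite vmulDr.
move=> k r i x y hr hx; rewrite sym_VZ vmulZl.
have hx' : homm i (sym_V x) by have := gm_deg sym_V_gmap hx; rewrite addr0.
by rewrite (vmulZr _ hr hx') mulrz_ksg2 ksg2 mulr1z.
Qed.
Lemma hmulD : {morph hmul : z z' / z + z'}.
Proof. exact: pliftD hmul_respects. Qed.
Lemma hmul_pure x y : hmul (tpure (sym_gr V) x y) = vmul (sym_V x) y.
Proof. by rewrite /hmul plift_gen //; apply: hmul_respects. Qed.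

(** Moving a letter to the front costs exactly the Koszul sign that [esum] attaches to it, so all
    terms are equal. *)
Lemma esum_mono w : esum w (fun t b => mono (t :: b)) = mono w *+ size w.
Proof.
suff h (u : word V) : esum w (fun t b => mono (u ++ t :: b)) = mono (u ++ w) *+ size w by exact: (h [::]).
elim: w u => [|t w IH] u /=; first by rewrite mulr0n.
rewrite mulrS; congr (_ + _); rewrite -cat_rcons -IH; apply: eq_esum => -[i x] b /=.
case: t => j y; rewrite cat_rcons mono_swap mulrz_ksg2.
by rewrite (@ksg_even (i * j) _ 0) ?ksg0 ?mulr1z //=; ring.
Qed.

Lemma hmul_cop z : hmul (cop z) = euler z.
Proof.
move: z; apply: sym_ext => [x y|x y|r w]; rewrite ?copD ?hmulD ?eulerD //.
rewrite cop_mono sh2sum_all (tsum_morph _ _ hmulD) euler_rmono rmonoE scalerMnr -esum_mono.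
rewrite -tsum_single (tsum_morph _ _ (scalerDr r)); apply: eq_tsum => b1 b2 _ _.
rewrite hmul_pure sym_VZ vmulZl sym_V_monoE; case: b1 => [|t [|? ?]].
- by rewrite (morphD0 (vmulDl _)).
- rewrite (vmul_homog _ (gproj_homog _ _ _)) lmul_proj -surjective_pairing lmul_mono //.
by rewrite (morphD0 (vmulDl _)).
Qed.

Hypothesis charK : [pchar K]%R =i pred0.

(** Dividing words of positive length by their length gives a map J with J(euler z) + counit(z) 1 =
    z. *)
Lemma euler_inj z : euler z = 0 -> counit z = 0 -> z = 0.
Proof.
have JM : mlw (sym_gr V) 0 (fun w => rinv R (size w) *: mono w).
  by apply: (mlw_size (h := fun n w => rinv R n *: mono w)) => n; apply: (mlw_scale0 (@sym_act _ _ V) (rinv_hom R n) (mlw_mono V)).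
have Jg := ext_gmap (@sym_act _ _ V) JM.
move=> h1 h2; have : ext 0 (fun w => rinv R (size w) *: mono w) (euler z) + counit z *: mono [::] = z.
  move: z {h1 h2}; apply: sym_ext => [x y|x y|r w]; rewrite ?eulerD ?(gm_add Jg) ?counitD ?scalerDl //.
    by rewrite addrACA.
  rewrite counit_rmono rmonoE (gmap0_lin euler_gmap) (gmap0_lin Jg) euler_mono.
  rewrite -scaler_nat (gmap0_lin Jg) (ext_mono _ JM).
  case: w => [|t w] /=; first by rewrite scale0r scaler0 add0r.
  rewrite scale0r addr0; congr (_ *: _).
  by rewrite scaler_nat scalerMnr rinvK.
by rewrite h1 h2 (morphD0 (gm_add Jg)) scale0r addr0.
Qed.
End Euler.

(** * Cofreeness *)

Section CoalgUniqueness.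
Variables (K : fieldType) (R : dgca K) (V W : dgmod R).
Hypothesis charK : [pchar K]%R =i pred0.

(** Induction on word length: [c] kills the empty first block, so the convolution involves [X] on
    shorter words only. This serves both for the difference of two coalgebra morphisms and for the
    commutator of one with the codifferentials. *)
Lemma conv_uniq (X : word V -> sym W) (c : word V -> word V -> sym W -> sym W) :
  (forall b z, c [::] b z = 0) -> (forall a b, c a b 0 = 0) ->
  (forall w, counit (X w) = 0) ->
  (forall w, euler (X w) = tsum w (fun b1 b2 => c b1 b2 (X b2))) ->
  forall w, X w = 0.
Proof.
move=> c0 cz h0 hN w; elim: {w}(size w).+1 {-2}w (ltnSn (size w)) => // n IH w lwn.
apply: (euler_inj charK) => //; rewrite hN -[RHS](tsum0 _ w); apply: eq_tsum => b1 b2 hs _.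
case: b1 hs => [|t b1] hs; first exact: c0.
by rewrite IH //; move: hs => /=; lia.
Qed.

Lemma euler_coalg (H : sym V -> sym W) w :
  gmap (sym_gr V) (sym_gr W) 0 H -> coalg H ->
  euler (H (mono w)) =
    tsum w (fun b1 b2 => vmul (sym_V (H (mono b1))) (H (mono b2))).
Proof.
move=> h c; rewrite -hmul_cop c cop_monoE (tsum_morph _ _ (tmapDS h h)) (tsum_morph _ _ (@hmulD _ _ _)).
apply: eq_tsum => b1 b2 _ _.
by rewrite (tmap_pureS _ h h (homog_mono b1)) mul0r ksg0 mulr1z hmul_pure.
Qed.

(** The convolution formulas of [H] and [H'] have the same left factors, the corestrictions being
    equal, so the difference satisfies the recursion of [conv_uniq]. *)
Lemma coalg_uniq (H H' : sym V -> sym W) :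
  gmap (sym_gr V) (sym_gr W) 0 H -> gmap (sym_gr V) (sym_gr W) 0 H' ->
  coalg H -> coalg H' ->
  H (mono [::]) = mono [::] ->
  (forall w, counit (H (mono w)) = counit (H' (mono w))) ->
  (forall w, sym_V (H (mono w)) = sym_V (H' (mono w))) -> H =1 H'.
Proof.
move=> g g' c c' h1 hc hp; apply: (gmap_sym_ext g g') => w _.
apply/eqP; rewrite -subr_eq0; apply/eqP; move: w.
apply: (@conv_uniq (fun w => H (mono w) - H' (mono w))
  (fun b1 _ z => vmul (sym_V (H (mono b1))) z)) => [b z|a b|w|w].
- by rewrite h1 sym_V_monoE (morphD0 (vmulDl z)).
- exact: (morphD0 (@vmulDr _ _ _ _)).
- by rewrite counitD -mulrN1z (morphD_mulrz (@counitD _ _ _)) hc mulrN1z subrr.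
rewrite -mulrN1z eulerD (morphD_mulrz (@eulerD _ _ _)) (euler_coalg _ g c) (euler_coalg _ g' c').
rewrite -tsumMz -tsumD; apply: eq_tsum => b1 b2 _ _.
by rewrite -hp vmulDr -[- H' _]mulrN1z (morphD_mulrz (@vmulDr _ _ _ _)).
Qed.
End CoalgUniqueness.

(** * The coalgebra morphism with a given corestriction *)

Section CofreeMorphism.
Variables (K : fieldType) (R : dgca K) (V W : dgmod R).
Hypothesis charK : [pchar K]%R =i pred0.
Variable f : word V -> W.
Hypotheses (hf : mlw (dgm_gr W) 0 f) (f0 : f [::] = 0).

Lemma lmul_block_wlin z : wlin 0 (fun w => lmul (deg w, f w) z : sym W).
Proof.
split=> [w1 i x y w2|w1 i x w2|w1 k a i x w2 ha hx|w1 i x j y w2]; rewrite ?deg_slot.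
- by rewrite (mw_add hf) lmulDl.
- by rewrite (mw_proj hf).
- rewrite (mw_scale hf) //.
  have hw : homm (deg w1 + i + deg w2) (f (w1 ++ (i, x) :: w2)).
    by have := mw_deg hf (w1 ++ (i, x) :: w2); rewrite addr0 deg_slot.
  rewrite (morphD_mulrz (f := fun x => lmul (_, x) z)) => [|? ?]; last exact: lmulDl.
  by rewrite (_ : deg w1 + (k + i) + deg w2 = k + (deg w1 + i + deg w2)) ?lmulZ //; ring.
rewrite (mw_swap hf) (morphD_mulrz (f := fun x => lmul (_, x) z)) => [|? ?]; last exact: lmulDl.
by rewrite !deg_cons /= (_ : deg w1 + i + (j + deg w2) = deg w1 + j + (i + deg w2)) //; ring.
Qed.

(* The sum over the decompositions of a word into k nonempty ordered blocks of the
   products of the values of f on the blocks. *)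
Fixpoint blocks (k : nat) (w : word V) : sym W :=
  if k is k'.+1 then tsum w (fun b1 b2 => lmul (deg b1, f b1) (blocks k' b2))
  else if w is [::] then mono [::] else 0.

Lemma wlin_gmap p q (phi : sym W -> sym W) (h : word V -> sym W) :
  gmap (sym_gr W) (sym_gr W) p phi -> wlin q h -> wlin (q + p) (fun w => phi (h w)).
Proof.
move=> g H; have D := gm_add g.
split=> [w1 i x y w2|w1 i x w2|w1 k a i x w2 ha hx|w1 i x j y w2].
- by rewrite (mw_add H) D.
- by rewrite (mw_proj H).
- rewrite (mw_scale H) // (morphD_mulrz D) (gm_lin g _ ha) mulrz_ksg2.
  by congr (_ *~ ksg _); ring.
by rewrite (mw_swap H) (morphD_mulrz D).
Qed.

Lemma blocks_mlw k : mlw (sym_gr W) 0 (blocks k).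
Proof.
elim: k => [|k IH] /=.
  split; first split=> [[|? ?] i x y w2|[|? ?] i x w2|[|? ?] l a i x w2 ha hx|[|? ?] i x j y w2] //=;
    rewrite ?addr0 ?scaler0 ?mul0rz //.
  case=> [|? ?]; last exact: homog0.
  by have := homog_mono ([::] : word W); rewrite !deg_nil addr0.
apply: mlw_tsum => [b|b|b1 b2].
- exact: lmul_block_wlin.
- by apply: wlin_gmap; [apply: (lmul_gmap (deg b, f b))|exact: IH].
rewrite addr0 addrC; apply: (gm_deg (lmul_gmap (deg b1, f b1))).
by have := mw_deg IH b2; rewrite addr0.
Qed.

Lemma blocks_big k w : (size w < k)%N -> blocks k w = 0.
Proof.
elim: k w => // k IH w hw /=; rewrite -[RHS](tsum0 _ w); apply: eq_tsum => b1 b2 hs _.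
case: b1 hs => [|t b1] hs; first by rewrite f0 lmul0.
by rewrite IH ?(morphD0 (@lmulD _ _ _ _)) //; move: hs => /=; lia.
Qed.

(* One of the k+1 ordered blocks contains the first letter; moving it to the front
   only costs a Koszul sign. *)
Lemma blocks_cons k x w : blocks k.+1 (x :: w) =
  tsum w (fun b1 b2 => lmul (deg (x :: b1), f (x :: b1)) (blocks k b2)) *+ k.+1.
Proof.
elim: k x w => [|k IH] x w.
  rewrite mulr1n /= -[RHS]addr0; congr (_ + _); rewrite -[RHS](tsum0 _ w).
  by apply: eq_tsum => b1 b2 _ _; rewrite (morphD0 (@lmulD _ _ _ _)) mul0rz.
rewrite [LHS]/= -[blocks k.+1]/(blocks k.+1) mulrS; congr (_ + _).
transitivity (tsum w (fun b e => tsum e (fun a d =>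
    lmul (deg (x :: a), f (x :: a)) (lmul (deg b, f b) (blocks k d)) *~ ksg (deg b * deg a))) *~ k.+1).
  rewrite -tsumMz; apply: eq_tsum => b e _ _; rewrite -[tsum e _ + _]/(blocks k.+1 (x :: e)) IH.
  rewrite pmulrn (morphD_mulrz (@lmulD _ _ _ _)) mulrzAC; congr (_ *~ _).
  rewrite (tsum_morph _ _ (@lmulD _ _ _ _)) -tsumMz; apply: eq_tsum => a d _ _.
  rewrite lmul_comm mulrz_ksg2 deg_cons /=; congr (_ *~ _).
  by apply: (@ksg_even (x.1 * deg b)); ring.
rewrite -pmulrn; congr (_ *+ _).
rewrite -[LHS](tsum_assoc_comm w (fun b a d => lmul (deg (x :: a), f (x :: a)) (lmul (deg b, f b) (blocks k d)))).
apply: eq_tsum => a e _ _; by rewrite (tsum_morph _ _ (@lmulD _ _ _ _)).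
Qed.

(** The convolution exponential of [f]. The sum may stop at the length of the word because [f]
    vanishes on the empty block. *)
Definition cofree_word (w : word V) : sym W :=
  \sum_(k < (size w).+1) rinv R k`! *: blocks k w.
Definition cofree : sym V -> sym W := ext 0 cofree_word.

Lemma cofree_wordE n w : (size w <= n)%N ->
  cofree_word w = \sum_(k < n.+1) rinv R k`! *: blocks k w.
Proof.
move=> h; rewrite /cofree_word -!(big_mkord xpredT (fun k => rinv R k`! *: blocks k w)).
rewrite [RHS](big_cat_nat (n := (size w).+1)) //= [X in _ + X]big_nat [X in _ + X]big1 ?addr0 // => k /andP[hk _].
by rewrite blocks_big ?scaler0.
Qed.

Lemma cofree_mlw : mlw (sym_gr W) 0 cofree_word.
Proof.
apply: (mlw_size (h := fun n w => \sum_(k < n.+1) rinv R k`! *: blocks k w)) => n.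
apply: mlw_sum => k; apply: (mlw_scale0 (@sym_act _ _ W) (rinv_hom R _)).
exact: blocks_mlw.
Qed.

Lemma cofree_gmap : gmap (sym_gr V) (sym_gr W) 0 cofree.
Proof. exact: (ext_gmap (@sym_act _ _ W) cofree_mlw). Qed.
Lemma cofree_mono w : cofree (mono w) = cofree_word w.
Proof. exact: (ext_mono _ cofree_mlw). Qed.

Lemma cofree_nil : cofree (mono [::]) = mono [::].
Proof.
rewrite cofree_mono /cofree_word big_ord1 /= /rinv fact0 invr1 rmorph1 scale1r //.
Qed.

Lemma rinv_factS k (z : sym W) : rinv R (k.+1)`! *: (z *+ k.+1) = rinv R k`! *: z.
Proof.
by rewrite factS /rinv natrM invfM mulrC rmorphM -scalerA rinvK.
Qed.

(** By [blocks_cons] the block holding [x] can be brought to the front, giving k+1 equal terms that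
    turn 1/(k+1)! into 1/k!. The factorials thus disappear from the recursion. *)
Lemma cofree_cons x w : cofree (mono (x :: w)) =
  tsum w (fun b1 b2 => lmul (deg (x :: b1), f (x :: b1)) (cofree (mono b2))).
Proof.
rewrite cofree_mono /cofree_word big_ord_recl /= scaler0 add0r.
under eq_bigr => k _ do rewrite -[tsum _ _ + _]/(blocks k.+1 (x :: w)) blocks_cons rinv_factS.
under eq_bigr => k _ do rewrite (tsum_morph _ _ (scalerDr _)).
rewrite -tsum_sum; apply: eq_tsum => b1 b2 hs _.
rewrite cofree_mono (@cofree_wordE (size w)); last by rewrite -hs leq_addl.
rewrite (morphD_sum _ _ _ (@lmulD _ _ _ _)); apply: eq_bigr => k _.
by rewrite (gm_lin (lmul_gmap (_, _)) _ (rinv_hom R _)) mul0r ksg0 mulr1z.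
Qed.

(** The component of t o z in V comes only from the component of z in V^{o 0}. *)
Lemma sym_V_lmul (t : int * W) (z : sym W) : counit z = 0 -> sym_V (lmul t z) = 0.
Proof.
suff -> : sym_V (lmul t z) = twist (dga_gr R) t.1 (counit z) *: gproj (dgm_gr W) t.1 t.2.
  by move=> ->; rewrite (morphD0 (@twistD _ _ _)) scale0r.
move: z; apply: sym_ext => [y z|y z|r w]; rewrite ?lmulD ?sym_VD ?counitD ?twistD ?scalerDl //.
rewrite /lmul (ext_rmono _ _ (lmul_mlw t)) sym_VZ sym_V_monoE counit_rmono.
by case: w => [|? ?] //=; rewrite (morphD0 (@twistD _ _ _)) scale0r scaler0.
Qed.

Lemma cofree_counit w : counit (cofree (mono w)) = counit (mono w).
Proof.
case: w => [|x w]; first by rewrite cofree_nil !counit_mono.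
rewrite cofree_cons (tsum_morph _ _ (@counitD _ _ _)) counit_mono -[RHS](tsum0 _ w).
by apply: eq_tsum => b1 b2 _ _; apply: (coder_counit _ (lmul_coder _)).
Qed.

Lemma cofree_corestr w : sym_V (cofree (mono w)) = f w.
Proof.
case: w => [|x w]; first by rewrite cofree_nil sym_V_monoE f0.
rewrite cofree_cons (tsum_morph _ _ (@sym_VD _ _ _)).
rewrite -[RHS](tsum_nilr w (fun b => f (x :: b))); apply: eq_tsum => b1 b2 _ _.
case: b2 => [|t b2]; last by rewrite sym_V_lmul // cofree_counit counit_mono.
rewrite cofree_nil lmul_mono sym_V_monoE /=.
by have := mw_deg hf (x :: b1); rewrite addr0 => /homogE.
Qed.

(** Induction through [cofree_cons]: multiplication by a vector is a coderivation, and its two terms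
    are the cases where the first letter falls into the left or the right tensor factor. *)
Lemma cofree_coalg : coalg cofree.
Proof.
apply/(coalg_monoP cofree_gmap) => w _.
elim: {w}(size w).+1 {-2}w (ltnSn (size w)) => // n IH [|x w] lwn.
  by rewrite cofree_nil cop_monoE /= cofree_nil.
rewrite cofree_cons (tsum_morph _ _ (@copD _ _ _)) /=.
pose S a := lmul (deg (x :: a), f (x :: a)).
have sg_id a := tmapDS (lmul_gmap (deg (x :: a), f (x :: a))) (gmap_id (sym_gr W)).
have id_lmul a := tmapDS (gmap_id (sym_gr W)) (lmul_gmap (deg (x :: a), f (x :: a))).
transitivity (tsum w (fun a e => tsum e (fun c d =>
    tpure (sym_gr W) (S a (cofree (mono c))) (cofree (mono d)))) +
  tsum w (fun a e => tsum e (fun c d =>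
    tpure (sym_gr W) (cofree (mono c)) (S a (cofree (mono d))) *~ ksg (deg (x :: a) * deg c)))).
  rewrite -tsumD; apply: eq_tsum => a e hs _.
  rewrite (coder_cop _ (lmul_coder _)) IH; last by move: hs lwn => /=; lia.
  rewrite (tsum_morph _ _ (sg_id a)) (tsum_morph _ _ (id_lmul a)).
  have hc c : homog (sym_gr W) (deg c) (cofree (mono c)).
    by have := gm_deg cofree_gmap (homog_mono c); rewrite addr0.
  congr (_ + _); apply: eq_tsum => c d _ _.
    by rewrite (tmap_pureS _ (lmul_gmap _) (gmap_id _) (hc c)) mul0r ksg0 mulr1z.
  by rewrite (tmap_pureS _ (gmap_id _) (lmul_gmap _) (hc c)).
congr (_ + _).
  rewrite -(tsum_assoc w (fun a c d => tpure _ (S a (cofree (mono c))) (cofree (mono d)))).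
  apply: eq_tsum => c d _ _; rewrite cofree_cons.
  by rewrite (tsum_morph _ _ (@tpureDl _ _ _ _ (sym_gr W) _)).
transitivity (tsum w (fun c e => tsum e (fun a d =>
    tpure (sym_gr W) (cofree (mono c)) (S a (cofree (mono d))) *~ ksg (x.1 * deg c)))).
  rewrite (tsum_assoc_comm w (fun a c d => tpure (sym_gr W) (cofree (mono c)) (S a (cofree (mono d))) *~ ksg (x.1 * deg c))).
  apply: eq_tsum => a e _ _; apply: eq_tsum => c d _ _.
  by rewrite mulrz_ksg2 deg_cons; congr (_ *~ ksg _); ring.
apply: eq_tsum => c e _ _; rewrite cofree_cons tsumMz.
by rewrite (tsum_morph _ _ (@tpureDr _ _ _ _ (sym_gr W) _)).
Qed.
End CofreeMorphism.

(** * Multi-shuffles *)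

(** The inversions between [a] and the entries after it depend on which entries these are, not on
    their order. The multiplicative form avoids a quotient of signs. *)
Lemma koszul_cat_perm (ds : seq int) a s b : perm_eq s b ->
  koszul ds (a ++ s) * koszul ds b = koszul ds (a ++ b) * koszul ds s.
Proof.
move=> p; elim: a => [|x a IH] /=; first exact: mulrC.
rewrite -!mulrA IH; congr (_ * _).
by apply: perm_big; rewrite perm_cat2l.
Qed.

Lemma koszul_sorted (ds : seq int) l : sorted ltn l -> koszul ds l = 1.
Proof.
elim: l => //= m l IH hl; rewrite IH ?(path_sorted hl) // mulr1 big_seq_cond big1 // => b /andP[hb].
have /allP/(_ _ hb) /= : all (ltn m) l by apply: order_path_min hl; exact: ltn_trans.
by move/ltnW; rewrite leqNgt => /negPf ->.
Qed.

(** Positions range over any list, not only 0..n-1, so that removing a block leaves a problem of the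
    same form. *)
Definition shufs (sh l : seq nat) : seq (seq nat) :=
  [seq s <- permutations l | all (sorted ltn) (reshape sh s)].

Lemma shufs_cons i sh l : sorted ltn l -> (i <= size l)%N ->
  perm_eq (shufs (i :: sh) l)
    [seq p.1 ++ s | p <- [seq p <- usp l | size p.1 == i], s <- shufs sh p.2].
Proof.
move=> sl hl; have ul : uniq l by apply: sorted_uniq sl; [exact: ltn_trans|exact: ltnn].
apply: uniq_perm; first by rewrite filter_uniq ?permutations_uniq.
  apply: allpairs_uniq_dep.
  - by rewrite filter_uniq ?usp_uniq.
  - by move=> p _; rewrite filter_uniq ?permutations_uniq.
  move=> [p s] [p' s'] /allpairsPdep[q [r [hq hr [-> /=]]]] + /allpairsPdep[q' [r' [hq' hr' [-> /=]]]].
  case: q q' hq hq' hr hr' => q1 q2 [q1' q2'].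
  rewrite !mem_filter !mem_usp //= !mem_permutations => /and4P[/eqP e1 _ _ s2] /and4P[/eqP e2 _ _ s2'].
  move=> /andP[_ p2] /andP[_ p2'] -> -> /eqP.
  rewrite eqseq_cat ?e1 ?e2 // => /andP[/eqP ? /eqP ?]; subst.
  suff -> : q2 = q2' by [].
  apply: (irr_sorted_eq ltn_trans ltnn s2 s2') => z.
  by rewrite -(perm_mem p2) (perm_mem p2').
move=> s; rewrite mem_filter mem_permutations /=; apply/idP/allpairsPdep.
  case/andP=> /andP[s1 s2] p; have us : uniq s by rewrite (perm_uniq p).
  (* The complement listed by [usp] is increasing, whereas the tail of a shuffle is increasing only
     blockwise; hence the sorting. *)
  exists (take i s, sort leq (drop i s)), (drop i s); rewrite cat_take_drop; split=> //.
    rewrite mem_filter mem_usp //= s1 size_takel ?(perm_size p) // eqxx /=.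
    rewrite ltn_sorted_uniq_leq sort_uniq drop_uniq //= (sort_sorted leq_total) andbT.
    rewrite -(permPr p) -[X in perm_eq _ X](cat_take_drop i s) perm_cat2l.
    by rewrite perm_sort.
  by rewrite mem_filter mem_permutations s2 /= perm_sym perm_sort.
case=> -[p1 p2] [r []]; rewrite mem_filter mem_usp //= => /and4P[/eqP e1 p s1 s2].
rewrite mem_filter mem_permutations => /andP[hr pr] ->.
rewrite -e1 take_size_cat // drop_size_cat // s1 hr /= (perm_trans _ p) // perm_cat2l //.
Qed.

Section Shuffles.
Variables (K : fieldType) (R : dgca K) (V : dgmod R) (M : zmodType).
Implicit Types (w : word V) (H : seq (word V) -> M).

Lemma tsum_usp w0 (l : seq nat) (F : word V -> word V -> M) : sorted ltn l ->
  \sum_(p <- usp l)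
     F [seq nth (0, 0) w0 j | j <- p.1] [seq nth (0, 0) w0 j | j <- p.2]
       *~ koszul (unzip1 w0) (p.1 ++ p.2)
  = tsum [seq nth (0, 0) w0 j | j <- l] F.
Proof.
have nE a : (unzip1 w0)`_a = (nth (0, 0) w0 a).1.
  by have [h|h] := ltnP a (size w0); [rewrite (nth_map (0, 0))|rewrite !nth_default ?size_map].
elim: l F => [|m l IH] F sl /=; first by rewrite big_seq1 /= mulr1z.
have lt b : b \in l -> (m < b)%N.
  by have /allP h : all (ltn m) l by [apply: order_path_min sl; exact: ltn_trans]; apply: h.
have mem p b : p \in usp l -> b \in p.1 ++ p.2 -> (m < b)%N.
  by move/usp_perm/perm_mem => -> /lt.
have {}IH F' := IH F' (path_sorted sl).
rewrite big_cat !big_map /= -!IH; congr (_ + _).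
  rewrite big_seq [RHS]big_seq; apply: eq_bigr => p hp /=.
  rewrite [X in X * _]big_seq_cond [X in X * _]big1 ?mul1r // => b.
  by case/andP => /(mem _ _ hp)/ltnW; rewrite leqNgt => /negPf ->.
rewrite big_seq [RHS]big_seq; apply: eq_bigr => p hp /=.
rewrite koszul_insert; first last.
- by move=> a ha; apply: (mem _ _ hp); rewrite mem_cat ha orbT.
- by move=> a ha; apply: (mem _ _ hp); rewrite mem_cat ha.
rewrite (mulrC (koszul _ _)) mulrzA nE; congr (_ *~ ksg (_ * _) *~ _).
by rewrite /deg big_map; apply: eq_bigr.
Qed.

(* [shsum] and its sum over all compositions into k positive parts, computed by
   splitting off one block at a time. *)
Fixpoint shape_sum (sh : seq nat) w H : M :=
  if sh is i :: sh' then
    tsum w (fun b1 b2 => if size b1 == i then shape_sum sh' b2 (fun bs => H (b1 :: bs)) else 0)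
  else if w is [::] then H [::] else 0.

Fixpoint block_sum (k : nat) w H : M :=
  if k is k'.+1 then
    tsum w (fun b1 b2 => if b1 is [::] then 0 else block_sum k' b2 (fun bs => H (b1 :: bs)))
  else if w is [::] then H [::] else 0.

Lemma shufs_shape_sum w0 sh l H : sorted ltn l -> size l = sumn sh ->
  \sum_(s <- shufs sh l)
     H (reshape sh [seq nth (0, 0) w0 j | j <- s]) *~ koszul (unzip1 w0) s
  = shape_sum sh [seq nth (0, 0) w0 j | j <- l] H.
Proof.
elim: sh l H => [|i sh IH] l H sl hl.
  by case: l hl sl => //= _ _; rewrite /shufs /= big_seq1 /= mulr1z.
rewrite (perm_big _ (shufs_cons sh sl _)) /=; last by rewrite hl /= leq_addr.
rewrite big_allpairs_dep /= big_filter big_mkcond -tsum_usp //.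
rewrite big_seq [RHS]big_seq; apply: eq_bigr => -[p1 p2] /=; rewrite mem_usp // => /and3P[/= hp s1 s2].
rewrite size_map; case: eqP => e; last by rewrite mul0rz.
have hp2 : size p2 = sumn sh.
  by have := perm_size hp; rewrite size_cat e hl /=; lia.
rewrite -IH // mulrz_suml big_seq [RHS]big_seq; apply: eq_bigr => s.
rewrite mem_filter mem_permutations => /andP[_ ps].
rewrite map_cat take_size_cat ?size_map // drop_size_cat ?size_map // -mulrzA; congr (_ *~ _).
by have := koszul_cat_perm (unzip1 w0) p1 ps; rewrite (koszul_sorted _ s2) mulr1 mulrC.
Qed.

Lemma shsum_shape_sum sh w H : size w = sumn sh -> shsum sh w H = shape_sum sh w H.
Proof.
move=> e; rewrite /shsum -[shuffles sh]/(shufs sh (iota 0 (sumn sh))).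
rewrite shufs_shape_sum ?iota_ltn_sorted ?size_iota // -e.
by congr shape_sum; apply: (mkseq_nth (0, 0) w).
Qed.

(** The bound [N] is kept apart from [size w]: passing to the second block shortens the word, while
    the index type of the tuples must stay the same. *)
Lemma tuple_block_sum k N w H : (size w <= N)%N ->
  \sum_(t : k.-tuple 'I_N.+1 |
      all (fun i : 'I__ => 0 < i)%N t && (sumn (map val t) == size w))
    shape_sum (map val t) w H = block_sum k w H.
Proof.
elim: k w H => [|k IH] w H hw.
  rewrite big_mkcond (bigD1 (nil_tuple _)) //= big1 ?addr0; last first.
    by move=> t; rewrite (tuple0 t) eqxx.
  by case: w hw.
rewrite big_mkcond (reindex (fun p : 'I_N.+1 * k.-tuple 'I_N.+1 => cons_tuple p.1 p.2)) /=; last first.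
  exists (fun t => (thead t, behead_tuple t)) => [[i t] _|t _] /=.
    by congr (_, _); apply: val_inj.
  by case/tupleP: t => i t; congr cons_tuple; apply: val_inj.
rewrite -(pair_bigA _ (fun (i : 'I_N.+1) (t : k.-tuple 'I_N.+1) =>
  if (0 < i)%N && all (fun i : 'I_N.+1 => 0 < i)%N t && (i + sumn (map val t) == size w)%N
  then tsum w (fun b1 b2 => if size b1 == i then shape_sum (map val t) b2 (fun bs => H (b1 :: bs)) else 0)
  else 0)) /=.
pose C (i : 'I_N.+1) (t : k.-tuple 'I_N.+1) :=
  (0 < i)%N && all (fun i : 'I_N.+1 => 0 < i)%N t && (i + sumn (map val t) == size w)%N.
transitivity (tsum w (fun b1 b2 => \sum_(i < N.+1) \sum_(t : k.-tuple 'I_N.+1)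
    if C i t && (size b1 == i) then shape_sum (map val t) b2 (fun bs => H (b1 :: bs)) else 0)).
  rewrite tsum_sum; apply: eq_bigr => i _; rewrite tsum_sum; apply: eq_bigr => t _.
  rewrite -/(C i t); case: (C i t) => //=; by rewrite tsum0.
apply: eq_tsum => b1 b2 hs _; case: b1 hs => [|x b1] hs.
  rewrite big1 // => i _; rewrite big1 // => t _; rewrite /C.
  by case: i => -[|i] hi //=; rewrite andbF.
have h1 : ((size b1).+1 < N.+1)%N by move: hs hw => /=; lia.
rewrite (bigD1 (Ordinal h1)) //= [X in _ + X]big1 ?addr0; last first.
  move=> i ne; rewrite big1 // => t _; case: eqP => [e|_]; last by rewrite andbF.
  by case/eqP: ne; apply: val_inj.
rewrite -IH; last by move: hs hw => /=; lia.
rewrite [RHS]big_mkcond; apply: eq_bigr => t _; rewrite /C /= eqxx andbT.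
by rewrite -hs /= eqn_add2l.
Qed.
End Shuffles.

(** * Composition sums as corestrictions of cofree extensions *)

Section CompSum.
Variables (K : fieldType) (R : dgca K) (U V : dgmod R).
Hypothesis charK : [pchar K]%R =i pred0.
Implicit Types (w : word U).

Lemma eq_tsum_hword (M : zmodType) w (F F' : word U -> word U -> M) : hword w ->
  (forall b1 b2, hword b1 -> hword b2 -> F b1 b2 = F' b1 b2) -> tsum w F = tsum w F'.
Proof.
elim: w F F' => [|x w IH] F F' hw h /=; first exact: h.
case/andP: hw => hx hw; congr (_ + _); apply: IH => // b1 b2 h1 h2.
  by apply: h => //=; apply/andP.
by rewrite h //; apply/andP.
Qed.

Variable f : seq U -> V.
Hypothesis ml : forall n, (1 <= n)%N -> multilin 0 n f.

Definition letters (bs : seq (word U)) : word V := [seq (deg b, corestr f b) | b <- bs].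

Lemma hword_letters bs : hword (letters bs).
Proof.
rewrite /hword all_map; apply/allP => b _ /=.
by have := mw_deg (corestr_mlw ml) b; rewrite addr0.
Qed.

(** Generalized over the additive map [psi], which absorbs multiplication by the blocks already
    split off. *)
Lemma block_sum_blocks (M : zmodType) k w H (psi : sym V -> M) :
  {morph psi : x y / x + y} -> hword w ->
  (forall bs, size bs = k -> all (fun b => hword b && (0 < size b)%N) bs ->
     H bs = psi (mono (letters bs))) ->
  block_sum k w H = psi (blocks (corestr f) k w).
Proof.
elim: k w H psi => [|k IH] w H psi psiD hw hH /=.
  by case: w hw => [|x w] _; [rewrite (hH [::])|rewrite (morphD0 psiD)].
rewrite (tsum_morph _ _ psiD); apply: eq_tsum_hword => // b1 b2 h1 h2.
case: b1 h1 => [|x b1] h1; first by rewrite lmul0 (morphD0 psiD).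
rewrite (IH _ _ (psi \o lmul (deg (x :: b1), corestr f (x :: b1)))) //.
  by move=> y z /=; rewrite lmulD psiD.
move=> bs hs hbs; rewrite -[RHS]/(psi (lmul _ _)) lmul_mono; apply: (hH ((x :: b1) :: bs)).
  by rewrite /= hs.
by rewrite -cat1s all_cat hbs all_seq1 h1.
Qed.

(** Linearity of [psi] is asked for rational scalars because, besides corestrictions of coalgebra
    morphisms, it will be pr_V D, where [D] differentiates scalars. *)
Lemma comp_sumE (W : dgmod R) (g : seq V -> W) (psi : sym V -> W) w :
  {morph psi : x y / x + y} ->
  (forall n z, psi (rinv R n *: z) = rinv R n *: psi z) ->
  (forall b : word V, hword b -> (0 < size b)%N -> psi (mono b) = g (unzip2 b)) ->
  (0 < size w)%N -> hword w ->
  comp_sum g f w = psi (cofree (corestr f) (mono w)).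
Proof.
move=> psiD psiZ hg w0 hw; have f0 : corestr f [::] = 0 by [].
rewrite cofree_mono; last exact: corestr_mlw.
rewrite /cofree_word (morphD_sum _ _ _ psiD) big_ord_recl /= psiZ.
case: w w0 hw => // x w _ hw; rewrite (morphD0 psiD) scaler0 add0r /comp_sum.
rewrite big_add1 big_mkord; apply: eq_bigr => k _; rewrite psiZ -scaler_sumr; congr (_ *: _).
rewrite -[RHS](@block_sum_blocks _ k.+1 (x :: w) (fun bs => g [seq f (unzip2 b) | b <- bs]) psi) //.
  rewrite -(@tuple_block_sum _ _ _ _ _ (size (x :: w))) //; apply: eq_bigr => t /andP[_ /eqP e].
  by rewrite shsum_shape_sum.
move=> bs hs hbs; rewrite hg ?hword_letters ?size_map ?hs //; congr g.
rewrite /unzip2 -map_comp; apply/eq_in_map => b hb /=.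
by have /allP/(_ _ hb)/andP[h1 h2] := hbs; rewrite corestr_hword.
Qed.
End CompSum.

(** * The codifferential *)

Section CodifferentialTheory.
Variables (K : fieldType) (R : dgca K) (V : dgmod R) (L : linf V).
Implicit Types (z : sym V) (w : word V).
Local Notation D := (Dmap L).
Local Notation q := (with_d (li_q L)).

Lemma dga_d_one : dga_d (1 : R) = 0.
Proof.
have := dga_dM (1 : R) (homR1 R); rewrite !mulr1 mul1r ksg0 mulr1z.
by move/eqP; rewrite -subr_eq0 opprD addNKr oppr_eq0 => /eqP.
Qed.

Lemma dtilD : {morph @dtil _ _ V : z z' / z + z'}.
Proof. exact: sliftD (dtil_bal V). Qed.

Lemma DmapD : {morph D : z z' / z + z'}.
Proof. by move=> z z'; rewrite /Dmap dtilD QD addrACA. Qed.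

Definition dletter w : int * V := (deg w + 1, q (unzip2 (wproj w))).
(** Gathers d_V and all q_n in one family. The zero on the empty block says that there is no
    curvature term, whence D 1 = 0. *)
Definition dblock w z : sym V := if w is [::] then 0 else lmul (dletter w) z.

Lemma Dmap_mono w : D (mono w) = tsum w (fun b1 b2 => dblock b1 (mono b2)).
Proof.
rewrite /Dmap Q_mono Qgen_tsum /dtil /mono (slift_mono _ _ (dtil_bal V)) dtil_genE.
rewrite dga_d_one scale0r add0r -tsum_single -tsumD; apply: eq_tsum => b1 b2 _ _.
rewrite /dblock ginv1 lmul_mono; case: b1 => [|t [|t' b1]] //=; rewrite ?addr0 ?add0r //.
  by rewrite scale1r /dletter deg_cons deg_nil addr0.
by rewrite /coder_term ginv1 scale1r /dletter.
Qed.

Lemma Dmap_nil : D (mono [::]) = 0.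
Proof. by rewrite Dmap_mono. Qed.

Lemma esum_scale w (a : R) (G : int * V -> word V -> sym V) :
  esum w (fun t b => a *: G t b) = a *: esum w G.
Proof.
rewrite -!tsum_single (tsum_morph _ _ (scalerDr a)); apply: eq_tsum => b1 b2 _ _.
by case: b1 => [|? [|? ?]]; rewrite ?scaler0.
Qed.

Lemma Dmap_scale k (a : R) z : homR k a ->
  D (a *: z) = dga_d a *: z + (a *: D z) *~ ksg k.
Proof.
move=> ha; rewrite /Dmap (gm_lin (coder_gmap (Q_coder L)) _ ha) mulr1 scalerDr mulrzDl addrA.
congr (_ + _); move: z; apply: sym_ext => [z z'|z z'|r w]; rewrite ?scalerDr ?dtilD //.
  by rewrite scalerDr mulrzDl addrACA.
rewrite !scale_rmono /dtil !(slift_mono _ _ (dtil_bal V)) !dtil_genE (dga_dM _ ha).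
rewrite !scalerDl scalerDr mulrzDl -!addrA rmonoE; congr (_ + _).
rewrite -scalerMzl scalerA; congr (_ + _); rewrite !esum_scale (ginvMl _ ha).
by rewrite -scalerMzl scalerA.
Qed.

Lemma with_d_hom w : hword w -> (0 < size w)%N -> homm (deg w + 1) (q (unzip2 w)).
Proof.
case: w => [|t [|t' w]] // hw _.
  by case/andP: hw => ht _; rewrite deg_cons deg_nil addr0; apply: dgm_d1.
exact: (ml_deg (@li_ml _ _ _ L (size w).+2 isT) hw (erefl _)).
Qed.

Lemma dletter_hom w : (0 < size w)%N -> homm (dletter w).1 (dletter w).2.
Proof.
move=> w0; have := with_d_hom (hword_wproj w); rewrite deg_wproj size_map; exact.
Qed.

Lemma Dmap_deg m z : homog (sym_gr V) m z -> homog (sym_gr V) (m + 1) (D z).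
Proof.
move/homogE <-; apply/eqP; move: z => /=.
apply: sym_ext => [z z'|z z'|r w].
- by rewrite (sprojD m) DmapD (sprojD (m + 1)).
- by rewrite (sprojD m) DmapD.
apply/eqP; rewrite -[_ == _]/(homog (sym_gr V) (m + 1) _) sproj_mono.
have hr := gproj_homog (dga_gr R) (m - deg w) r; rewrite rmonoE (Dmap_scale _ hr).
apply: homogD.
  rewrite (_ : m + 1 = (m - deg w + 1) + deg w); last by ring.
  exact: (sym_act (dga_d1 hr) (homog_mono w)).
apply: homogMz; rewrite (_ : m + 1 = (m - deg w) + (deg w + 1)); last by ring.
apply: (sym_act hr); rewrite Dmap_mono; apply: homog_tsum => b1 b2 e.
case: b1 e => [|t b1] e; first exact: homog0.
rewrite /dblock lmul_mono (_ : deg w + 1 = deg (dletter (t :: b1) :: b2)); first exact: homog_mono.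
by rewrite (deg_cons (dletter _)) -e /=; ring.
Qed.

Lemma counit_Dmap z : counit (D z) = dga_d (counit z).
Proof.
rewrite /Dmap counitD (coder_counit z (Q_coder L)) addr0.
move: z; apply: sym_ext => [z z'|z z'|r w]; rewrite ?dtilD ?counitD ?dga_dD //.
rewrite /dtil (slift_mono _ _ (dtil_bal V)) dtil_genE counitD counit_rmono esum_scale !counitZ.
have -> : counit (esum w (fun t b => mono ((t.1 + 1, dgm_d (gproj (dgm_gr V) t.1 t.2)) :: b))) = 0.
  rewrite -tsum_single (tsum_morph _ _ (@counitD _ _ _)) -[RHS](tsum0 _ w).
  by apply: eq_tsum => -[|? [|? ?]] b _ _; rewrite ?counit_mono //= (morphD0 (@counitD _ _ _)).
rewrite mulr0 addr0 counit_mono; case: w => [|? ?] /=; rewrite ?mulr1 ?mulr0 //.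
by rewrite (morphD0 (@dga_dD _ R)).
Qed.

Lemma sym_V_D w : sym_V (D (mono w)) = if w is [::] then 0 else q (unzip2 (wproj w)).
Proof.
rewrite Dmap_mono (tsum_morph _ _ (@sym_VD _ _ _)).
rewrite -[RHS](tsum_nilr w (fun w => if w is [::] then 0 else q (unzip2 (wproj w)))).
apply: eq_tsum => b1 b2 _ _; case: b1 => [|t b1] /=.
  by rewrite (morphD0 (@sym_VD _ _ _)); case: b2.
case: b2 => [|u b2]; last by rewrite sym_V_lmul // counit_mono.
by rewrite lmul_mono sym_V_monoE; apply: homogE; apply: dletter_hom.
Qed.

(** The operator D (x) id + id (x) D. Since [D] differentiates scalars, its two summands do not
    descend separately to the tensor product over [R], only their sum does; so it is not a sum of
    two [tmap]. *)
Definition Dmap2 : symsym V -> symsym V :=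
  plift (fun xy => tpure (sym_gr V) (D xy.1) xy.2 +
                   tpure (sym_gr V) (twist (sym_gr V) 1 xy.1) (D xy.2)).

Lemma Dmap2_respects : respects (@tens_rel _ _ (sym V) (sym V) (sym_gr V))
  (fun xy => tpure (sym_gr V) (D xy.1) xy.2 +
                   tpure (sym_gr V) (twist (sym_gr V) 1 xy.1) (D xy.2)).
Proof.
apply: (@tens_respects _ _ _ _ _ _ (fun x y => tpure (sym_gr V) (D x) y +
   tpure (sym_gr V) (twist (sym_gr V) 1 x) (D y))).
- by move=> y x x'; rewrite DmapD twistD !tpureDl addrACA.
- by move=> x y y'; rewrite DmapD !tpureDr addrACA.
move=> k r i x y hr hx; rewrite (twist_homog _ hx) (twist_homog _ (sym_act hr hx)).
rewrite !(Dmap_scale _ hr) !mul1r; move: (Dmap_deg hx); generalize (D x) (D y) => dx dy hdx.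
rewrite tpureDl tpureDr !tpureMzl !tpureMzr.
rewrite (tpureZ _ (dga_d1 hr) hx) (tpureZ _ hr hdx) (tpureZ _ hr hx).
rewrite !mulrzDl !mulrz_ksg2 [in RHS]addrCA -addrA; congr (_ *~ _ + (_ *~ _ + _ *~ _)).
- by congr ksg; ring.
- by apply: (@ksg_even k); ring.
by congr ksg; ring.
Qed.

Lemma Dmap2D : {morph Dmap2 : z z' / z + z'}.
Proof. exact: pliftD Dmap2_respects. Qed.
Lemma Dmap2_pure i x y : homog (sym_gr V) i x -> Dmap2 (tpure (sym_gr V) x y) =
  tpure (sym_gr V) (D x) y + tpure (sym_gr V) x (D y) *~ ksg i.
Proof.
move=> hx; rewrite /Dmap2 plift_gen /=; last exact: Dmap2_respects.
by rewrite (twist_homog _ hx) tpureMzl mul1r.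
Qed.

(** Each term of [D] multiplies the rest of the word by a vector, which is a coderivation.
    Regrouping the threefold splittings collects D (x) id and id (x) D. *)
Lemma cop_D_mono w : cop (D (mono w)) = Dmap2 (cop (mono w)).
Proof.
rewrite Dmap_mono (tsum_morph _ _ (@copD _ _ _)) cop_monoE (tsum_morph _ _ Dmap2D).
transitivity (tsum w (fun a e => tsum e (fun c d =>
    tpure (sym_gr V) (dblock a (mono c)) (mono d))) +
  tsum w (fun a e => tsum e (fun c d =>
    tpure (sym_gr V) (mono c) (dblock a (mono d)) *~ ksg ((deg a + 1) * deg c)))).
  rewrite -tsumD; apply: eq_tsum => a e _ _.
  case: a => [|t a] /=.
    rewrite (morphD0 (@copD _ _ _)) -tsumD -[LHS](tsum0 _ e); apply: eq_tsum => c d _ _.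
    by rewrite tpure0l tpure0r mul0rz addr0.
  have sg_id := tmapDS (lmul_gmap (dletter (t :: a))) (gmap_id (sym_gr V)).
  have id_lmul := tmapDS (gmap_id (sym_gr V)) (lmul_gmap (dletter (t :: a))).
  rewrite (coder_cop _ (lmul_coder _)) cop_monoE (tsum_morph _ _ sg_id) (tsum_morph _ _ id_lmul).
  congr (_ + _); apply: eq_tsum => c d _ _.
    by rewrite (tmap_pureS _ (lmul_gmap _) (gmap_id _) (homog_mono c)) mul0r ksg0 mulr1z.
  by rewrite (tmap_pureS _ (gmap_id _) (lmul_gmap _) (homog_mono c)).
transitivity (tsum w (fun c d => tpure (sym_gr V) (D (mono c)) (mono d)) +
  tsum w (fun c d => tpure (sym_gr V) (mono c) (D (mono d)) *~ ksg (deg c))); last first.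
  rewrite -tsumD; apply: eq_tsum => c d _ _; by rewrite (Dmap2_pure _ (homog_mono c)).
congr (_ + _).
  rewrite -(tsum_assoc w (fun a c d => tpure (sym_gr V) (dblock a (mono c)) (mono d))).
  apply: eq_tsum => c d _ _; rewrite Dmap_mono.
  by rewrite (tsum_morph _ _ (@tpureDl _ _ _ _ (sym_gr V) _)).
transitivity (tsum w (fun c e => tsum e (fun a d =>
    tpure (sym_gr V) (mono c) (dblock a (mono d)) *~ ksg (deg c)))).
  rewrite (tsum_assoc_comm w (fun a c d => tpure (sym_gr V) (mono c) (dblock a (mono d)) *~ ksg (deg c))).
  apply: eq_tsum => a e _ _; apply: eq_tsum => c d _ _.
  by rewrite mulrz_ksg2; congr (_ *~ ksg _); ring.
apply: eq_tsum => c e _ _; rewrite Dmap_mono tsumMz.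
by rewrite (tsum_morph _ _ (@tpureDr _ _ _ _ (sym_gr V) _)).
Qed.

Lemma cop_D z : cop (Dmap L z) = Dmap2 (cop z).
Proof.
move: z; apply: sym_ext => [x y|x y|r w]; [by rewrite DmapD copD|by rewrite copD Dmap2D|].
rewrite rmonoE; move: r; apply: (grade_ext (G := dga_gr R)) => [r r'|r r'|k r hr].
- by rewrite scalerDl DmapD copD.
- by rewrite scalerDl copD Dmap2D.
have D1 := tmapDS (gmap_scale V (dga_d1 hr)) (gmap_id (sym_gr V)).
have D0 := tmapDS (gmap_scale V hr) (gmap_id (sym_gr V)).
rewrite (Dmap_scale _ hr) copD (morphD_mulrz (@copD _ _ V)) !(cop_scale _ hr).
rewrite (cop_scale _ (dga_d1 hr)) cop_D_mono; move: (cop (mono w)).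
apply: tens_ext => [x y|x y|i x y hx].
- by rewrite D1 Dmap2D D0 mulrzDl addrACA.
- by rewrite D0 Dmap2D.
rewrite (tmap_pureS _ (gmap_scale V (dga_d1 hr)) (gmap_id _) hx).
rewrite (tmap_pureS _ (gmap_scale V hr) (gmap_id _) hx) (Dmap2_pure _ hx) D0.
rewrite (morphD_mulrz D0) (tmap_pureS _ (gmap_scale V hr) (gmap_id _) hx).
rewrite (tmap_pureS _ (gmap_scale V hr) (gmap_id _) (Dmap_deg hx)).
rewrite !mul0r ksg0 !mulr1z (Dmap2_pure _ (sym_act hr hx)) (Dmap_scale _ hr) tpureDl tpureMzl.
by rewrite mulrzDl mulrz_ksg2 addrA [k + i]addrC.
Qed.

End CodifferentialTheory.

(** * Morphism equations as compatibility with the codifferentials *)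

Section CodifferentialMorphism.
Variables (K : fieldType) (R : dgca K) (V W : dgmod R) (LV : linf V) (LW : linf W).
Hypothesis charK : [pchar K]%R =i pred0.

Variable F : sym V -> sym W.
Hypotheses (gF : gmap (sym_gr V) (sym_gr W) 0 F) (cF : coalg F).
Hypothesis (F_counit : forall w, counit (F (mono w)) = counit (mono w)).
Hypothesis (F_D : forall w, sym_V (Dmap LW (F (mono w))) = sym_V (F (Dmap LV (mono w)))).

Lemma counit_F z : counit (F z) = counit z.
Proof.
move: z; apply: sym_ext => [x y|x y|r w]; rewrite ?(gm_add gF) ?counitD //.
by rewrite rmonoE (gmap0_lin gF) !counitZ F_counit.
Qed.

Hypothesis F_nil : F (mono [::]) = mono [::].

(** Put X = D F - F D. In mu (pr_V (x) id) Delta X the terms with [D] on the left factor cancel by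
    [F_D]; what remains is the recursion of [conv_uniq]. *)
Lemma Dmap_comm z : Dmap LW (F z) = F (Dmap LV z).
Proof.
suff e w : Dmap LW (F (mono w)) - F (Dmap LV (mono w)) = 0.
  move: z; apply: sym_ext => [x y|x y|r w]; [by rewrite (gm_add gF) DmapD|by rewrite DmapD (gm_add gF)|].
  rewrite rmonoE; move: r; apply: (grade_ext (G := dga_gr R)) => [r r'|r r'|k r hr].
  - by rewrite scalerDl (gm_add gF) DmapD.
  - by rewrite scalerDl DmapD (gm_add gF).
  rewrite (gmap0_lin gF) !(Dmap_scale _ _ hr) (gm_add gF) (morphD_mulrz (gm_add gF)) !(gmap0_lin gF).
  by move/eqP: (e w); rewrite subr_eq0 => /eqP ->.
have FN x : F (- x) = - F x by rewrite -[- x]mulrN1z (morphD_mulrz (gm_add gF)) mulrN1z.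
have sN (x y : sym W) : vmul (sym_V x) (- y) = - vmul (sym_V x) y.
  by rewrite -[- y]mulrN1z (morphD_mulrz (@vmulDr _ _ _ _)) mulrN1z.
move: w; pose X w := Dmap LW (F (mono w)) - F (Dmap LV (mono w)).
have pX w : sym_V (X w) = 0.
  by rewrite /X sym_VD F_D -[- F _]mulrN1z (morphD_mulrz (@sym_VD _ _ _)) mulrN1z subrr.
apply: (@conv_uniq _ _ _ _ charK X (fun a _ z => vmul (sym_V (F (mono a))) z *~ ksg (deg a))) => [b z'|a b|w|w].
- by rewrite F_nil sym_V_monoE (morphD0 (vmulDl _)) mul0rz.
- by rewrite (morphD0 (@vmulDr _ _ _ _)) mul0rz.
- rewrite /X counitD counit_Dmap F_counit -[- F _]mulrN1z (morphD_mulrz (@counitD _ _ _)) counit_F counit_Dmap.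
  by rewrite mulrN1z subrr.
have FF := tmapDS gF gF.
rewrite /X -[- F _]mulrN1z eulerD (morphD_mulrz (@eulerD _ _ _)) -!hmul_cop cop_D !cF cop_D.
rewrite cop_monoE (tsum_morph _ _ FF) (tsum_morph _ _ (@Dmap2D _ _ _ LW)) (tsum_morph _ _ (@Dmap2D _ _ _ LV)).
rewrite (tsum_morph _ _ FF) !(tsum_morph _ _ (@hmulD _ _ _)) -tsumMz -tsumD.
apply: eq_tsum => a b _ _.
have hF : homog (sym_gr W) (deg a) (F (mono a)).
  by have := gm_deg gF (homog_mono a); rewrite addr0.
rewrite (tmap_pureS _ gF gF (homog_mono a)) (Dmap2_pure LV _ (homog_mono a)) FF.
rewrite (morphD_mulrz FF) (tmap_pureS _ gF gF (homog_mono a)).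
rewrite (tmap_pureS _ gF gF (Dmap_deg LV (homog_mono a))) !mul0r ksg0 !mulr1z (Dmap2_pure LW _ hF).
rewrite !hmulD !(morphD_mulrz (@hmulD _ _ _)) !hmul_pure mulrzDl addrACA mulrN1z.
have -> : vmul (sym_V (F (Dmap LV (mono a)))) (F (mono b)) = vmul (sym_V (Dmap LW (F (mono a)))) (F (mono b)).
  by rewrite F_D.
by rewrite subrr add0r vmulDr sN mulrzBl mulrN1z.
Qed.
End CodifferentialMorphism.

Section RightHandSide.
Variables (K : fieldType) (R : dgca K) (V W : dgmod R) (L : linf V).

(** Together with [comp_sumE], this turns the L_infty[1] morphism equations into the equality of the
    corestrictions of D_W F and F D_V on words. *)
Lemma rel_rhsE (g : seq V -> W) (psi : sym V -> W) (w : word V) :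
  {morph psi : x y / x + y} ->
  (forall b : word V, hword b -> (0 < size b)%N -> psi (mono b) = g (unzip2 b)) ->
  hword w ->
  \sum_(1 <= j < (size w).+1) sh2sum j w (fun b1 b2 =>
    g (with_d (li_q L) (unzip2 b1) :: unzip2 b2)) = psi (Dmap L (mono w)).
Proof.
move=> psiD hg hw; rewrite sh2sum_from Dmap_mono (tsum_morph _ _ psiD).
apply: eq_tsum_hword => // b1 b2 h1 h2; case: b1 h1 => [|t b1] h1; first by rewrite /= (morphD0 psiD).
rewrite /dblock lmul_mono hg //; first by rewrite /dletter (wproj_hword h1).
by apply/andP; split=> //; apply: (@dletter_hom _ _ _ L (t :: b1)).
Qed.
End RightHandSide.

(** * From a linearization to a splitting *)

Section ShortExactness.
Variables (K : fieldType) (R : dgca K) (V : dgmod R) (L : linf V).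
Hypothesis charK : [pchar K]%R =i pred0.

Lemma ev1_hom k (u : sym V -> sym V) : coder k u -> homm k (ev1 u).
Proof.
move=> h; have := gm_deg (coder_gmap h) (homog_mono [::]).
by rewrite deg_nil add0r => /(gm_deg (sym_V_gmap V)); rewrite addr0.
Qed.

(* A coderivation maps 1 to a primitive element, and those lie in V. *)
Lemma coder_one k (u : sym V -> sym V) : coder k u -> u (mono [::]) = mono [:: (k, ev1 u)].
Proof.
move=> h; have g := coder_gmap h; have hk := ev1_hom h.
apply/eqP; rewrite -subr_eq0; apply/eqP; apply: (euler_inj charK).
  rewrite -[- mono _]mulrN1z eulerD (morphD_mulrz (@eulerD _ _ _)) euler_mono mulr1n.
  rewrite -hmul_cop (coder_cop _ h) cop_monoE /= hmulD.
  rewrite (tmap_pureS _ g (gmap_id _) (homog_mono [::])) (tmap_pureS _ (gmap_id _) g (homog_mono [::])).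
  rewrite mul0r deg_nil mulr0 ksg0 !mulr1z !hmul_pure sym_V_monoE (morphD0 (vmulDl _)) addr0.
  by rewrite (vmul_homog _ hk) lmul_mono mulrN1z subrr.
by rewrite counitD -[- mono _]mulrN1z (morphD_mulrz (@counitD _ _ _)) (coder_counit _ h) counit_mono mul0rz addr0.
Qed.

(** As D 1 = 0, the commutator at 1 is [D] applied to u(1), which is a vector, and the linear part
    of [D] on V is d_V. *)
Lemma ev1_LD k (u : sym V -> sym V) : coder k u -> ev1 (LD L k u) = dgm_d (ev1 u).
Proof.
move=> h; rewrite {1}/ev1 /LD Dmap_nil (morphD0 (gm_add (coder_gmap h))) mul0rz subr0.
by rewrite (coder_one h) sym_V_D /= (homogE (ev1_hom h)).
Qed.

Lemma ev_short_exact : short_exact (@F1_incl K R V L) (@ev_one K R V L).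
Proof.
split.
- split=> // i u [] //.
- split=> [i u h|i u v hu hv|i k a u ha hu|i u hu]; first exact: ev1_hom.
  + exact: sym_VD.
  + exact: sym_VZ.
  exact: ev1_LD.
- by [].

- move=> k v hv; split=> [e|[u [hu h0] <-]].
    exists v => //; split=> // r; have g := coder_gmap hv; move: r.
    apply: (grade_ext (G := dga_gr R) (h := fun _ => 0)) => [a b|a b|i a ha].
    + by rewrite scalerDl (gm_add g) sym_VD.
    + by rewrite addr0.
    rewrite (gm_lin g _ ha) (morphD_mulrz (@sym_VD _ _ _)) sym_VZ.
    by rewrite -[sym_V _]/(ev_one v) e scaler0 mul0rz.
  by have := h0 1; rewrite scale1r.
(* Multiplication by [c] is a coderivation with value [c] at 1. It need not respect the
   differentials, so surjectivity does not already give a splitting. *)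
move=> k c hc; exists (lmul (k, c)); first exact: (lmul_coder (k, c)).
by rewrite /ev_one /ev1 lmul_mono sym_V_monoE /= (homogE hc).
Qed.
End ShortExactness.

Section Conjugation.
Variables (K : fieldType) (R : dgca K) (V W : dgmod R).

(** In the tensor factor where [phi] does not act, G F = 1 restores the identity. *)
Lemma conj_coder (F : sym V -> sym W) (G : sym W -> sym V) k phi :
  gmap (sym_gr V) (sym_gr W) 0 F -> gmap (sym_gr W) (sym_gr V) 0 G ->
  coalg F -> coalg G -> cancel F G -> coder k phi -> coder k (fun z => G (phi (F z))).
Proof.
move=> gF gG cF cG FK h; have g := coder_gmap h.
have gC : gmap (sym_gr V) (sym_gr V) k (fun z => G (phi (F z))).
  by have := gmap_comp gG (gmap_comp g gF); rewrite add0r addr0.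
apply/coderP; split=> // z; rewrite cG (coder_cop _ h) cF; move: (cop z) => {z}.
have FF := tmapDS gF gF; have GG := tmapDS gG gG.
have p1 := tmapDS g (gmap_id (sym_gr W)); have p2 := tmapDS (gmap_id (sym_gr W)) g.
have c1 := tmapDS gC (gmap_id (sym_gr V)); have c2 := tmapDS (gmap_id (sym_gr V)) gC.
apply: tens_ext => [x y|x y|i x y hx].
- by rewrite FF p1 p2 -GG addrACA.
- by rewrite c1 c2 addrACA.
have hF : homog (sym_gr W) i (F x) by have := gm_deg gF hx; rewrite addr0.
rewrite (tmap_pureS _ gF gF hx) (tmap_pureS _ gC (gmap_id _) hx) (tmap_pureS _ (gmap_id _) gC hx).
rewrite !mul0r ksg0 !mulr1z (tmap_pureS _ g (gmap_id _) hF) (tmap_pureS _ (gmap_id _) g hF).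
rewrite mul0r ksg0 mulr1z GG (morphD_mulrz GG) (tmap_pureS _ gG gG hF).
rewrite (tmap_pureS _ gG gG (gm_deg g hF)) !mul0r ksg0 !mulr1z.
by rewrite !FK.
Qed.
End Conjugation.

Section LinearDifferential.
Variables (K : fieldType) (R : dgca K) (V : dgmod R).
Local Notation D0 := (Dmap (linear_linf V)).

Lemma linear_D_mono (w : word V) :
  D0 (mono w) = esum w (fun t b => lmul (t.1 + 1, dgm_d (gproj (dgm_gr V) t.1 t.2)) (mono b)).
Proof.
rewrite Dmap_mono -tsum_single; apply: eq_tsum => -[|t [|t' b1]] b2 _ _ //=.
  by rewrite /dletter deg_cons deg_nil addr0.
by rewrite /dletter lmul0.
Qed.

(** The relation [D_0, x o -] = (d x) o -, by which multiplication by vectors splits the sequence of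
    the linear structure. *)
Lemma linear_D_lmul i (x : V) z : homm i x ->
  D0 (lmul (i, x) z) = lmul (i + 1, dgm_d x) z + lmul (i, x) (D0 z) *~ ksg i.
Proof.
move=> hx; move: z; apply: sym_ext => [y z|y z|r w].
- by rewrite lmulD DmapD.
- by rewrite DmapD !lmulD mulrzDl addrACA.
rewrite rmonoE; move: r; apply: (grade_ext (G := dga_gr R)) => [a b|a b|k a ha].
- by rewrite scalerDl lmulD DmapD.
- by rewrite scalerDl DmapD !lmulD mulrzDl addrACA.
have e : D0 (lmul (i, x) (mono w)) = lmul (i + 1, dgm_d x) (mono w) + lmul (i, x) (D0 (mono w)) *~ ksg i.
  rewrite lmul_mono linear_D_mono /= (homogE hx); congr (_ + _).
  rewrite linear_D_mono -!tsum_single (tsum_morph _ _ (@lmulD _ _ _ (i, x))) -tsumMz.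
  apply: eq_tsum => -[|t [|t' b1]] b2 _ _; rewrite ?(morphD0 (@lmulD _ _ _ _)) ?mul0rz //.
  rewrite -lmul_mono lmul_comm mulrz_ksg2 /=; congr (_ *~ _).
  by apply: (@ksg_even (i * t.1)); ring.
rewrite (gm_lin (lmul_gmap (i, x)) _ ha) (morphD_mulrz (@DmapD _ _ _ _)) !(Dmap_scale _ _ ha).
rewrite (gm_lin (lmul_gmap (i + 1, dgm_d x)) _ ha) lmulD (morphD_mulrz (@lmulD _ _ _ _)).
rewrite (gm_lin (lmul_gmap (i, x)) _ ha) (gm_lin (lmul_gmap (i, x)) _ (dga_d1 ha)) e /=.
move: (lmul (i, x) (mono w)) (lmul (i + 1, dgm_d x) (mono w)) (lmul (i, x) (D0 (mono w))) => A B C.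
rewrite scalerDr -scalerMzr !mulrzDl !mulrz_ksg2 addrCA; congr (_ *~ _ + (_ *~ _ + _ *~ _)).
- by congr ksg; ring.
- by apply: (@ksg_even (- i)); ring.
by congr ksg; ring.
Qed.
End LinearDifferential.

Section MorphismToCoalgebra.
Variables (K : fieldType) (R : dgca K).
Hypothesis charK : [pchar K]%R =i pred0.

(** The differential of [R] kills the image of [K], by [dga_dZ] and d 1 = 0. *)
Lemma Dmap_rinv (V : dgmod R) (L : linf V) n z : Dmap L (rinv R n *: z) = rinv R n *: Dmap L z.
Proof.
rewrite (Dmap_scale L z (rinv_hom R n)) ksg0 mulr1z /rinv.
by have := dga_dZ (n%:R^-1 : K) (1 : R); rewrite mulr1 dga_d_one mulr0 => ->; rewrite scale0r add0r.
Qed.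

Variables (V W : dgmod R) (f : seq V -> W).
Hypothesis ml : forall n, (1 <= n)%N -> multilin 0 n f.

Lemma cofree1 i (x : V) : homm i x ->
  cofree (corestr f) (mono [:: (i, x)]) = mono [:: (i, f [:: x])].
Proof.
move=> hx; have hf := corestr_mlw ml.
by rewrite cofree_cons //= cofree_nil // lmul_mono /corestr /= (homogE hx) deg_cons deg_nil addr0.
Qed.

Lemma mor_D_comm (LV : linf V) (LW : linf W) (z : sym V) :
  (forall w : word V, (1 <= size w)%N -> hword w ->
    comp_sum (with_d (li_q LW)) f w =
    \sum_(1 <= j < (size w).+1) sh2sum j w (fun b1 b2 =>
      f (with_d (li_q LV) (unzip2 b1) :: unzip2 b2))) ->
  Dmap LW (cofree (corestr f) z) = cofree (corestr f) (Dmap LV z).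
Proof.
move=> rel; have hf := corestr_mlw ml; have gF := cofree_gmap hf.
apply: (Dmap_comm charK gF (cofree_coalg charK hf (erefl _)) (cofree_counit charK hf (erefl _))) => // [w|]; last exact: cofree_nil.
rewrite -mono_wproj; case: w => [|t w]; first by rewrite cofree_nil // !Dmap_nil (morphD0 (gm_add gF)).
have hw := hword_wproj (t :: w); have w0 : (0 < size (wproj (t :: w)))%N by [].
move: hw w0; generalize (wproj (t :: w)) => w' hw w0.
rewrite -(@rel_rhsE _ _ _ _ LV f (fun z => sym_V (cofree (corestr f) z))) //.
- rewrite -rel // (comp_sumE ml (psi := fun z => sym_V (Dmap LW z))) //.
  + by move=> x y; rewrite DmapD sym_VD.
  + by move=> n y; rewrite Dmap_rinv sym_VZ.
  by move=> b hb b0; rewrite sym_V_D; case: b hb b0 => // u b hb _; rewrite (wproj_hword hb).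
- by move=> x y; rewrite (gm_add gF) sym_VD.
by move=> b hb b0; rewrite cofree_corestr // corestr_hword.
Qed.

End MorphismToCoalgebra.

Section Composition.
Variables (K : fieldType) (R : dgca K).
Hypothesis charK : [pchar K]%R =i pred0.

Lemma cofree_cancel (V W : dgmod R) (f : seq V -> W) (g : seq W -> V) :
  (forall n, (1 <= n)%N -> multilin 0 n f) -> (forall n, (1 <= n)%N -> multilin 0 n g) ->
  (forall w : word V, (1 <= size w)%N -> hword w -> comp_sum g f w = linf_id (unzip2 w)) ->
  cancel (cofree (corestr f)) (cofree (corestr g)).
Proof.
move=> mf mg e; have hf := corestr_mlw mf; have hg := corestr_mlw mg.
have gF := cofree_gmap hf; have gG := cofree_gmap hg.
have gGF : gmap (sym_gr V) (sym_gr V) 0 (cofree (corestr g) \o cofree (corestr f)).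
  by have := gmap_comp gG gF; rewrite addr0.
have cGF : coalg (cofree (corestr g) \o cofree (corestr f)).
  by apply: coalg_comp => //; apply: cofree_coalg.
apply: (coalg_uniq charK gGF (gmap_id _) cGF).
- apply/(coalg_monoP (gmap_id _)) => w _; exact: cop_monoE.
- by rewrite /= !cofree_nil.
- by move=> w; rewrite /= (counit_F gG (cofree_counit charK hg (erefl _))) cofree_counit.
move=> w /=; rewrite -mono_wproj; case: w => [|t w]; first by rewrite !cofree_nil.
have hw := hword_wproj (t :: w); have w0 : (0 < size (wproj (t :: w)))%N by [].
rewrite -(comp_sumE mf (g := g) (psi := fun z => sym_V (cofree (corestr g) z))) //.
- by rewrite e // sym_V_monoE; case: w {w0} hw => //= hw; rewrite gprojK eqxx.
- by move=> x y; rewrite (gm_add gG) sym_VD.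
- by move=> n y; rewrite (gmap0_lin gG) sym_VZ.
by move=> b hb b0; rewrite cofree_corestr // corestr_hword.
Qed.
End Composition.

Section LinearizableSplits.
Variables (K : fieldType) (R : dgca K) (V : dgmod R) (L : linf V).
Hypothesis charK : [pchar K]%R =i pred0.

Lemma linearizable_split : linearizable L ->
  split_exact (@F1_incl K R V L) (@ev_one K R V L).
Proof.
case=> f [g [gf fg]]; split; first exact: ev_short_exact.
have mf := lm_ml f; have mg := lm_ml g.
have hf := corestr_mlw mf; have hg := corestr_mlw mg.
set F := cofree (corestr f); set G := cofree (corestr g).
have gF : gmap _ _ 0 F := cofree_gmap hf; have gG : gmap _ _ 0 G := cofree_gmap hg.
have cF : coalg F := cofree_coalg charK hf (erefl _).
have cG : coalg G := cofree_coalg charK hg (erefl _).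
have FK : cancel F G by apply: (cofree_cancel charK mf mg) => w w0 hw; apply: gf.
have DF z : Dmap (linear_linf V) (F z) = F (Dmap L z).
  by apply: (mor_D_comm charK mf) => w w0 hw; apply: lm_rel.
have DG z : Dmap L (G z) = G (Dmap (linear_linf V) z).
  by apply: (mor_D_comm charK mg) => w w0 hw; apply: lm_rel.
have f1 i x : homm i x -> homm i (f [:: x]).
  move=> hx; have := @ml_deg _ _ _ _ _ _ _ (mf 1%N isT) [:: (i, x)].
  by rewrite /= hx deg_cons deg_nil !addr0; apply.
(* The one-letter case of D_0 F = F D says that f_1 is a cochain map. *)
have fd i x : homm i x -> f [:: dgm_d x] = dgm_d (f [:: x]).
  move=> hx; have := DF (mono [:: (i, x)]).
  rewrite /F (cofree1 charK mf hx) linear_D_mono /= Dmap_mono /= (homogE (f1 _ _ hx)) !addr0.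
  rewrite /dblock /dletter /= deg_cons deg_nil addr0 (homogE hx) mulr0 ksg0.
  rewrite mul0rz addr0 !lmul_mono (cofree1 charK mf (dgm_d1 hx)) => /(congr1 (@sym_V _ _ V)).
  rewrite !sym_V_monoE /= (homogE (dgm_d1 (f1 _ _ hx))).
  by rewrite (homogE (f1 _ _ (dgm_d1 hx))).
exists (fun x z => G (vmul (f [:: x]) (F z))); split; first split.
- move=> i u hu /=.
  rewrite (_ : (fun z => _) = fun z => G (lmul (i, f [:: u]) (F z))); last first.
    by rewrite funeqE => z; rewrite (vmul_homog _ (f1 _ _ hu)).
  exact: (conj_coder gF gG cF cG FK (lmul_coder (i, f [:: u]))).
- move=> i u v _ _; rewrite funeqE => z.
  rewrite (@ml_add _ _ _ _ _ _ _ (mf 1%N isT) [::] u v [::]) // vmulDl (gm_add gG) //.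
- move=> i k a u ha _; rewrite funeqE => z.
  have -> := @ml_scale _ _ _ _ _ _ _ (mf 1%N isT) [::] k a u [::] isT ha (erefl _).
  rewrite deg_nil addr0 mulr0 ksg0 mulr1z vmulZl (gmap0_lin gG) //.
(* The two intertwining relations turn [D, G phi F] into G [D_0, phi] F. *)
- move=> i u hu; rewrite funeqE => z /=; rewrite /LD DG -DF -[- _]mulrN1z.
  rewrite (fd _ _ hu) (vmul_homog _ (dgm_d1 (f1 _ _ hu))) !(vmul_homog _ (f1 _ _ hu)).
  rewrite linear_D_lmul; last exact: f1.
  by rewrite (gm_add gG) (morphD_mulrz (gm_add gG)) mulrN1z addrK.
(* [F] sends the one-letter word c to f_1(c), so [G] sends f_1(c) back to c. *)
move=> k c hc; rewrite /ev_one /ev1 /F cofree_nil // (vmul_homog _ (f1 _ _ hc)) lmul_mono.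
by rewrite -(cofree1 charK mf hc) -/F FK sym_V_monoE /= (homogE hc).
Qed.
End LinearizableSplits.

(** * From a splitting to a linearization *)

Section MorphismOfCoalgebraMap.
Variables (K : fieldType) (R : dgca K) (V W : dgmod R).
Hypothesis charK : [pchar K]%R =i pred0.
Variable H : sym V -> sym W.
Hypotheses (gH : gmap (sym_gr V) (sym_gr W) 0 H) (cH : coalg H).
Hypotheses (H1 : H (mono [::]) = mono [::]) (H_counit : forall w, counit (H (mono w)) = counit (mono w)).

Definition taylor (s : seq V) : W := sym_V (H (smono s)).

Lemma taylor_multilin n : multilin 0 n taylor.
Proof.
apply: (@smono_multilin _ _ _ _ _ (fun z => sym_V (H z))).
by have := gmap_comp (sym_V_gmap W) gH; rewrite addr0.
Qed.

Lemma taylor_hword w : hword w -> taylor (unzip2 w) = sym_V (H (mono w)).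
Proof. by move=> hw; rewrite /taylor smono_hword. Qed.

Lemma cofree_taylor : cofree (corestr taylor) =1 H.
Proof.
have hf : mlw (dgm_gr W) 0 (corestr taylor) by apply: corestr_mlw => n _; apply: taylor_multilin.
apply: (coalg_uniq charK (cofree_gmap hf) gH (cofree_coalg charK hf (erefl _)) cH) => [|w|w].
- exact: cofree_nil.
- by rewrite cofree_counit.
rewrite cofree_corestr // -(mono_wproj w); case: w => [|t w]; first by rewrite H1 sym_V_monoE.
by rewrite -taylor_hword ?hword_wproj.
Qed.

Lemma mor_of_coalg (LV : linf V) (LW : linf W) :
  (forall z, Dmap LW (H z) = H (Dmap LV z)) ->
  exists f : linf_mor LV LW, lm_f f = taylor.
Proof.
move=> DH; suff rel (w : word V) : (1 <= size w)%N -> hword w ->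
    comp_sum (with_d (li_q LW)) taylor w =
    \sum_(1 <= j < (size w).+1) sh2sum j w (fun b1 b2 =>
      taylor (with_d (li_q LV) (unzip2 b1) :: unzip2 b2)).
  by exists (LinfMor (fun n _ => taylor_multilin n) rel).
move=> w0 hw; rewrite (@rel_rhsE _ _ _ _ LV taylor (fun z => sym_V (H z))) //.
- rewrite (comp_sumE (fun n _ => taylor_multilin n) (psi := fun z => sym_V (Dmap LW z))) //.
  + by rewrite cofree_taylor DH.
  + by move=> x y; rewrite DmapD sym_VD.
  + by move=> n y; rewrite Dmap_rinv sym_VZ.
  by move=> b hb b0; rewrite sym_V_D; case: b hb b0 => // u b hb _; rewrite (wproj_hword hb).
- by move=> x y; rewrite (gm_add gH) sym_VD.
by move=> b hb _; rewrite taylor_hword.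
Qed.
End MorphismOfCoalgebraMap.

Lemma comp_taylor (K : fieldType) (R : dgca K) (charK : [pchar K]%R =i pred0) (V W : dgmod R)
    (F : sym V -> sym W) (G : sym W -> sym V) (w : word V) :
  gmap (sym_gr V) (sym_gr W) 0 F -> gmap (sym_gr W) (sym_gr V) 0 G ->
  coalg F -> F (mono [::]) = mono [::] -> (forall w, counit (F (mono w)) = counit (mono w)) ->
  cancel F G -> (0 < size w)%N -> hword w ->
  comp_sum (taylor G) (taylor F) w = linf_id (unzip2 w).
Proof.
move=> gF gG cF F1 Fc FK w0 hw.
rewrite (comp_sumE (fun n _ => taylor_multilin gF n) (psi := fun z => sym_V (G z))) //.
- rewrite cofree_taylor // FK sym_V_monoE; case: w w0 hw => // -[i x] [|u w] //= _.
  by rewrite andbT => /homogE.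
- by move=> x y; rewrite (gm_add gG) sym_VD.
- by move=> n y; rewrite (gmap0_lin gG) sym_VZ.
by move=> b hb _; rewrite taylor_hword.
Qed.

(** * Inverting a coalgebra endomorphism with identity linear part *)

Section InverseMorphism.
Variables (K : fieldType) (R : dgca K) (V : dgmod R).
Hypothesis charK : [pchar K]%R =i pred0.
Variable F : sym V -> sym V.
Hypotheses (gF : gmap (sym_gr V) (sym_gr V) 0 F) (cF : coalg F).
Hypotheses (F1 : F (mono [::]) = mono [::]) (F_counit : forall w, counit (F (mono w)) = counit (mono w)).
Hypothesis F_V : forall t, sym_V (F (mono [:: t])) = gproj (dgm_gr V) t.1 t.2.

(** The filtration by word length; as an inductive predicate it spares choosing a presentation of
    each element by words. *)
Inductive fil (n : nat) : sym V -> Prop :=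
| fil0 : fil n 0
| filD z z' : fil n z -> fil n z' -> fil n (z + z')
| fil_mono r w : (size w <= n)%N -> fil n (rmono r w).

Lemma fil_scale n (a : R) z : fil n z -> fil n (a *: z).
Proof.
elim=> [|x y _ hx _ hy|r w hw]; first by rewrite scaler0; apply: fil0.
  by rewrite scalerDr; apply: filD.
by rewrite scale_rmono; apply: fil_mono.
Qed.

Lemma fil_mulrz n z m : fil n z -> fil n (z *~ m).
Proof. by move=> h; rewrite -scaler_int; apply: fil_scale. Qed.

Lemma fil_leq m n z : (m <= n)%N -> fil m z -> fil n z.
Proof.
move=> mn; elim=> [|x y _ hx _ hy|r w hw]; [exact: fil0|exact: filD|].
by apply: fil_mono; apply: leq_trans mn.
Qed.

Lemma fil_tsum n (w : word V) G :
  (forall b1 b2, fil n (G b1 b2)) -> fil n (tsum w G).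
Proof.
elim: w G => [|x w IH] G h //=; apply: filD; apply: IH => // b1 b2; exact: fil_mulrz.
Qed.

Lemma fil_lmul n t z : fil n z -> fil n.+1 (lmul t z).
Proof.
elim=> [|x y _ hx _ hy|r w hw].
- by rewrite (morphD0 (@lmulD _ _ _ _)); apply: fil0.
- by rewrite lmulD; apply: filD.
rewrite /lmul (ext_rmono _ _ (lmul_mlw t)) -rmonoE; exact: fil_mono.
Qed.

Lemma fil_blocks (f : word V -> V) k w : fil k (blocks f k w).
Proof.
elim: k w => [|k IH] w /=.
  by case: w => [|? ?]; [apply: fil_mono|apply: fil0].
by apply: fil_tsum => b1 b2; apply: fil_lmul.
Qed.

(** With as many nonempty blocks as letters, every block is a single letter; each of the n! orders
    contributes the word itself. *)
Lemma blocks_top (f : word V -> V) w : f [::] = 0 ->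
  (forall t, f [:: t] = gproj (dgm_gr V) t.1 t.2) ->
  blocks f (size w) w = mono w *+ (size w)`!.
Proof.
move=> f0 f1; have [n hw] : exists n, size w = n by exists (size w).
rewrite hw; elim: n w hw => [|n IH] w hw.
  by case: w hw.
rewrite /= factS mulrnA -hw -esum_mono -tsum_single pmulrn -tsumMz.
apply: eq_tsum => b1 b2 hs _; case: b1 hs => [|t [|t' b1]] hs.
- by rewrite f0 lmul0 mul0rz.
- rewrite IH; last by move: hs; rewrite hw => -[].
  rewrite pmulrn (morphD_mulrz (@lmulD _ _ _ _)); congr (_ *~ _).
  by rewrite f1 deg_cons deg_nil addr0 lmul_proj lmul_mono; case: t {hs}.
by rewrite blocks_big ?(morphD0 (@lmulD _ _ _ _)) ?mul0rz //; move: hs; rewrite hw /=; lia.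
Qed.

Definition defect z : sym V := z - F z.

Lemma defect_gmap : gmap (sym_gr V) (sym_gr V) 0 defect.
Proof. exact: (gmapD (gmap_id _) (gmapN gF)). Qed.

Lemma defectD : {morph defect : x y / x + y}.
Proof. exact: gm_add defect_gmap. Qed.

(** [F] is the cofree extension of its corestriction. By [blocks_top] its top term is the word
    itself, so only products of fewer blocks, hence shorter words, are left. *)
Lemma defect_mono w : fil (size w).-1 (defect (mono w)).
Proof.
pose f := fun w => sym_V (F (mono w)).
have hf : mlw (dgm_gr V) 0 f.
  have h := gmap_comp (sym_V_gmap V) gF; rewrite addr0 in h.
  exact: (gmap_mlw h).
have f0 : f [::] = 0 by rewrite /f F1 sym_V_monoE.
have FE : F =1 cofree f.
  apply: (coalg_uniq charK gF (cofree_gmap hf) cF (cofree_coalg charK hf f0) F1) => u.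
    by rewrite F_counit cofree_counit.
  by rewrite cofree_corestr.
rewrite /defect FE cofree_mono // /cofree_word big_ord_recr /=.
rewrite (blocks_top _ f0 F_V) (rinvK charK) ?fact_gt0 // opprD addrCA subrr addr0.
rewrite -mulrN1z; apply: fil_mulrz.
apply: (big_ind (fil _)) => [|x y|k _]; [exact: fil0|exact: filD|].
(* The remaining indices satisfy k < size w; for the empty word there are none, so the predecessor
   does no harm. *)
by apply: fil_scale; apply: fil_leq (fil_blocks f k w); case: (size w) k => [[]|n k]//; rewrite -ltnS.
Qed.

Lemma defect_fil n z : fil n z -> fil n.-1 (defect z).
Proof.
elim=> [|x y _ hx _ hy|r w hw].
- by rewrite (morphD0 defectD); apply: fil0.
- by rewrite defectD; apply: filD.
rewrite rmonoE (gmap0_lin defect_gmap); apply: fil_scale.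
by apply: fil_leq (defect_mono w); lia.
Qed.

Lemma defect_fil0 z : fil 0 z -> defect z = 0.
Proof.
elim=> [|x y _ hx _ hy|r w]; first exact: (morphD0 defectD).
  by rewrite defectD hx hy addr0.
case: w => // _; rewrite rmonoE (gmap0_lin defect_gmap) /defect F1 subrr.
exact: scaler0.
Qed.

Lemma iter_defect0 n j z : fil n z -> (n < j)%N -> iter j defect z = 0.
Proof.
have i0 k : iter k defect 0 = 0 by elim: k => //= k ->; exact: (morphD0 defectD).
elim: n j z => [|n IH] [|j] z hz //; rewrite iterSr.
  by rewrite defect_fil0.
by move=> nj; apply: IH => //; apply: defect_fil hz.
Qed.

Lemma iter_defect_gmap j : gmap (sym_gr V) (sym_gr V) 0 (iter j defect).
Proof.
elim: j => [|j IH]; first exact: gmap_id.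
have := gmap_comp defect_gmap IH; rewrite addr0.
by congr (gmap _ _ _ _).
Qed.

(* The Neumann series of F = 1 - (1 - F), finite on each word because 1 - F shortens
   words. *)
Definition neumann : sym V -> sym V :=
  ext 0 (fun w => \sum_(j < (size w).+1) iter j defect (mono w)).

Lemma neumann_mlw : mlw (sym_gr V) 0 (fun w : word V => \sum_(j < (size w).+1) iter j defect (mono w)).
Proof.
apply: (mlw_size (h := fun n w => \sum_(j < n.+1) iter j defect (mono w))) => n.
by apply: mlw_sum => j; apply: gmap_mlw (iter_defect_gmap j).
Qed.

Lemma neumann_gmap : gmap (sym_gr V) (sym_gr V) 0 neumann.
Proof. exact: (ext_gmap (@sym_act _ _ V) neumann_mlw). Qed.

(** F of a word mixes several lengths, so the series must be computed with one truncation valid for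
    all of them; the additional terms vanish. *)
Lemma neumann_fil n z : fil n z -> neumann z = \sum_(j < n.+1) iter j defect z.
Proof.
elim=> [|x y _ hx _ hy|r w hw].
- rewrite (morphD0 (gm_add neumann_gmap)) big1 // => j _.
  exact: (morphD0 (gm_add (iter_defect_gmap j))).
- rewrite (gm_add neumann_gmap) hx hy -big_split; apply: eq_bigr => j _.
  by rewrite (gm_add (iter_defect_gmap j)).
rewrite rmonoE (gmap0_lin neumann_gmap) /neumann (ext_mono _ neumann_mlw) scaler_sumr.
under [RHS]eq_bigr => j _ do rewrite (gmap0_lin (iter_defect_gmap j)).
rewrite -!(big_mkord xpredT (fun j => r *: iter j defect (mono w))).
rewrite [RHS](big_cat_nat (n := (size w).+1)) //= [X in _ + X]big_nat [X in _ + X]big1 ?addr0 // => k /andP[hk _].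
by rewrite (iter_defect0 (n := size w)) ?scaler0 //; apply: fil_mono.
Qed.

Lemma fil_mono1 w : fil (size w) (mono w).
Proof. exact: fil_mono. Qed.

Lemma neumannK : cancel neumann F.
Proof.
have gC := gmap_comp gF neumann_gmap; rewrite addr0 in gC.
apply: (gmap_sym_ext gC (gmap_id _)) => w _ /=.
rewrite (neumann_fil (fil_mono1 w)) (morphD_sum _ _ _ (gm_add gF)).
have FE x : F x = x - defect x by rewrite /defect opprB addrC subrK.
under eq_bigr => j _ do rewrite FE.
rewrite -(big_mkord xpredT (fun j => iter j defect (mono w) - defect (iter j defect (mono w)))).
rewrite (telescope_big (fun i j => iter i defect (mono w) - iter j defect (mono w))) //=.
  by rewrite -iterS (iter_defect0 (fil_mono1 w)) // subr0.
by move=> i _; rewrite addrA subrK.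
Qed.

Lemma Fneumann : cancel F neumann.
Proof.
have gC := gmap_comp neumann_gmap gF; rewrite addr0 in gC.
apply: (gmap_sym_ext gC (gmap_id _)) => w _ /=.
have FE x : F x = x - defect x by rewrite /defect opprB addrC subrK.
have hF : fil (size w) (F (mono w)).
  rewrite FE -[- _]mulrN1z; apply: filD; first exact: fil_mono1.
  by apply: fil_mulrz; apply: fil_leq (defect_mono w); lia.
rewrite (neumann_fil hF).
under eq_bigr => j _ do rewrite FE -[- _]mulrN1z (gm_add (iter_defect_gmap j))
  (morphD_mulrz (gm_add (iter_defect_gmap j))) mulrN1z -iterSr.
rewrite -(big_mkord xpredT (fun j => iter j defect (mono w) - iter j.+1 defect (mono w))).
rewrite (telescope_big (fun i j => iter i defect (mono w) - iter j defect (mono w))) //=.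
  by rewrite -iterS (iter_defect0 (fil_mono1 w)) // subr0.
by move=> i _; rewrite addrA subrK.
Qed.

(** With G the inverse of F, apply (G (x) G)(F (x) F) = id to Delta F G = (F (x) F) Delta G. *)
Lemma neumann_coalg : coalg neumann.
Proof.
move=> z; have GG := tmapDS neumann_gmap neumann_gmap; have FF := tmapDS gF gF.
have E c : tmapS 0 neumann neumann (tmapS 0 F F c) = c.
  move: c; apply: tens_ext => [x y|x y|i x y hx]; rewrite ?FF ?GG //.
  have hF : homog (sym_gr V) i (F x) by have := gm_deg gF hx; rewrite addr0.
  rewrite (tmap_pureS _ gF gF hx) mul0r ksg0 mulr1z.
  by rewrite (tmap_pureS _ neumann_gmap neumann_gmap hF) mul0r ksg0 mulr1z !Fneumann.
by rewrite -{2}(neumannK z) cF E.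
Qed.

Lemma neumann_nil : neumann (mono [::]) = mono [::].
Proof. by rewrite -{1}F1 Fneumann. Qed.

Lemma neumann_counit w : counit (neumann (mono w)) = counit (mono w).
Proof. by rewrite -(counit_F gF F_counit) neumannK. Qed.
End InverseMorphism.

(** * The exponential of a section *)

Section ExponentialOfSection.
Variables (K : fieldType) (R : dgca K) (V : dgmod R) (L : linf V).
Hypothesis charK : [pchar K]%R =i pred0.
Variable s : V -> sym V -> sym V.
Hypotheses (s_coder : forall k x, homm k x -> coder k (s x))
  (s_add : forall k x y z, homm k x -> homm k y -> s (x + y) z = s x z + s y z)
  (s_scale : forall i k (a : R) x z, homR k a -> homm i x -> s (a *: x) z = a *: s x z)
  (s_d : forall i x z, homm i x -> s (dgm_d x) z = LD L i (s x) z)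
  (s_ev : forall k x, homm k x -> ev1 (s x) = x).

Definition sect (t : int * V) : sym V -> sym V := s (gproj (dgm_gr V) t.1 t.2).

Lemma sect_coder t : coder t.1 (sect t).
Proof. by apply: s_coder; apply: gproj_homog. Qed.
Lemma sect_gmap t : gmap (sym_gr V) (sym_gr V) t.1 (sect t).
Proof. exact: coder_gmap (sect_coder t). Qed.
Lemma sectD t : {morph sect t : z z' / z + z'}.
Proof. exact: gm_add (sect_gmap t). Qed.

(** Being zero off the one-letter blocks, it turns a sum over splittings into a sum over the choice
    of one letter. *)
Definition sblock (b : word V) (z : sym V) : sym V := if b is [:: t] then sect t z else 0.

Lemma coder0 k : coder k (fun _ : sym V => 0 : sym V).
Proof.
have [h1 h2 h3] := gmap0 (sym_gr V) (sym_gr V) k; split=> // w _.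
rewrite (morphD0 (@copD _ _ _)) sh2sum_all -[LHS](tsum0 _ w); apply: eq_tsum => b1 b2 _ _.
by rewrite tpure0l tpure0r mul0rz addr0.
Qed.

Lemma sblock_coder b : coder (deg b) (sblock b).
Proof.
case: b => [|t [|u b]]; try exact: coder0.
by rewrite deg_cons deg_nil addr0; apply: sect_coder.
Qed.

Lemma sblock_gmap b : gmap (sym_gr V) (sym_gr V) (deg b) (sblock b).
Proof. exact: coder_gmap (sblock_coder b). Qed.

Lemma sblock_wlin z : wlin 0 (fun b => sblock b z).
Proof.
split=> [w1 i x y w2|w1 i x w2|w1 k a i x w2 ha hx|w1 i x j y w2].
- case: w1 => [|? [|? ?]]; case: w2 => [|? ?] /=; rewrite ?addr0 //.
  by rewrite /sect gprojD (s_add z (gproj_homog _ i x) (gproj_homog _ i y)).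
- by case: w1 => [|? [|? ?]]; case: w2 => [|? ?] //=; rewrite /sect /= gprojK eqxx.
- case: w1 => [|? [|? ?]]; case: w2 => [|? ?] /=; rewrite ?scaler0 ?mul0rz //.
  rewrite deg_nil addr0 mulr0 ksg0 mulr1z /sect /= gproj_scale //.
  by rewrite (s_scale z ha (gproj_homog _ i x)).
by case: w1 => [|? [|? ?]]; case: w2 => [|? ?] /=; rewrite ?mul0rz.
Qed.

(* (1/n!) \sum eps s(x_1) ... s(x_n) 1 over the orderings of the letters of w. *)
Fixpoint expn_word (n : nat) (w : word V) : sym V :=
  if n is n'.+1 then rinv R n *: tsum w (fun b1 b2 => sblock b1 (expn_word n' b2))
  else if w is [::] then mono [::] else 0.
Definition exp_word (w : word V) : sym V := expn_word (size w) w.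
Definition sexp : sym V -> sym V := ext 0 exp_word.

Lemma expn_word_mlw n : mlw (sym_gr V) 0 (expn_word n).
Proof.
elim: n => [|n IH]; first exact: (blocks_mlw (mlw0 V (dgm_gr V) 0) 0).
apply: (mlw_scale0 (@sym_act _ _ V) (rinv_hom R _)).
apply: mlw_tsum => [b|b|b1 b2].
- exact: sblock_wlin.
- by apply: wlin_gmap; [apply: sblock_gmap|exact: IH].
rewrite addr0 addrC; apply: (gm_deg (sblock_gmap b1)).
by have := mw_deg IH b2; rewrite addr0.
Qed.

Lemma exp_word_mlw : mlw (sym_gr V) 0 exp_word.
Proof. exact: mlw_size expn_word_mlw. Qed.
Lemma sexp_gmap : gmap (sym_gr V) (sym_gr V) 0 sexp.
Proof. exact: (ext_gmap (@sym_act _ _ V) exp_word_mlw). Qed.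

Lemma sexp_nil : sexp (mono [::]) = mono [::].
Proof. by rewrite /sexp (ext_mono _ exp_word_mlw). Qed.

(** The differential equation of the exponential: E composed with the Euler derivation is the
    convolution of s with E. The counit, coalgebra and cochain properties of E follow from it, with
    division by the length at the end. *)
Lemma sexp_rec w : sexp (mono w) *+ size w =
  tsum w (fun b1 b2 => sblock b1 (sexp (mono b2))).
Proof.
case: w => [|t w]; first by rewrite mulr0n.
rewrite {1}/sexp (ext_mono _ exp_word_mlw) /exp_word.
rewrite -[expn_word _ _]/(rinv R (size w).+1 *: tsum (t :: w) (fun b1 b2 => sblock b1 (expn_word (size w) b2))).
rewrite scalerMnr (rinvK charK) //; apply: eq_tsum => b1 b2 hs _.
case: b1 hs => [|u [|? ?]] //= hs; have -> : size w = size b2 by lia.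
by rewrite /sexp (ext_mono _ exp_word_mlw).
Qed.

Lemma natmul_inj n (x y : sym V) : (0 < n)%N -> x *+ n = y *+ n -> x = y.
Proof. by move=> n0 e; rewrite -(rinvK charK x n0) e rinvK. Qed.

Lemma sexp_counit w : counit (sexp (mono w)) = counit (mono w).
Proof.
case: w => [|t w]; first by rewrite sexp_nil.
rewrite [RHS]counit_mono /= -(rinvK charK (sexp _) (ltn0Sn (size w))) counitZ.
rewrite -[(size w).+1]/(size (t :: w)) sexp_rec (tsum_morph _ _ (@counitD _ _ _)).
rewrite (_ : tsum _ _ = 0) ?mulr0 // -[RHS](tsum0 _ (t :: w)).
apply: eq_tsum => b1 b2 _ _; case: b1 => [|u [|? ?]] /=; try exact: (morphD0 (@counitD _ _ _)).
exact: (coder_counit _ (sect_coder u)).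
Qed.

Lemma sexp_V t : sym_V (sexp (mono [:: t])) = gproj (dgm_gr V) t.1 t.2.
Proof.
have := sexp_rec [:: t]; rewrite mulr1n /= mul0rz addr0 sexp_nil => ->.
exact: s_ev (gproj_homog _ _ _).
Qed.

Lemma sexp_hom w : homog (sym_gr V) (deg w) (sexp (mono w)).
Proof. by have := gm_deg sexp_gmap (homog_mono w); rewrite addr0. Qed.

(** After multiplication by the length n, the two terms of the coderivation identity carry the
    lengths of the left and of the right block as factors, and these add up to n. *)
Lemma sexp_coalg : coalg sexp.
Proof.
apply/(coalg_monoP sexp_gmap) => w _.
elim: {w}(size w).+1 {-2}w (ltnSn (size w)) => // n IH w lwn.
case: (posnP (size w)) => [/size0nil ->|w0].
  by rewrite sexp_nil cop_monoE /= sexp_nil.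
pose TP c d := tpure (sym_gr V) (sexp (mono c)) (sexp (mono d)).
have e : cop (sexp (mono w) *+ size w) = tsum w (fun c d => TP c d *~ size w).
  rewrite sexp_rec (tsum_morph _ _ (@copD _ _ _)).
  transitivity (tsum w (fun a e => tsum e (fun c d =>
      tpure (sym_gr V) (sblock a (sexp (mono c))) (sexp (mono d)))) +
    tsum w (fun a e => tsum e (fun c d =>
      tpure (sym_gr V) (sexp (mono c)) (sblock a (sexp (mono d))) *~ ksg (deg a * deg c)))).
    rewrite -tsumD; apply: eq_tsum => a e hs _.
    case: a hs => [|t a] hs.
      rewrite /= (morphD0 (@copD _ _ _)) -tsumD -[LHS](tsum0 _ e); apply: eq_tsum => c d _ _.
      by rewrite tpure0l tpure0r mul0rz addr0.
    rewrite (coder_cop _ (sblock_coder _)) IH; last by move: hs lwn => /=; lia.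
    have g := sblock_gmap (t :: a).
    rewrite (tsum_morph _ _ (tmapDS g (gmap_id (sym_gr V)))) (tsum_morph _ _ (tmapDS (gmap_id (sym_gr V)) g)).
    congr (_ + _); apply: eq_tsum => c d _ _.
      by rewrite (tmap_pureS _ g (gmap_id _) (sexp_hom c)) mul0r ksg0 mulr1z.
    by rewrite (tmap_pureS _ (gmap_id _) g (sexp_hom c)).
  transitivity (tsum w (fun c d => TP c d *~ size c) + tsum w (fun c d => TP c d *~ size d)); last first.
    rewrite -tsumD; apply: eq_tsum => c d <- _; by rewrite -mulrzDr PoszD.
  congr (_ + _).
    rewrite -(tsum_assoc w (fun a c d => tpure (sym_gr V) (sblock a (sexp (mono c))) (sexp (mono d)))).
    apply: eq_tsum => c d _ _; rewrite /TP -tpureMzl -pmulrn sexp_rec.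
    by rewrite (tsum_morph _ _ (@tpureDl _ _ _ _ (sym_gr V) _)).
  rewrite -(tsum_assoc_comm w (fun a c d => tpure (sym_gr V) (sexp (mono c)) (sblock a (sexp (mono d))))).
  apply: eq_tsum => c d _ _; rewrite /TP -tpureMzr -pmulrn sexp_rec.
  by rewrite (tsum_morph _ _ (@tpureDr _ _ _ _ (sym_gr V) _)).
rewrite -{1}(rinvK charK (sexp (mono w)) w0) (cop_scale _ (rinv_hom R _)) e.
have g := gmap_scale V (rinv_hom R (size w)); have gD := tmapDS g (gmap_id (sym_gr V)).
rewrite (tsum_morph _ _ gD); apply: eq_tsum => c d _ _; rewrite /TP -tpureMzl.
have hc : homog (sym_gr V) (deg c) (sexp (mono c) *~ size w) by apply: homogMz; apply: sexp_hom.
by rewrite (tmap_pureS _ g (gmap_id _) hc) mul0r ksg0 mulr1z -pmulrn rinvK.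
Qed.

Lemma Dmap_sect t z : Dmap L (sect t z) =
  sect (t.1 + 1, dgm_d (gproj (dgm_gr V) t.1 t.2)) z + sect t (Dmap L z) *~ ksg t.1.
Proof.
have h := gproj_homog (dgm_gr V) t.1 t.2.
by rewrite {2}/sect /= (homogE (dgm_d1 h)) (s_d _ h) /LD subrK.
Qed.

(** The empty word encodes a block that is not a single letter; it is read as the contribution 0
    below. *)
Definition dsingle (b : word V) : word V :=
  if b is [:: t] then [:: (t.1 + 1, dgm_d (gproj (dgm_gr V) t.1 t.2))] else [::].

Lemma linear_D_single (w : word V) : Dmap (linear_linf V) (mono w) =
  tsum w (fun a e => if dsingle a is [:: u] then mono (u :: e) else 0).
Proof.
rewrite linear_D_mono -tsum_single; apply: eq_tsum => -[|t [|? ?]] e _ _ //=.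
by rewrite lmul_mono.
Qed.

(** [D] passes s(x) at the cost of s(d x), and then acts on E of a shorter word. On the other side
    [sexp_rec] is applied to words with one differentiated letter, which is either the letter picked
    by s or one of the others. *)
Lemma sexp_D z : Dmap L (sexp z) = sexp (Dmap (linear_linf V) z).
Proof.
suff e w : Dmap L (sexp (mono w)) = sexp (Dmap (linear_linf V) (mono w)).
  move: z; apply: sym_ext => [x y|x y|r w]; [by rewrite (gm_add sexp_gmap) DmapD|by rewrite DmapD (gm_add sexp_gmap)|].
  rewrite rmonoE; move: r; apply: (grade_ext (G := dga_gr R)) => [r r'|r r'|k r hr].
  - by rewrite scalerDl (gm_add sexp_gmap) DmapD.
  - by rewrite scalerDl DmapD (gm_add sexp_gmap).
  rewrite (gmap0_lin sexp_gmap) !(Dmap_scale _ _ hr) (gm_add sexp_gmap).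
  by rewrite (morphD_mulrz (gm_add sexp_gmap)) !(gmap0_lin sexp_gmap) e.
elim: {w}(size w).+1 {-2}w (ltnSn (size w)) => // n IH w lwn.
case: (posnP (size w)) => [/size0nil ->|w0].
  by rewrite sexp_nil !Dmap_nil (morphD0 (gm_add sexp_gmap)).
apply: (natmul_inj w0); rewrite pmulrn -(morphD_mulrz (@DmapD _ _ _ L)) -pmulrn sexp_rec.
rewrite (tsum_morph _ _ (@DmapD _ _ _ L)).
transitivity (tsum w (fun a e => sblock (dsingle a) (sexp (mono e))) +
  tsum w (fun a e => tsum e (fun b f =>
    (if dsingle b is [:: u] then sblock a (sexp (mono (u :: f))) else 0) *~ ksg (deg a)))).
  rewrite -tsumD; apply: eq_tsum => a e hs _; case: a hs => [|t [|? ?]] hs.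
  - rewrite /= (morphD0 (@DmapD _ _ _ L)) -[LHS](tsum0 _ e) add0r; apply: eq_tsum => b f _ _.
    by case: (dsingle b) => [|? [|? ?]]; rewrite mul0rz.
  - rewrite /= Dmap_sect IH; last by move: hs lwn => /=; lia.
    congr (_ + _); rewrite deg_cons deg_nil addr0 tsumMz; congr (_ *~ _).
    rewrite linear_D_single (tsum_morph _ _ (gm_add sexp_gmap)) (tsum_morph _ _ (@sectD t)).
    apply: eq_tsum => b f _ _; case: (dsingle b) => [|u [|? ?]] //;
      by rewrite (morphD0 (gm_add sexp_gmap)) (morphD0 (@sectD t)).
  rewrite /= (morphD0 (@DmapD _ _ _ L)) -[LHS](tsum0 _ e) add0r; apply: eq_tsum => b f _ _.
  by case: (dsingle b) => [|? [|? ?]]; rewrite mul0rz.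
rewrite linear_D_single (tsum_morph _ _ (gm_add sexp_gmap)) pmulrn -tsumMz.
pose C a b f := if dsingle b is [:: u] then sblock a (sexp (mono (u :: f))) else 0.
transitivity (tsum w (fun b e => sblock (dsingle b) (sexp (mono e))) +
  tsum w (fun b e => tsum e (fun a f => C a b f *~ ksg ((deg b + 1) * deg a)))).
  congr (_ + _); rewrite (tsum_assoc_comm w (fun a b f => C a b f *~ ksg ((deg b + 1) * deg a))).
  apply: eq_tsum => a e _ _; apply: eq_tsum => b f _ _; rewrite mulrz_ksg2; congr (_ *~ _).
  by apply/esym/(@ksg_even (deg a * deg b)); ring.
rewrite -tsumD; apply: eq_tsum => b e hs _; rewrite /C.
case: b hs => [|t [|? ?]] hs /=;
  try by rewrite (morphD0 (gm_add sexp_gmap)) mul0rz add0r -[RHS](tsum0 _ e);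
     apply: eq_tsum => a f _ _; rewrite mul0rz.
set u := (t.1 + 1, _); rewrite deg_cons deg_nil addr0.
(* Replacing a letter by its differential keeps the length, so the factor n is the one of [sexp_rec]
   for [u :: e]. *)
have -> : size w = size (u :: e) by rewrite -hs.
rewrite -pmulrn sexp_rec /=; congr (_ + _).
rewrite -[LHS](tsum_nil e (fun f => sect u (sexp (mono f)))); apply: eq_tsum => b1 b2 _ _.
by case: b1.
Qed.
End ExponentialOfSection.

Lemma split_linearizable (K : fieldType) (charK : [pchar K]%R =i pred0) (R : dgca K)
    (V : dgmod R) (L : linf V) :
  split_exact (@F1_incl K R V L) (@ev_one K R V L) -> linearizable L.
Proof.
case=> _ [s [[s1 s2 s3 s4] s5]].
have sA k x y z : homm k x -> homm k y -> s (x + y) z = s x z + s y z.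
  by move=> hx hy; rewrite (s2 _ _ _ hx hy).
have sZ i k (a : R) x z : homR k a -> homm i x -> s (a *: x) z = a *: s x z.
  by move=> ha hx; rewrite (s3 _ _ _ _ ha hx).
have sd i x z : homm i x -> s (dgm_d x) z = LD L i (s x) z.
  by move=> hx; rewrite (s4 _ _ hx).
pose E := sexp s; have gE : gmap _ _ 0 E := sexp_gmap s1 sA sZ.
have cE : coalg E := sexp_coalg charK s1 sA sZ.
have E1 : E (mono [::]) = mono [::] := sexp_nil s1 sA sZ.
have Ec w : counit (E (mono w)) = counit (mono w) := sexp_counit charK s1 sA sZ w.
have EV t : sym_V (E (mono [:: t])) = gproj (dgm_gr V) t.1 t.2 := sexp_V charK s1 sA sZ s5 t.
have ED z : Dmap L (E z) = E (Dmap (linear_linf V) z) := sexp_D charK s1 sA sZ sd z.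
have gG := neumann_gmap gE; have cG := neumann_coalg charK gE cE E1 Ec EV.
have EK := Fneumann charK gE cE E1 Ec EV; have GK := neumannK charK gE cE E1 Ec EV.
have G1 := neumann_nil charK gE cE E1 Ec EV; have Gc := neumann_counit charK gE cE E1 Ec EV.
have GD z : Dmap (linear_linf V) (neumann E z) = neumann E (Dmap L z).
  by rewrite -[in RHS](GK z) ED EK.
have [g eg] := mor_of_coalg charK gG cG G1 Gc GD.
have [e ee] := mor_of_coalg charK gE cE E1 Ec ED.
(* E goes from the linear structure to [L], so the isomorphism out of [L] is its inverse. *)
exists g, e; split=> w w0 hw; rewrite eg ee.
  exact: (comp_taylor charK gG gE cG G1 Gc GK w0 hw).
exact: (comp_taylor charK gE gG cE E1 Ec EK w0 hw).
Qed.

Theorem theorem2 (K : fieldType) (charK : [pchar K]%R =i pred0) (R : dgca K)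
    (V : dgmod R) (L : linf V) :
  linearizable L <-> split_exact (@F1_incl K R V L) (@ev_one K R V L).
Proof. by split; [exact: linearizable_split|exact: split_linearizable]. Qed.
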